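(* (i) Let $B>0$ and suppose that $J_{B,1} > \frac{B}{\pi}$. Then every maximizing sequence for $J_{B,1}$ has a subsequence which, after translations in Fourier space, converges in $L^2(\mathbb T)$ to a maximizer for $J_{B,1}$. That is, if $\{u_j\}_{j\in\mathbb N}\subset L^2(\mathbb T)$ satisfies $\|u_j\|_{L^2}=1$ for all $j$ and $\lim_{j\to\infty}W_B(u_j)=J_{B,1}$, then there exist a subsequence $\{u_{j_k}\}$ and a sequence of integers $\{\theta_k\}$ such that $\{e^{i\theta_k x}u_{j_k}(x)\}$ converges strongly in $L^2(\mathbb T)$ to a maximizer for $J_{B,1}$. In particular, there exists $u_0\in L^2(\mathbb T)$ with $\|u_0\|_{L^2}=1$ and $W_B(u_0)=J_{B,1}$. (ii) For all $B>0$, $J_{B,1}\ge \frac{B}{\pi}$. (iii) If $B>0$ and $J_{B,1}=\frac{B}{\pi}$, then there exist maximizing sequences for $J_{B,1}$ which do not have any subsequences that can be made to converge by translating the terms in Fourier space; that is, there exist maximizing sequences $\{u_j\}$ such that for no subsequence $\{u_{j_k}\}$ and no sequence of integers $\{\theta_k\}$ does $\{e^{i\theta_k x}u_{j_k}(x)\}$ converge strongly in $L^2(\mathbb T)$.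
   Context: $\mathbb T=\mathbb R/(2\pi\mathbb Z)$. $L^2(\mathbb T)$ is the space of complex-valued, measurable, $2\pi$-periodic functions that are square-integrable on $[0,2\pi]$, with $\|u\|_{L^2}^2=\int_{\mathbb T}|u(x)|^2\,dx$. Fourier coefficients: $\hat u(n)=\frac1{2\pi}\int_{\mathbb T}e^{-inx}u(x)\,dx$, $n\in\mathbb Z$. For $t\in\mathbb R$, $T_t:L^2(\mathbb T)\to L^2(\mathbb T)$ is defined by $\widehat{T_tu}(n)=e^{-in^2t}\hat u(n)$, $n \in \mathbb Z$. For $B>0$, $W_B(u)=\int_0^B\int_{\mathbb T}|T_tu(x)|^4\,dx\,dt$, and for $\lambda>0$, $J_{B,\lambda}=\sup\{W_B(u):u\in L^2(\mathbb T),\ \|u\|_{L^2}^2=\lambda\}$. A maximizing sequence for $J_{B,\lambda}$ is a sequence $\{u_j\}_{j\in\mathbb N}$ in $L^2(\mathbb T)$ with $\|u_j\|_{L^2}^2=\lambda$ for all $j$ and $W_B(u_j)\to J_{B,\lambda}$. A maximizer for $J_{B,\lambda}$ is $u_0\in L^2(\mathbb T)$ with $\|u_0\|_{L^2}^2=\lambda$ and $W_B(u_0)=J_{B,\lambda}$. A translation in Fourier space of $u$ by $m\in\mathbb Z$ is the function $e^{imx}u(x)$. *)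

(* Defs.v *)
From HB Require Import structures.
From mathcomp Require Import all_boot all_order all_algebra.
From mathcomp Require Import all_classical all_reals all_analysis.
From mathcomp Require Export complex.
Set Implicit Arguments.
Unset Strict Implicit.
Unset Printing Implicit Defensive.
Import Order.TTheory GRing.Theory Num.Theory numFieldNormedType.Exports.
Local Open Scope classical_set_scope.
Local Open Scope complex_scope.
Local Open Scope ring_scope.

(* The modulus [Normc.normc] takes values in [R], whereas the generic norm
   [`|z|] of [R[i]] takes values in [R[i]]. *)
Notation cmod := (@ComplexField.Normc.normc _).

Section circle.
Context {R : realType}.
Implicit Types (u v : R -> R[i]) (B lam t x : R) (n m : int).

Definition expi x : R[i] := cos x +i* sin x.

(* Integration over the circle is integration over one period. *)
Definition period : set R := `[0, 2 * pi].

Definition cmeasurable u :=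
  measurable_fun [set: R] (fun x => complex.Re (u x)) /\
  measurable_fun [set: R] (fun x => complex.Im (u x)).

Definition cintegral (D : set R) u : R[i] :=
  (\int[lebesgue_measure]_(x in D) complex.Re (u x)) +i*
  (\int[lebesgue_measure]_(x in D) complex.Im (u x)).

Definition L2norm u : \bar R :=
  ((\int[lebesgue_measure]_(x in period) (cmod (u x) ^+ 2)%:E) `^ 2^-1)%E.

(* Elements of L2 of the circle are represented by functions rather than by
   classes for equality almost everywhere; everything below is invariant
   under a change of representative. *)
Definition L2T u :=
  [/\ forall x, u (x + 2 * pi) = u x, cmeasurable u & (L2norm u < +oo)%E].

Definition fourier_coef u n : R[i] :=
  ((2 * pi)^-1)%:C * cintegral period (fun x => expi (- (n%:~R * x)) * u x).

(* A representative is chosen with [xget]: by the Riesz-Fischer theorem the set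
   is nonempty when [u] is in L2, and its elements agree almost everywhere. *)
Definition schrodinger t u : R -> R[i] :=
  xget (fun=> 0) [set v | L2T v /\
    forall n, fourier_coef v n = expi (- (n%:~R ^+ 2 * t)) * fourier_coef u n].

Definition W B u : \bar R :=
  (\int[lebesgue_measure]_(t in `[0%R, B])
     \int[lebesgue_measure]_(x in period) (cmod (schrodinger t u x) ^+ 4)%:E)%E.

Definition J B lam : \bar R :=
  ereal_sup [set W B u | u in [set u | L2T u /\ (L2norm u ^+ 2)%E = lam%:E]].

Definition maximizing_sequence B lam (u_ : nat -> R -> R[i]) :=
  (forall j, L2T (u_ j) /\ (L2norm (u_ j) ^+ 2)%E = lam%:E) /\
  W B (u_ j) @[j --> \oo] --> J B lam.

Definition maximizer B lam u :=
  [/\ L2T u, (L2norm u ^+ 2)%E = lam%:E & W B u = J B lam].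

Definition fourier_translate m u : R -> R[i] := fun x => expi (m%:~R * x) * u x.

Definition L2cvg (u_ : nat -> R -> R[i]) u :=
  L2norm (fun x => u_ k x - u x) @[k --> \oo] --> 0%E.

End circle.

(* Main.v *)
(* By Plancherel, a function of L2 is a square-summable sequence [c], and on
   trigonometric polynomials W_B is the quartic form
     2 pi Re sum_{n+j=m+l} c_n c_j c_m^* c_l^* int_0^B e^{2i(m-n)(m-j)t} dt.
   The resonant terms [m = n] or [m = j] give B (2 (sum |c|^2)^2 - sum |c|^4); in
   the others the kernel is at most 1/(|m-n||m-j|), and a single Cauchy-Schwarz
   inequality shows that the terms with |m-n| or |m-j| large are uniformly small.
   What remains has finite range in frequency. Hence W_B is a bounded continuous
   functional; it tends to B/pi along normalized sequences with sup |c_n| -> 0,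
   which gives (ii) and (iii); and if a sequence splits into two distant pieces of
   masses x and 1 - x, then in the limit W_B is at most
   J (x^2 + (1-x)^2) + 2 (B/pi) x (1-x), which is less than J if J > B/pi.
   So for J > B/pi a maximizing sequence neither vanishes nor splits: translated so
   that |c_0| stays away from 0, it has a subsequence converging coefficientwise to
   a limit of full mass, hence converging strongly. *)
Require Import Defs.
From mathcomp Require Import all_boot all_order all_algebra.
From mathcomp Require Import all_classical all_reals all_analysis.
From mathcomp Require Import measurable_realfun ring lra zify.
Set Implicit Arguments.
Unset Strict Implicit.
Unset Printing Implicit Defensive.
Import Order.TTheory GRing.Theory Num.Theory numFieldNormedType.Exports.
Local Open Scope classical_set_scope.
Local Open Scope complex_scope.
Local Open Scope ring_scope.

Local Notation Re := complex.Re.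
Local Notation Im := complex.Im.
Local Notation mu := lebesgue_measure.

(** The threshold comes from the resonant terms alone: with sum |c_n|^2 = 1/(2 pi), they contribute
    2 pi B 2 (2 pi)^-2 = B/pi, up to fourth powers. The bound for a split sequence equals J - 2 (J -
    B/pi) x (1 - x), so a strict gap leaves only x = 0 or x = 1. Since B is arbitrary, there is no
    exact orthogonality in time. What replaces it is the factorization m^2 + l^2 - n^2 - j^2 = 2 (m
    - n) (m - j) on n + j = m + l, which turns decay of the time integral into decay in two
    independent gaps. The definition of the flow picks a representative separately at each time, so
    it is neither visibly additive nor jointly measurable, and the quartic formula is available for
    polynomials only. The passage to L2 rests on uniqueness of Fourier coefficients, on lower
    semicontinuity (for upper bounds) and on a convexity inequality which, together with the upper
    bound, yields uniform continuity on bounded sets. Uniqueness is proved by approximating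
    indicators of arcs by real trigonometric polynomials. *)

Section complex_numbers.
Context {R : realType}.
Implicit Types (z w : R[i]) (x y : R).

Lemma complex_eqP z w : Re z = Re w -> Im z = Im w -> z = w.
Proof. by case: z w => [a b] [c d] /= -> ->. Qed.

Lemma cReD z w : Re (z + w) = Re z + Re w. Proof. by case: z w => [a b] [c d]. Qed.
Lemma cImD z w : Im (z + w) = Im z + Im w. Proof. by case: z w => [a b] [c d]. Qed.
Lemma cReN z : Re (- z) = - Re z. Proof. by case: z. Qed.
Lemma cImN z : Im (- z) = - Im z. Proof. by case: z. Qed.
Lemma cReM z w : Re (z * w) = Re z * Re w - Im z * Im w.
Proof. by case: z w => [a b] [c d]. Qed.
Lemma cImM z w : Im (z * w) = Re z * Im w + Im z * Re w.
Proof. by case: z w => [a b] [c d]. Qed.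
Lemma cReJ z : Re z^* = Re z. Proof. by case: z. Qed.
Lemma cImJ z : Im z^* = - Im z. Proof. by case: z. Qed.
Lemma cReC x : Re x%:C = x. Proof. by []. Qed.
Lemma cImC x : Im x%:C = 0. Proof. by []. Qed.
Definition ReImE := (cReD, cImD, cReN, cImN, cReM, cImM, cReJ, cImJ, cReC, cImC).

Lemma cmod_sqr z : cmod z ^+ 2 = Re z ^+ 2 + Im z ^+ 2.
Proof. by case: z => [a b] /=; rewrite sqr_sqrtr// addr_ge0// sqr_ge0. Qed.

Lemma cmod_ge0 z : 0 <= cmod z.
Proof. by case: z => [a b] /=; rewrite sqrtr_ge0. Qed.

Lemma cmodE z : cmod z = Num.sqrt (Re z ^+ 2 + Im z ^+ 2).
Proof. by case: z. Qed.

Lemma mulJ z : z * z^* = (cmod z ^+ 2)%:C.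
Proof. by apply: complex_eqP; rewrite !ReImE ?cmod_sqr; ring. Qed.

Lemma cmodJ z : cmod z^* = cmod z.
Proof. by rewrite !cmodE !ReImE sqrrN. Qed.

Lemma cmod0 : cmod (0 : R[i]) = 0.
Proof. by rewrite cmodE /= expr0n /= addr0 sqrtr0. Qed.

Lemma cmodC x : cmod x%:C = `|x|.
Proof. by rewrite cmodE !ReImE expr0n addr0 sqrtr_sqr. Qed.

Lemma cmodM z w : cmod (z * w) = cmod z * cmod w.
Proof. exact: ComplexField.Normc.normcM. Qed.

Lemma cmodN z : cmod (- z) = cmod z.
Proof. by rewrite !cmodE !ReImE !sqrrN. Qed.

Lemma ler_cmodD z w : cmod (z + w) <= cmod z + cmod w.
Proof. exact: le_normcD. Qed.

Lemma ler_cmod_dist z w : `|cmod z - cmod w| <= cmod (z - w).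
Proof.
rewrite ler_norml; apply/andP; split.
  rewrite lerNl opprB lerBlDr -(cmodN (z - w)) opprB.
  by apply: le_trans (ler_cmodD _ _); rewrite subrK.
by rewrite lerBlDr; apply: le_trans (ler_cmodD _ _); rewrite subrK.
Qed.

Lemma ler_Re_cmod z : `|Re z| <= cmod z.
Proof.
by rewrite -sqrtr_sqr cmodE ler_wsqrtr// lerDl sqr_ge0.
Qed.

Lemma ler_Im_cmod z : `|Im z| <= cmod z.
Proof.
by rewrite -sqrtr_sqr cmodE ler_wsqrtr// lerDr sqr_ge0.
Qed.

Lemma ler_cmod_ReIm z : cmod z <= `|Re z| + `|Im z|.
Proof.
rewrite -(@ler_pXn2r _ 2)// ?nnegrE ?cmod_ge0 ?addr_ge0// cmod_sqr sqrrD.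
rewrite !real_normK ?num_real//.
by have := mulr_ge0 (normr_ge0 (Re z)) (normr_ge0 (Im z)); lra.
Qed.

Lemma ler_cmod_sum (I : Type) (s : seq I) (P : pred I) (F : I -> R[i]) :
  cmod (\sum_(i <- s | P i) F i) <= \sum_(i <- s | P i) cmod (F i).
Proof.
elim/big_rec2: _ => [|i x z _ le_zx]; first by rewrite cmod0.
by apply: le_trans (ler_cmodD _ _) _; rewrite lerD2l.
Qed.

Lemma expiD x y : expi (x + y) = expi x * expi y.
Proof.
by apply: complex_eqP; rewrite !ReImE /= ?cosD ?sinD; ring.
Qed.

Lemma expi0 : expi (0 : R) = 1.
Proof. by rewrite /expi cos0 sin0. Qed.

Lemma expiJ x : (expi x)^* = expi (- x).
Proof. by rewrite /expi /= cosN sinN. Qed.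

Lemma cmod_expi x : cmod (expi x) = 1.
Proof. by rewrite cmodE /= cos2Dsin2 sqrtr1. Qed.

End complex_numbers.

Section complex_measurability.
Context {R : realType} d (T : measurableType d).
Implicit Types u v : T -> R[i].

(** The domain is arbitrary because the flow of a polynomial has to be measurable jointly in time
    and space, on a product; over the line the body is that of [cmeasurable]. *)
Definition cmeas u :=
  measurable_fun [set: T] (fun x => Re (u x)) /\
  measurable_fun [set: T] (fun x => Im (u x)).

Lemma cmeas_cst (z : R[i]) : cmeas (fun=> z).
Proof. by split; exact: measurable_cst. Qed.

Lemma cmeasD u v : cmeas u -> cmeas v -> cmeas (fun x => u x + v x).
Proof.
move=> [mu1 mu2] [mv1 mv2]; split.
- under eq_fun do rewrite cReD; exact: measurable_funD.
- under eq_fun do rewrite cImD; exact: measurable_funD.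
Qed.

Lemma cmeasM u v : cmeas u -> cmeas v -> cmeas (fun x => u x * v x).
Proof.
move=> [mu1 mu2] [mv1 mv2]; split.
- under eq_fun do rewrite cReM.
  by apply: measurable_funB; exact: measurable_funM.
- under eq_fun do rewrite cImM.
  by apply: measurable_funD; exact: measurable_funM.
Qed.

Lemma cmeasN u : cmeas u -> cmeas (fun x => - u x).
Proof.
move=> mu; have := cmeasM (cmeas_cst (-1)) mu.
by under eq_fun do rewrite mulN1r.
Qed.

Lemma cmeasB u v : cmeas u -> cmeas v -> cmeas (fun x => u x - v x).
Proof. by move=> mu mv; apply: cmeasD => //; exact: cmeasN. Qed.

Lemma cmeas_sum (I : Type) (s : seq I) (F : I -> T -> R[i]) :
  (forall i, cmeas (F i)) -> cmeas (fun x => \sum_(i <- s) F i x).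
Proof.
move=> mF; elim: s => [|i s IH].
  by under eq_fun do rewrite big_nil; exact: cmeas_cst.
by under eq_fun do rewrite big_cons; exact: cmeasD.
Qed.

Lemma cmeas_expi (f : T -> R) :
  measurable_fun [set: T] f -> cmeas (fun x => expi (f x)).
Proof.
move=> mf; split => /=.
- by apply: measurableT_comp mf; apply: continuous_measurable_fun => x; exact: continuous_cos.
- by apply: measurableT_comp mf; apply: continuous_measurable_fun => x; exact: continuous_sin.
Qed.

Lemma measurable_cmod u :
  cmeas u -> measurable_fun [set: T] (fun x => cmod (u x)).
Proof.
move=> [mu1 mu2]; under eq_fun do rewrite cmodE.
apply: (@measurableT_comp _ _ _ _ _ _ (@Num.sqrt R)).
  by apply: continuous_measurable_fun; exact: sqrt_continuous.
by apply: measurable_funD; exact: measurable_funX.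
Qed.

End complex_measurability.

(** * Complex-valued integration and square-integrable functions *)

Section complex_integration.
Context {R : realType}.
(* Sets are typed over [measurableTypeR R], which carries [lebesgue_measure]: the
   default measurable structure of [R] has another display, and unification
   does not identify the two. *)
Implicit Types (u v : R -> R[i]) (D : set (measurableTypeR R)) (z : R[i]).

Lemma integrable_eq D (f g : R -> \bar R) : measurable D ->
  mu.-integrable D f -> (forall x, D x -> f x = g x) -> mu.-integrable D g.
Proof.
move=> mD fi fg; apply: (eq_integrable mD _ _ _ fi) => x.
by rewrite inE => /fg.
Qed.

Definition cintegrable D u :=
  mu.-integrable D (EFin \o (fun x => Re (u x))) /\
  mu.-integrable D (EFin \o (fun x => Im (u x))).

Lemma cintegrable_le D u (g : R -> R) : measurable D -> cmeasurable u ->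
  mu.-integrable D (EFin \o g) -> (forall x, D x -> cmod (u x) <= g x) ->
  cintegrable D u.
Proof.
move=> mD [mu1 mu2] ig ug; split.
- apply: (le_integrable mD _ _ ig) => /=.
    by apply/measurable_EFinP; exact: measurable_funTS.
  move=> x Dx; rewrite lee_fin (le_trans (ler_Re_cmod _))//.
  by rewrite (le_trans (ug _ Dx))// ler_norm.
- apply: (le_integrable mD _ _ ig) => /=.
    by apply/measurable_EFinP; exact: measurable_funTS.
  move=> x Dx; rewrite lee_fin (le_trans (ler_Im_cmod _))//.
  by rewrite (le_trans (ug _ Dx))// ler_norm.
Qed.

Lemma eq_cintegral D u v : {in D, u =1 v} -> cintegral D u = cintegral D v.
Proof.
by move=> uv; congr Complex; apply: eq_Rintegral => x xD; rewrite uv.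
Qed.

Lemma cintegrableD D u v : measurable D -> cintegrable D u -> cintegrable D v ->
  cintegrable D (fun x => u x + v x).
Proof.
move=> mD [u1 u2] [v1 v2]; split.
- apply: (integrable_eq mD (integrableD mD u1 v1)).
  by move=> x _ /=; rewrite cReD.
- apply: (integrable_eq mD (integrableD mD u2 v2)).
  by move=> x _ /=; rewrite cImD.
Qed.

Lemma integrableZl_EFin D (f : R -> R) (a : R) : measurable D ->
  mu.-integrable D (EFin \o f) -> mu.-integrable D (EFin \o (fun x => a * f x)).
Proof.
by move=> mD fi; apply: (integrable_eq mD (integrableZl mD a fi)).
Qed.

Lemma cintegrableZ D u z : measurable D -> cintegrable D u ->
  cintegrable D (fun x => z * u x).
Proof.
move=> mD [u1 u2]; split.
- have := integrableB mD (integrableZl_EFin (Re z) mD u1)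
    (integrableZl_EFin (Im z) mD u2).
  by move/(integrable_eq mD); apply => x _ /=; rewrite cReM.
- have := integrableD mD (integrableZl_EFin (Re z) mD u2)
    (integrableZl_EFin (Im z) mD u1).
  by move/(integrable_eq mD); apply => x _ /=; rewrite cImM.
Qed.

Lemma cintegralD D u v : measurable D -> cintegrable D u -> cintegrable D v ->
  cintegral D (fun x => u x + v x) = cintegral D u + cintegral D v.
Proof.
move=> mD [u1 u2] [v1 v2]; apply: complex_eqP; rewrite !ReImE /=.
- by rewrite -RintegralD//; apply: eq_Rintegral => x _; rewrite cReD.
- by rewrite -RintegralD//; apply: eq_Rintegral => x _; rewrite cImD.
Qed.

Lemma cintegralZ D u z : measurable D -> cintegrable D u ->
  cintegral D (fun x => z * u x) = z * cintegral D u.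
Proof.
move=> mD [u1 u2]; apply: complex_eqP; rewrite !ReImE /=.
- rewrite -!RintegralZl// -RintegralB//; try exact: integrableZl_EFin.
  by apply: eq_Rintegral => x _; rewrite cReM.
- rewrite -!RintegralZl// -RintegralD//; try exact: integrableZl_EFin.
  by apply: eq_Rintegral => x _; rewrite cImM.
Qed.

Lemma cintegrable0 D : cintegrable D (fun=> 0).
Proof. by split => /=; exact: integrable0. Qed.

Lemma cintegral0 D : cintegral D (fun=> 0) = 0.
Proof.
by apply: complex_eqP => /=; rewrite /Rintegral integral0.
Qed.

Lemma cintegrable_sum D (I : Type) (s : seq I) (F : I -> R -> R[i]) :
  measurable D -> (forall i, cintegrable D (F i)) ->
  cintegrable D (fun x => \sum_(i <- s) F i x).
Proof.
move=> mD iF; elim: s => [|i s IH].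
  by under eq_fun do rewrite big_nil; exact: cintegrable0.
by under eq_fun do rewrite big_cons; exact: cintegrableD.
Qed.

Lemma cintegral_sum D (I : Type) (s : seq I) (F : I -> R -> R[i]) :
  measurable D -> (forall i, cintegrable D (F i)) ->
  cintegral D (fun x => \sum_(i <- s) F i x) = \sum_(i <- s) cintegral D (F i).
Proof.
move=> mD iF; elim: s => [|i s IH].
  by under eq_fun do rewrite big_nil; rewrite big_nil cintegral0.
under eq_fun do rewrite big_cons.
by rewrite big_cons cintegralD// ?IH//; exact: cintegrable_sum.
Qed.

Lemma cintegral_real D (f : R -> R) :
  cintegral D (fun x => (f x)%:C) = (\int[mu]_(x in D) f x)%:C.
Proof.
by apply: complex_eqP => //=; rewrite /Rintegral integral0.
Qed.

End complex_integration.

Section square_integrable.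
Context {R : realType}.
Implicit Types (u v : R -> R[i]) (z : R[i]) (n m : int).

Lemma period_measurable : measurable (@period R : set (measurableTypeR R)).
Proof. exact: measurable_itv. Qed.

Lemma mu_period : mu (@period R) = (2 * pi)%:E.
Proof.
rewrite /period lebesgue_measure_itv/= lte_fin mulr_gt0 ?pi_gt0//.
by rewrite oppr0 adde0.
Qed.

Definition esqnorm u : \bar R :=
  (\int[mu]_(x in period) (cmod (u x) ^+ 2)%:E)%E.

Definition sqnorm u : R := \int[mu]_(x in period) (cmod (u x) ^+ 2).

Lemma esqnorm_ge0 u : (0 <= esqnorm u)%E.
Proof. by apply: integral_ge0 => x _; rewrite lee_fin sqr_ge0. Qed.

Lemma sqnorm_ge0 u : 0 <= sqnorm u.
Proof. by apply: Rintegral_ge0 => x _; rewrite sqr_ge0. Qed.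

Lemma L2norm_sqr u : (L2norm u ^+ 2)%E = esqnorm u.
Proof.
rewrite /L2norm -/(esqnorm u) poweR12_sqrt ?esqnorm_ge0//.
by rewrite sqr_sqrte// esqnorm_ge0.
Qed.

Lemma L2norm_lty u : (L2norm u < +oo)%E = (esqnorm u < +oo)%E.
Proof.
apply/idP/idP; first by apply: lty_poweRy; rewrite invr_neq0.
exact: poweR_lty.
Qed.

Lemma measurable_sqr_cmod u (D : set (measurableTypeR R)) : cmeasurable u ->
  measurable_fun D (EFin \o (fun x => cmod (u x) ^+ 2)).
Proof.
move=> mu; apply/measurable_EFinP; apply: measurable_funTS.
by apply: measurable_funX; exact: measurable_cmod.
Qed.

Lemma L2TP u : L2T u <-> [/\ forall x, u (x + 2 * pi) = u x, cmeasurable u &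
  mu.-integrable period (EFin \o (fun x => cmod (u x) ^+ 2))].
Proof.
rewrite /L2T L2norm_lty; split=> -[pu mu uoo]; split => //.
  apply/integrableP; split; first exact: measurable_sqr_cmod.
  apply: le_lt_trans uoo; rewrite le_eqVlt; apply/orP; left; apply/eqP.
  apply: eq_integral => x _ /=.
  by rewrite ger0_norm ?sqr_ge0.
have /integrableP[_] := uoo; apply: le_lt_trans.
rewrite le_eqVlt; apply/orP; left; apply/eqP.
apply: eq_integral => x _ /=.
by rewrite ger0_norm ?sqr_ge0.
Qed.

Lemma L2T_integrable u : L2T u ->
  mu.-integrable period (EFin \o (fun x => cmod (u x) ^+ 2)).
Proof. by move=> /L2TP[]. Qed.

Lemma L2T_meas u : L2T u -> cmeasurable u. Proof. by case. Qed.

Lemma esqnormE u : L2T u -> esqnorm u = (sqnorm u)%:E.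
Proof.
move=> u2; rewrite /sqnorm /Rintegral fineK//.
exact: (integrable_fin_num period_measurable (L2T_integrable u2)).
Qed.

(** The difference of the two sides is |z - w|^2. Integrated, this is the quasi-triangle inequality
    for [sqnorm] that serves wherever two L2 errors are added. *)
Lemma cmod_sqrD_le (z w : R[i]) :
  cmod (z + w) ^+ 2 <= 2 * cmod z ^+ 2 + 2 * cmod w ^+ 2.
Proof.
rewrite !cmod_sqr !ReImE -subr_ge0.
have -> : 2 * (Re z ^+ 2 + Im z ^+ 2) + 2 * (Re w ^+ 2 + Im w ^+ 2) -
  ((Re z + Re w) ^+ 2 + (Im z + Im w) ^+ 2) =
  (Re z - Re w) ^+ 2 + (Im z - Im w) ^+ 2 by ring.
by rewrite addr_ge0// sqr_ge0.
Qed.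

Lemma L2TD u v : L2T u -> L2T v -> L2T (fun x => u x + v x).
Proof.
move=> /L2TP[pu mu_ iu] /L2TP[pv mv iv]; apply/L2TP; split.
- by move=> x; rewrite pu pv.
- exact: cmeasD.
- have i2 := integrableD period_measurable
    (integrableZl_EFin 2 period_measurable iu)
    (integrableZl_EFin 2 period_measurable iv).
  apply: (le_integrable period_measurable _ _ i2).
    by apply: measurable_sqr_cmod; exact: cmeasD.
  move=> x _ /=; rewrite lee_fin !ger0_norm ?sqr_ge0//; first exact: cmod_sqrD_le.
  by rewrite addr_ge0// mulr_ge0// sqr_ge0.
Qed.

Lemma L2TZ u z : L2T u -> L2T (fun x => z * u x).
Proof.
move=> /L2TP[pu mu_ iu]; apply/L2TP; split.
- by move=> x; rewrite pu.
- by apply: cmeasM => //; exact: cmeas_cst.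
- have := integrableZl_EFin (cmod z ^+ 2) period_measurable iu.
  by move/(integrable_eq period_measurable); apply => x _ /=; rewrite cmodM exprMn.
Qed.

Lemma L2T0 : L2T (fun=> 0 : R[i]).
Proof.
apply/L2TP; split => //.
under eq_fun do rewrite cmod0 expr0n /=.
exact: integrable0.
Qed.

Lemma L2TB u v : L2T u -> L2T v -> L2T (fun x => u x - v x).
Proof.
move=> u2 v2; have := L2TD u2 (L2TZ (-1) v2).
by under eq_fun do rewrite mulN1r.
Qed.

Lemma L2T_sum (I : Type) (s : seq I) (F : I -> R -> R[i]) :
  (forall i, L2T (F i)) -> L2T (fun x => \sum_(i <- s) F i x).
Proof.
move=> iF; elim: s => [|i s IH].
  by under eq_fun do rewrite big_nil; exact: L2T0.
by under eq_fun do rewrite big_cons; exact: L2TD.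
Qed.

Definition mode n : R -> R[i] := fun x => expi (n%:~R * x).

Lemma expi_int n : expi (n%:~R * (2 * pi)) = 1 :> R[i].
Proof.
have hn k : expi (k%:R * (2 * pi)) = 1 :> R[i].
  elim: k => [|k IH]; first by rewrite mul0r expi0.
  rewrite -natr1 mulrDl mul1r expiD IH mul1r.
  by rewrite /expi mulr_natl cos2pi sin2pi.
case: n => k; first exact: hn.
rewrite NegzE mulrNz mulNr -expiJ hn.
by apply: complex_eqP; rewrite !ReImE /= ?oppr0.
Qed.

Lemma cmeas_mode n : cmeasurable (mode n).
Proof. by apply: cmeas_expi; exact: mulrl_measurable. Qed.

Lemma mode_periodic n x : mode n (x + 2 * pi) = mode n x.
Proof. by rewrite /mode mulrDr expiD expi_int mulr1. Qed.

Lemma cmod_mode n x : cmod (mode n x) = 1. Proof. exact: cmod_expi. Qed.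

Lemma modeD n m x : mode (n + m) x = mode n x * mode m x.
Proof. by rewrite /mode intrD mulrDl expiD. Qed.

Lemma modeJ n x : (mode n x)^* = mode (- n) x.
Proof. by rewrite /mode expiJ intrN mulNr. Qed.

Lemma L2T_modeM n u : L2T u -> L2T (fun x => mode n x * u x).
Proof.
move=> /L2TP[pu mu_ iu]; apply/L2TP; split.
- by move=> x; rewrite pu mode_periodic.
- by apply: cmeasM => //; exact: cmeas_mode.
- by under eq_fun do rewrite cmodM cmod_mode mul1r.
Qed.

Lemma integrable_cst_period (r : R) : mu.-integrable period (EFin \o cst r).
Proof.
apply: continuous_compact_integrable; first exact: segment_compact.
by apply: continuous_subspaceT => x; exact: cst_continuous.
Qed.

Lemma L2T_mode n : L2T (mode n).
Proof.
apply/L2TP; split; [exact: mode_periodic|exact: cmeas_mode|].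
under eq_fun do rewrite cmod_mode expr1n.
exact: integrable_cst_period.
Qed.

Lemma cmodM_le (z w : R[i]) : cmod (z * w) <= cmod z ^+ 2 + cmod w ^+ 2.
Proof.
rewrite cmodM; have := sqr_ge0 (cmod z - cmod w); rewrite sqrrB.
have := mulr_ge0 (cmod_ge0 z) (cmod_ge0 w); lra.
Qed.

Lemma cintegrableM u v : L2T u -> L2T v ->
  cintegrable period (fun x => u x * v x).
Proof.
move=> u2 v2; apply: (cintegrable_le period_measurable).
- by apply: cmeasM; exact: L2T_meas.
- exact: (integrableD period_measurable (L2T_integrable u2) (L2T_integrable v2)).
- by move=> x _; exact: cmodM_le.
Qed.

Lemma L2T_cintegrable u : L2T u -> cintegrable period u.
Proof.
move=> u2; have := cintegrableM (L2T_mode 0) u2.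
by under eq_fun do rewrite /mode mul0r expi0 mul1r.
Qed.

Lemma fourier_coefE u n :
  fourier_coef u n = ((2 * pi)^-1)%:C * cintegral period (fun x => mode (- n) x * u x).
Proof.
congr (_ * _); apply: eq_cintegral => x _.
by rewrite /mode intrN mulNr.
Qed.

Lemma cintegrable_modeM n u : L2T u -> cintegrable period (fun x => mode n x * u x).
Proof. by move=> u2; apply: L2T_cintegrable; exact: L2T_modeM. Qed.

Lemma fourier_coefD u v n : L2T u -> L2T v ->
  fourier_coef (fun x => u x + v x) n = fourier_coef u n + fourier_coef v n.
Proof.
move=> u2 v2; rewrite !fourier_coefE -mulrDr; congr (_ * _).
rewrite -(cintegralD period_measurable); try exact: cintegrable_modeM.
by apply: eq_cintegral => x _; rewrite mulrDr.
Qed.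

Lemma fourier_coefZ u z n : L2T u ->
  fourier_coef (fun x => z * u x) n = z * fourier_coef u n.
Proof.
move=> u2; rewrite !fourier_coefE mulrCA; congr (_ * _).
rewrite -(cintegralZ z period_measurable); last exact: cintegrable_modeM.
by apply: eq_cintegral => x _; rewrite mulrCA.
Qed.

Lemma fourier_coefB u v n : L2T u -> L2T v ->
  fourier_coef (fun x => u x - v x) n = fourier_coef u n - fourier_coef v n.
Proof.
move=> u2 v2; have := fourier_coefD n u2 (L2TZ (-1) v2).
by under eq_fun do rewrite mulN1r; rewrite fourier_coefZ// mulN1r.
Qed.

Lemma fourier_coef0 n : fourier_coef (fun=> 0 : R[i]) n = 0.
Proof.
have := fourier_coefZ 0 n L2T0; under eq_fun do rewrite mul0r.
by rewrite mul0r.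
Qed.

Lemma fourier_coef_sum (I : Type) (s : seq I) (F : I -> R -> R[i]) n :
  (forall i, L2T (F i)) ->
  fourier_coef (fun x => \sum_(i <- s) F i x) n = \sum_(i <- s) fourier_coef (F i) n.
Proof.
move=> F2; elim: s => [|i s IH].
  by under eq_fun do rewrite big_nil; rewrite big_nil fourier_coef0.
under eq_fun do rewrite big_cons.
by rewrite big_cons fourier_coefD ?IH//; exact: L2T_sum.
Qed.

Lemma fourier_coef_modeM u m n :
  fourier_coef (fun x => mode m x * u x) n = fourier_coef u (n - m).
Proof.
rewrite !fourier_coefE; congr (_ * _); apply: eq_cintegral => x _.
by rewrite mulrA -modeD opprB addrC.
Qed.

End square_integrable.

(** * Integrals of exponentials over an interval *)

Section exponential_integrals.
Context {R : realType}.
Implicit Types (w B x : R).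

Lemma FTC2_derive (f F : R -> R) B : 0 < B -> continuous f ->
  (forall x, is_derive x 1 F (f x)) ->
  \int[mu]_(x in `[0, B]) f x = F B - F 0.
Proof.
move=> B0 cf dF.
have cF : continuous F.
  move=> x; apply: differentiable_continuous; apply/derivable1_diffP.
  by have [] := dF x.
rewrite /Rintegral (@continuous_FTC2 _ f F)//.
- exact: continuous_subspaceT.
- split.
  + by move=> x _; have [] := dF x.
  + exact: (cvg_at_right_filter (cF 0)).
  + exact: (cvg_at_left_filter (cF B)).
- by move=> x _; rewrite derive1E; have [_ ] := dF x.
Qed.

Lemma is_derive_sin_scale w x : w != 0 ->
  is_derive x 1 (fun y : R => w^-1 * sin (w * y)) (cos (w * x)).
Proof.
move=> w0; have H : is_derive x 1 (fun y : R => w * y) w.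
  by apply: is_derive_eq; rewrite /GRing.scale /= mulr1.
have := is_deriveZ (w^-1) (@is_derive1_comp _ _ _ _ _ _ (is_derive_sin (w * x)) H).
by move/is_derive_eq; apply; rewrite /GRing.scale /= mulrC mulfK.
Qed.

Lemma is_derive_cos_scale w x : w != 0 ->
  is_derive x 1 (fun y : R => - w^-1 * cos (w * y)) (sin (w * x)).
Proof.
move=> w0; have H : is_derive x 1 (fun y : R => w * y) w.
  by apply: is_derive_eq; rewrite /GRing.scale /= mulr1.
have := is_deriveZ (- w^-1) (@is_derive1_comp _ _ _ _ _ _ (is_derive_cos (w * x)) H).
by move/is_derive_eq; apply; rewrite /GRing.scale /=; field.
Qed.

Lemma continuous_scale w : continuous (fun y : R => w * y).
Proof. by move=> x; exact: cvgMr. Qed.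

Lemma cintegral_expi w B : 0 < B -> w != 0 ->
  cintegral `[0, B] (fun t => expi (w * t)) =
  (w^-1 * sin (w * B)) +i* (w^-1 * (1 - cos (w * B))).
Proof.
move=> B0 w0; apply: complex_eqP => /=.
- rewrite (FTC2_derive B0 _ (fun x => is_derive_sin_scale x w0)).
    by rewrite mulr0 sin0 mulr0 subr0.
  by move=> x; apply: continuous_comp; [exact: continuous_scale|exact: continuous_cos].
- rewrite (FTC2_derive B0 _ (fun x => is_derive_cos_scale x w0)).
    by rewrite mulr0 cos0; ring.
  by move=> x; apply: continuous_comp; [exact: continuous_scale|exact: continuous_sin].
Qed.

Lemma mu_itv0 B : 0 < B -> mu `[0, B] = B%:E.
Proof.
by move=> B0; rewrite lebesgue_measure_itv/= lte_fin B0 oppr0 adde0.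
Qed.

Lemma cintegral_expi0 B : 0 < B ->
  cintegral `[0, B] (fun t => expi (0 * t)) = B%:C.
Proof.
move=> B0; have -> : (fun t : R => expi (0 * t)) = (fun=> (1 : R)%:C).
  by apply/funext => t; rewrite mul0r expi0.
rewrite cintegral_real Rintegral_cst//.
by have /= -> := mu_itv0 B0; rewrite mul1r.
Qed.

(** The integral is 1/w times sin + i (1 - cos), whose squared modulus is 2 - 2 cos <= 4; the bound
    is uniform in [B]. *)
Lemma cmod_cintegral_expi w B : 0 < B -> w != 0 ->
  cmod (cintegral `[0, B] (fun t => expi (w * t))) <= 2 / `|w|.
Proof.
move=> B0 w0; rewrite cintegral_expi//.
have -> : (w^-1 * sin (w * B)) +i* (w^-1 * (1 - cos (w * B))) =
    w^-1%:C * (sin (w * B) +i* (1 - cos (w * B))).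
  by apply: complex_eqP; rewrite !ReImE /= mul0r ?subr0 ?addr0.
rewrite cmodM cmodC normfV mulrC ler_wpM2r ?invr_ge0//.
rewrite -(@ler_pXn2r _ 2) ?nnegrE ?cmod_ge0// cmod_sqr /=.
have := cos2Dsin2 (w * B); have := cos_geN1 (w * B); nra.
Qed.

Lemma cintegral_mode (n : int) :
  cintegral period (mode n) = if n == 0 then (2 * pi)%:C else 0 :> R[i].
Proof.
have pi2 : 0 < 2 * pi :> R by rewrite mulr_gt0// pi_gt0.
case: eqP => [->|/eqP n0]; first exact: cintegral_expi0.
rewrite /mode cintegral_expi ?intr_eq0//.
rewrite -[cos _]/(Re (expi (n%:~R * (2 * pi)))) -[sin _]/(Im (expi (n%:~R * (2 * pi)))).
rewrite expi_int /=.
by apply: complex_eqP; rewrite /= ?subrr mulr0.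
Qed.

End exponential_integrals.

(** * Bessel, Riesz-Fischer and Plancherel *)

Section trigonometric_polynomials.
Context {R : realType}.
Implicit Types (u v : R -> R[i]) (z : R[i]) (n m : int) (s : seq int) (c : int -> R[i]).

Lemma pi2_gt0 : 0 < 2 * pi :> R. Proof. by rewrite mulr_gt0// pi_gt0. Qed.

Lemma fourier_coef_mode m n : fourier_coef (mode m : R -> R[i]) n = (m == n)%:R.
Proof.
rewrite fourier_coefE (_ : (fun x => _) = mode (m - n)); last first.
  by apply/funext => x; rewrite -modeD addrC.
rewrite cintegral_mode subr_eq0; case: eqP => _; last by rewrite mulr0.
by apply: complex_eqP; rewrite !ReImE /= ?mul0r ?mulr0 ?addr0 ?subr0 ?mulVf ?gt_eqF ?pi2_gt0.
Qed.

Lemma cmod_sqrB (z w : R[i]) :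
  cmod (z - w) ^+ 2 = cmod z ^+ 2 - 2 * Re (w^* * z) + cmod w ^+ 2.
Proof. by rewrite !cmod_sqr !ReImE; ring. Qed.

Lemma cintegral_fourier v n : 
  cintegral period (fun x => mode (- n) x * v x) = (2 * pi)%:C * fourier_coef v n.
Proof.
rewrite fourier_coefE mulrA -rmorphM /= mulfV ?gt_eqF ?pi2_gt0//.
by rewrite mul1r.
Qed.

Lemma Rintegral_cst_period (r : R) : \int[mu]_(_ in period) r = 2 * pi * r.
Proof.
rewrite Rintegral_cst; last exact: period_measurable.
by rewrite mulrC; congr (_ * _); exact: (congr1 fine (@mu_period R)).
Qed.

Lemma sqnorm_sub_mode v a n : L2T v ->
  sqnorm (fun x => v x - a * mode n x) =
  sqnorm v - 2 * (2 * pi) * Re (a^* * fourier_coef v n) + 2 * pi * cmod a ^+ 2.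
Proof.
move=> v2.
have [i1 _] := cintegrableZ a^* period_measurable (cintegrable_modeM (- n) v2).
have i2 := integrableZl_EFin 2 period_measurable i1.
have i3 := L2T_integrable v2.
have i4 := integrable_cst_period (cmod a ^+ 2).
rewrite /sqnorm; transitivity (\int[mu]_(x in period)
    (cmod (v x) ^+ 2 - 2 * Re (a^* * (mode (- n) x * v x)) + cmod a ^+ 2)).
  apply: eq_Rintegral => x _.
  by rewrite cmod_sqrB rmorphM /= modeJ mulrA cmodM cmod_mode mulr1.
rewrite RintegralD//; [|exact: period_measurable|]; last first.
  exact: (integrableB period_measurable i3 i2).
rewrite RintegralB//; [|exact: period_measurable].
rewrite Rintegral_cst_period RintegralZl//; last exact: period_measurable.
congr (_ - _ + _); rewrite -mulrA; congr (_ * _).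
transitivity (Re (a^* * cintegral period (fun x => mode (- n) x * v x))).
  rewrite -(cintegralZ _ period_measurable)//; exact: cintegrable_modeM.
by rewrite cintegral_fourier mulrCA cReM /= mul0r subr0.
Qed.

Definition tpoly s c : R -> R[i] := fun x => \sum_(n <- s) c n * mode n x.

Lemma L2T_tpoly s c : L2T (tpoly s c).
Proof. by apply: L2T_sum => n; apply: L2TZ; exact: L2T_mode. Qed.

Lemma fourier_coef_tpoly s c n : uniq s ->
  fourier_coef (tpoly s c) n = if n \in s then c n else 0.
Proof.
move=> us; rewrite /tpoly fourier_coef_sum; last first.
  by move=> i; apply: L2TZ; exact: L2T_mode.
under eq_bigr do rewrite (fourier_coefZ _ _ (L2T_mode _)) fourier_coef_mode.
case: ifPn => [ns|ns].
  rewrite (bigD1_seq n)//= eqxx mulr1 big1 ?addr0// => i /negbTE ->.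
  by rewrite mulr0.
rewrite big1_seq// => i /= si; case: eqP => [ein|_]; last by rewrite mulr0.
by rewrite -ein si in ns.
Qed.

(** Modes are subtracted one at a time, each orthogonal to those already removed. Since [c] is
    arbitrary, one identity yields Bessel ([c] the coefficients of [v]), the norm of a polynomial
    ([v] = 0), and the distance from a sequence to a truncated limit profile. *)
Lemma sqnorm_sub_tpoly v s c : uniq s -> L2T v ->
  sqnorm (fun x => v x - tpoly s c x) =
  sqnorm v + 2 * pi * \sum_(n <- s) (cmod (c n - fourier_coef v n) ^+ 2 -
                                   cmod (fourier_coef v n) ^+ 2).
Proof.
move=> + v2; elim: s => [_|n s IH /= /andP[ns us]].
  rewrite big_nil mulr0 addr0; congr sqnorm; apply/funext => x.
  by rewrite /tpoly big_nil subr0.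
rewrite big_cons mulrDr addrCA -IH//.
have -> : (fun x => v x - tpoly (n :: s) c x) =
    (fun x => (v x - tpoly s c x) - c n * mode n x).
  by apply/funext => x; rewrite /tpoly big_cons; ring.
rewrite sqnorm_sub_mode; last by apply: L2TB => //; exact: L2T_tpoly.
rewrite fourier_coefB//; last exact: L2T_tpoly.
rewrite fourier_coef_tpoly// (negbTE ns) subr0 cmod_sqrB.
rewrite !cmod_sqr !ReImE; ring.
Qed.

Lemma sqnorm_sub_partial v s : uniq s -> L2T v ->
  sqnorm (fun x => v x - tpoly s (fourier_coef v) x) =
  sqnorm v - 2 * pi * \sum_(n <- s) cmod (fourier_coef v n) ^+ 2.
Proof.
move=> us v2; rewrite sqnorm_sub_tpoly//; congr (_ + _).
rewrite -mulrN -sumrN; congr (_ * _); apply: eq_bigr => n _.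
by rewrite subrr cmod0 expr0n /= sub0r.
Qed.

Lemma sqnormN v : sqnorm (fun x => - v x) = sqnorm v.
Proof. by rewrite /sqnorm; under eq_Rintegral do rewrite cmodN. Qed.

Lemma sqnorm_tpoly s c : uniq s ->
  sqnorm (tpoly s c) = 2 * pi * \sum_(n <- s) cmod (c n) ^+ 2.
Proof.
move=> us; have := sqnorm_sub_tpoly c us L2T0.
have -> : (fun x : R => 0 - tpoly s c x) = (fun x => - tpoly s c x).
  by apply/funext => x; rewrite sub0r.
rewrite sqnormN => ->; rewrite /sqnorm.
under eq_Rintegral do rewrite cmod0 expr0n /=.
rewrite Rintegral_cst_period mulr0 add0r; congr (_ * _).
by apply: eq_bigr => n _; rewrite fourier_coef0 subr0 cmod0 expr0n subr0.
Qed.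

Lemma bessel v s : uniq s -> L2T v ->
  2 * pi * \sum_(n <- s) cmod (fourier_coef v n) ^+ 2 <= sqnorm v.
Proof.
by move=> us v2; rewrite -subr_ge0 -sqnorm_sub_partial// sqnorm_ge0.
Qed.

Lemma sqnormD_le u v : L2T u -> L2T v ->
  sqnorm (fun x => u x + v x) <= 2 * sqnorm u + 2 * sqnorm v.
Proof.
move=> u2 v2; have mp := @period_measurable R.
have iu := integrableZl_EFin 2 mp (L2T_integrable u2).
have iv := integrableZl_EFin 2 mp (L2T_integrable v2).
rewrite /sqnorm -!RintegralZl//; try exact: L2T_integrable.
rewrite -RintegralD//; apply: (le_Rintegral mp).
- by apply: L2T_integrable; exact: L2TD.
- exact: (integrableD mp iu iv).
- by move=> x _; exact: cmod_sqrD_le.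
Qed.

Lemma sqnormB_le u v : L2T u -> L2T v ->
  sqnorm (fun x => u x - v x) <= 2 * sqnorm u + 2 * sqnorm v.
Proof.
move=> u2 v2; have := sqnormD_le u2 (L2TZ (-1) v2).
under eq_fun do rewrite mulN1r; move=> /le_trans; apply.
by rewrite lerD2l ler_pM2l// (_ : (fun x => _) = (fun x => - v x)) ?sqnormN//; apply/funext => x; rewrite mulN1r.
Qed.

End trigonometric_polynomials.

Section convergence.
Context {R : realType}.
Implicit Types (u v : R -> R[i]) (D : set (measurableTypeR R)).

(* Instance search does not see [lebesgue_measure] as a bundled measure. *)
#[global] Instance ae_lebesgue_filter :
  Filter (nbhs (almost_everywhere (@lebesgue_measure R))).
Proof. exact: (ae_filter_ringOfSetsType (@lebesgue_measure R)). Qed.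

Lemma limn_einf_le (u : (\bar R)^nat) (K : \bar R) :
  (\forall n \near \oo, (u n <= K)%E) -> (limn_einf u <= K)%E.
Proof.
move=> uK; rewrite limn_einf_lim; apply: lime_le; first exact: is_cvg_einfs.
near=> n; apply: (@le_trans _ _ (u n)); last by near: n.
by apply: ereal_inf_lbound; exists n => //=.
Unshelve. all: by end_near. Qed.

Lemma fatou_bound D (f_ : nat -> R -> R) (f : R -> R) (K : R) :
  measurable D -> (forall n, measurable_fun D (f_ n)) -> measurable_fun D f ->
  (forall n x, 0 <= f_ n x) -> (forall x, 0 <= f x) ->
  {ae mu, forall x, D x -> f_ n x @[n --> \oo] --> f x} ->
  (\forall n \near \oo, (\int[mu]_(x in D) (f_ n x)%:E <= K%:E)%E) ->
  (\int[mu]_(x in D) (f x)%:E <= K%:E)%E.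
Proof.
move=> mD mf_ mf f_0 f0 fcvg fK.
pose F n x := (f_ n x)%:E.
have mF n : measurable_fun D (F n) by apply/measurable_EFinP; exact: mf_.
have mL : measurable_fun D (fun x => limn_einf (F ^~ x)).
  have -> : (fun x => limn_einf (F ^~ x)) =
      (fun x => - limn_esup (fun n => - F n x))%E.
    by apply/funext => x; rewrite (limn_esupN (F ^~ x)) oppeK.
  apply: measurableT_comp => //; apply: measurable_fun_limn_esup => n.
  exact: measurableT_comp.
have -> : (\int[mu]_(x in D) (f x)%:E = \int[mu]_(x in D) limn_einf (F ^~ x))%E.
  apply: ge0_ae_eq_integral => //.
  - exact/measurable_EFinP.
  - by move=> x _; rewrite lee_fin.
  - move=> x _; rewrite limn_einf_lim; apply: lime_ge; first exact: is_cvg_einfs.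
    by apply: nearW => n; apply: le_ereal_inf_tmp => _ [k _ <-]; rewrite lee_fin.
  - apply: filterS fcvg => x fx Dx.
    have fx' : F n x @[n --> \oo] --> (f x)%:E by apply/fine_cvgP; split; [exact: nearW|exact: fx].
    by rewrite is_cvg_limn_einfE; [rewrite (cvg_lim _ fx')|apply: cvgP fx'].
apply: (le_trans (fatou mu mD mF _)).
  by move=> n x _; rewrite lee_fin.
exact: limn_einf_le.
Qed.

Lemma cvg_geometric_diff (a : R^nat) (C : R) :
  (forall k, `|a k.+1 - a k| <= C * 2^-1 ^+ k) -> cvgn a.
Proof.
move=> ha.
have ca : cvgn (series (telescope a)).
  apply: normed_cvg; apply: (@series_le_cvg _ _ (geometric C (2^-1))).
  - by move=> n; exact: normr_ge0.
  - by move=> n; apply: le_trans (ha n).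
  - exact: ha.
  - by apply: is_cvg_geometric_series; rewrite ger0_norm// invf_lt1// ltr1n.
have -> : a = (fun n => a 0%N + series (telescope a) n).
  by apply/funext => n; rewrite eq_sum_telescope.
by apply: is_cvgD => //; exact: is_cvg_cst.
Qed.

(** Beppo Levi: the sum of the series has integral at most 2 C, hence is finite almost everywhere,
    and it bounds each of its terms. *)
Lemma ae_fin_nneseries D (f : nat -> R -> R) (C : R) :
  measurable D -> (forall n, measurable_fun D (f n)) -> (forall n x, 0 <= f n x) ->
  (forall n, (\int[mu]_(x in D) (f n x)%:E <= (C * 2^-1 ^+ n)%:E)%E) ->
  {ae mu, forall x, D x -> exists M, forall n, f n x <= M}.
Proof.
move=> mD mf f0 fC.
have C0 : 0 <= C.
  have := fC 0%N; rewrite expr0 mulr1 -lee_fin; apply: le_trans.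
  by apply: integral_ge0 => x _; rewrite lee_fin.
pose G x := (\sum_(n <oo) (f n x)%:E)%E.
have iG : mu.-integrable D G.
  have mG : measurable_fun D G.
    apply: ge0_emeasurable_sum => // [n x _|n _]; first by rewrite lee_fin.
    by apply/measurable_EFinP; exact: mf.
  apply/integrableP; split => //.
  under eq_integral.
    move=> x _; rewrite gee0_abs; last by apply: nneseries_ge0 => n _ _; rewrite lee_fin.
    over.
  rewrite integral_nneseries//; last 2 first.
    by move=> n; apply/measurable_EFinP; exact: mf.
    by move=> n x _; rewrite lee_fin.
  apply: (@le_lt_trans _ _ (C * 2)%:E); last exact: ltry.
  apply: lime_le.
    by apply: is_cvg_nneseries => n _ _; apply: integral_ge0 => x _; rewrite lee_fin.
  apply: nearW => N.
  have geom : \sum_(0 <= n < N) (C * 2^-1 ^+ n) = C * (2 - 2 * 2^-1 ^+ N).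
    elim: N => [|N IH]; first by rewrite big_geq// expr0; ring.
    by rewrite big_nat_recr//= IH exprS; field.
  apply: (@le_trans _ _ (\sum_(0 <= n < N) (C * 2^-1 ^+ n)%:E)%E).
    by apply: lee_sum => n _; exact: fC.
  rewrite sumEFin geom lee_fin ler_wpM2l// gerBl mulr_ge0// exprn_ge0//.
apply: filterS (integrable_ae mD iG) => x Gx Dx.
exists (fine (G x)) => n; rewrite -lee_fin fineK; last exact: Gx.
apply: (le_trans _ (nneseries_lim_ge n.+1 _)); last by move=> k _ _; rewrite lee_fin.
rewrite big_nat_recr//= leeDr// sume_ge0// => k _; rewrite lee_fin//.
Qed.

(** The rate 8^-k leaves room for a factor 4^n: the integrals of 4^n |v_{n+1} - v_n|^2 are at most K
    2^-n, so almost everywhere |v_{n+1} - v_n| <= sqrt M 2^-n and the sequence converges pointwise.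
    Fatou carries the L2 bounds to the limit. *)
Lemma L2_complete (v_ : nat -> R -> R[i]) (K : R) : (forall k, L2T (v_ k)) ->
  (forall k l, (k <= l)%N ->
    sqnorm (fun x => v_ l x - v_ k x) <= K * (8^-1) ^+ k) ->
  exists v, L2T v /\ forall k, sqnorm (fun x => v x - v_ k x) <= K * (8^-1) ^+ k.
Proof.
move=> v2 vK; have mp := @period_measurable R.
pose f n x := 4 ^+ n * cmod (v_ n.+1 x - v_ n x) ^+ 2.
have L2d k l : L2T (fun x => v_ l x - v_ k x).
  by apply: L2TB; exact: v2.
have mf n : measurable_fun (period : set (measurableTypeR R)) (f n).
  apply: measurable_funTS; apply: measurable_funM; first exact: measurable_cst.
  by apply: measurable_funX; exact: measurable_cmod (L2T_meas (L2d _ _)).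
have f0 n x : 0 <= f n x by rewrite /f mulr_ge0 ?sqr_ge0 ?exprn_ge0.
have fK n : (\int[mu]_(x in period) (f n x)%:E <= (K * 2^-1 ^+ n)%:E)%E.
  under eq_integral do rewrite EFinM.
  rewrite ge0_integralZl//; last 2 first.
  - exact: (measurable_sqr_cmod (L2T_meas (L2d n n.+1))).
  - by move=> x _; rewrite lee_fin sqr_ge0.
  rewrite -[X in (_ * X)%E]/(esqnorm (fun x => v_ n.+1 x - v_ n x)) esqnormE// -EFinM lee_fin.
  have -> : K * 2^-1 ^+ n = 4 ^+ n * (K * 8^-1 ^+ n).
    by rewrite mulrCA -exprMn; congr (_ * _ ^+ _); field.
  by rewrite ler_wpM2l ?exprn_ge0// vK.
have aeM := ae_fin_nneseries mp mf f0 fK.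
(* Upper limits exist at every point, so [v] is measurable and exactly periodic even where the
   sequence diverges; [fine] sends infinite values to 0. *)
pose lim_ (g : R[i] -> R) x := fine (limn_esup (fun k => (g (v_ k x))%:E)).
pose v x := lim_ (@complex.Re R) x +i* lim_ (@complex.Im R) x.
have cvg_lim_ (g : R[i] -> R) x : cvgn (fun k => g (v_ k x)) ->
    g (v_ k x) @[k --> \oo] --> lim_ g x.
  move=> cg; have cg' : (g (v_ k x))%:E @[k --> \oo] --> (limn (fun k => g (v_ k x)))%:E.
    by apply/fine_cvgP; split; [exact: nearW|exact: cg].
  by rewrite /lim_ is_cvg_limn_esupE; [rewrite (cvg_lim _ cg')|apply: cvgP cg'].
have aecvg : {ae mu, forall x, period x -> Re (v_ k x) @[k --> \oo] --> Re (v x) /\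
    Im (v_ k x) @[k --> \oo] --> Im (v x)}.
  apply: filterS aeM => x /[apply] -[M fM].
  have M0 : 0 <= M by apply: le_trans (f0 0%N x) (fM 0%N).
  have hd n : cmod (v_ n.+1 x - v_ n x) <= Num.sqrt M * 2^-1 ^+ n.
    rewrite -(@ler_pXn2r _ 2) ?nnegrE ?cmod_ge0 ?mulr_ge0 ?sqrtr_ge0 ?exprn_ge0 ?invr_ge0//.
    rewrite exprMn sqr_sqrtr// exprAC (_ : 2^-1 ^+ 2 = 4^-1); last by field.
    by rewrite exprVn ler_pdivlMr ?exprn_gt0// mulrC; exact: fM.
  split; apply: cvg_lim_; apply: (@cvg_geometric_diff _ (Num.sqrt M)) => k.
  - by apply: le_trans (hd k); rewrite -cReN -cReD; exact: ler_Re_cmod.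
  - by apply: le_trans (hd k); rewrite -cImN -cImD; exact: ler_Im_cmod.
have mv : cmeasurable v.
  split; apply: (measurableT_comp (f := fine)) => //.
  - apply: measurable_fun_limn_esup => k; apply/measurable_EFinP.
    by have [] := L2T_meas (v2 k).
  - apply: measurable_fun_limn_esup => k; apply/measurable_EFinP.
    by have [] := L2T_meas (v2 k).
have vE k : (esqnorm (fun x => v x - v_ k x)%R <= (K * 8^-1 ^+ k)%:E)%E.
  have mvk := L2T_meas (v2 k).
  apply: (@fatou_bound _ (fun l x => cmod (v_ l x - v_ k x) ^+ 2)) => //.
  - by move=> l; apply/measurable_EFinP; exact: (measurable_sqr_cmod (L2T_meas (L2d k l))).
  - by apply/measurable_EFinP; apply: measurable_sqr_cmod; exact: cmeasB.
  - by move=> l x; exact: sqr_ge0.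
  - by move=> x; exact: sqr_ge0.
  - apply: filterS aecvg => x /[apply] -[cR cI].
    under eq_fun do rewrite cmod_sqr cReD cReN cImD cImN !expr2.
    rewrite cmod_sqr cReD cReN cImD cImN !expr2.
    by apply: cvgD; apply: cvgM; apply: cvgB => //; exact: cvg_cst.
  - near=> l; rewrite -[X in (X <= _)%E]/(esqnorm (fun x => v_ l x - v_ k x)) esqnormE//.
    by rewrite lee_fin vK//; near: l; exact: nbhs_infty_ge.
(* Only differences from terms of the sequence are bounded so far; [v] itself is recovered by adding
   [v_ 0] back. *)
have vv : L2T (fun x => v x - v_ 0%N x).
  split.
  - move=> x; have [pv _ _] := v2 0%N; rewrite pv; congr (_ - _).
    by apply: complex_eqP; rewrite /= /lim_; congr (fine (limn_esup _));
      apply/funext => k; have [-> _ _] := v2 k.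
  - exact: cmeasB (L2T_meas (v2 0%N)).
  - by rewrite L2norm_lty; apply: le_lt_trans (vE 0%N) (ltry _).
have v2' : L2T v.
  by have := L2TD vv (v2 0%N); under eq_fun do rewrite subrK.
exists v; split => // k; rewrite -lee_fin -esqnormE ?vE//; exact: L2TB.
Unshelve. all: by end_near. Qed.

End convergence.

Section square_summable.
Context {R : realType}.
Implicit Types (u v : R -> R[i]) (c : int -> R[i]) (s : seq int) (n : int).

(** Bounds on finite sums stand in for a series, so that no enumeration of [int] has to be fixed;
    [uniq] excludes repeated terms. *)
Definition ell2 c := exists G : R, forall s, uniq s ->
  \sum_(n <- s) cmod (c n) ^+ 2 <= G.

Lemma sum_sqr_ge0 c s : 0 <= \sum_(n <- s) cmod (c n) ^+ 2.
Proof. by apply: sumr_ge0 => n _; exact: sqr_ge0. Qed.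

(** The list [s0] nearly attains the supremum of the finite sums, so a list disjoint from it can add
    at most [e]. *)
Lemma ell2_tail c (e : R) : ell2 c -> 0 < e ->
  exists2 s0, uniq s0 & forall s, uniq s -> {in s, forall n, n \notin s0} ->
    \sum_(n <- s) cmod (c n) ^+ 2 <= e.
Proof.
move=> [G cG] e0.
pose A := [set \sum_(n <- s) cmod (c n) ^+ 2 | s in [set s : seq int | uniq s]].
have hA : has_sup A.
  split; first by exists (\sum_(n <- [::]) cmod (c n) ^+ 2); exists [::].
  by exists G => _ [s us <-]; exact: cG.
have [_ [s0 us0 <-] hs0] := sup_adherent e0 hA.
exists s0 => // s us ss0.
have : \sum_(n <- s0 ++ s) cmod (c n) ^+ 2 <= sup A.
  apply: (ub_le_sup (hA.2)); exists (s0 ++ s) => //=.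
  rewrite cat_uniq us0 us andbT /=; apply/hasPn => n /=; exact: ss0.
rewrite big_cat /=; move: hs0; lra.
Qed.

Lemma sum_diff (V : zmodType) s s' (F : int -> V) : uniq s -> uniq s' ->
  \sum_(n <- s) F n - \sum_(n <- s') F n =
  \sum_(n <- s | n \notin s') F n - \sum_(n <- s' | n \notin s) F n.
Proof.
move=> us us'; rewrite (bigID (fun n => n \in s')) /= [X in _ - X](bigID (fun n => n \in s)) /=.
suff -> : \sum_(n <- s | n \in s') F n = \sum_(n <- s' | n \in s) F n.
  by rewrite opprD addrACA subrr add0r.
rewrite -big_filter -[RHS]big_filter; apply: perm_big.
apply: uniq_perm; rewrite ?filter_uniq// => n.
by rewrite !mem_filter andbC.
Qed.

(** The common modes cancel, and what remains of each polynomial lies outside the support of the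
    other, where the tail bound of that other list applies. *)
Lemma sqnorm_tpolyB_le s s' c (e e' : R) : uniq s -> uniq s' ->
  (forall r, uniq r -> {in r, forall n, n \notin s} ->
    \sum_(n <- r) cmod (c n) ^+ 2 <= e) ->
  (forall r, uniq r -> {in r, forall n, n \notin s'} ->
    \sum_(n <- r) cmod (c n) ^+ 2 <= e') ->
  sqnorm (fun x => tpoly s c x - tpoly s' c x) <= 2 * (2 * pi) * (e + e').
Proof.
move=> us us' se se'.
have -> : (fun x => tpoly s c x - tpoly s' c x) =
    (fun x => tpoly [seq n <- s | n \notin s'] c x - tpoly [seq n <- s' | n \notin s] c x).
  by apply/funext => x; rewrite /tpoly sum_diff// !big_filter.
apply: le_trans (sqnormB_le (L2T_tpoly _ _) (L2T_tpoly _ _)) _.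
rewrite !sqnorm_tpoly ?filter_uniq//.
have h1 : \sum_(n <- [seq n <- s | n \notin s']) cmod (c n) ^+ 2 <= e'.
  by apply: se'; rewrite ?filter_uniq// => n; rewrite mem_filter => /andP[].
have h2 : \sum_(n <- [seq n <- s' | n \notin s]) cmod (c n) ^+ 2 <= e.
  by apply: se; rewrite ?filter_uniq// => n; rewrite mem_filter => /andP[].
have p2 := @pi2_gt0 R; move: h1 h2.
by set x := \sum_(_ <- _) _; set y := \sum_(_ <- _) _; nra.
Qed.

Lemma le0_geometric (x K : R) : (forall k, x <= K * 8^-1 ^+ k) -> x <= 0.
Proof.
move=> xK; have cv : K * 8^-1 ^+ k @[k --> \oo] --> (0 : R).
  by apply: (@cvg_geometric _ K 8^-1); rewrite ger0_norm// invf_lt1// ltr1n.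
by rewrite -(cvg_lim _ cv)//; apply: limr_ge; [apply: cvgP cv|exact: nearW].
Qed.

Lemma fourier_coef_sqr_le v n : L2T v ->
  2 * pi * cmod (fourier_coef v n) ^+ 2 <= sqnorm v.
Proof. by move=> v2; have := @bessel _ v [:: n] isT v2; rewrite big_seq1. Qed.

Lemma riesz_fischer c : ell2 c -> exists v, [/\ L2T v,
  forall n, fourier_coef v n = c n &
  forall e, 0 < e -> exists2 s, uniq s & sqnorm (fun x => v x - tpoly s c x) <= e].
Proof.
move=> c2.
have /choice[s_ hs] : forall k : nat, exists s0, uniq s0 /\ forall s, uniq s ->
    {in s, forall n, n \notin s0} -> \sum_(n <- s) cmod (c n) ^+ 2 <= 8^-1 ^+ k.
  move=> k; have [|s0 us0 hs0] := @ell2_tail c (8^-1 ^+ k) c2.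
    by rewrite exprn_gt0.
  by exists s0.
have p2 := @pi2_gt0 R.
have g0 k : (0 : R) < 8^-1 ^+ k by rewrite exprn_gt0.
(* The squared distance of two approximants is at most 2 (2 pi) (8^-k + 8^-l), hence the factor 4
   when k <= l. *)
have [v [v2 hv]] : exists v, L2T v /\
    forall k, sqnorm (fun x => v x - tpoly (s_ k) c x) <= 4 * (2 * pi) * 8^-1 ^+ k.
  apply: L2_complete => [k|k l kl]; first exact: L2T_tpoly.
  have [[uk hk] [ul hl]] := (hs k, hs l).
  apply: le_trans (sqnorm_tpolyB_le ul uk hl hk) _.
  have : (8^-1 : R) ^+ l <= 8^-1 ^+ k.
    by apply: ler_wiXn2l => //; rewrite ?invr_ge0// invf_le1// ler1n.
  by move: p2 (g0 k) (g0 l); nra.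
exists v; split => //.
- move=> n; apply/eqP; rewrite -subr_eq0; apply/eqP.
  apply: ComplexField.Normc.eq0_normc; apply/eqP; rewrite -sqrf_eq0 eq_le sqr_ge0 andbT.
  (* 10 = 2 * 4 + 2 * 1: Bessel bounds the squared coefficient of the error by 4 * 8^-k, and a
     frequency outside [s_ k] has |c n|^2 <= 8^-k. *)
  apply: (@le0_geometric _ 10) => k.
  have [uk hk] := hs k.
  have h1 := fourier_coef_sqr_le n (L2TB v2 (L2T_tpoly (s_ k) c)).
  have {h1} := le_trans h1 (hv k).
  rewrite fourier_coefB//; last exact: L2T_tpoly.
  rewrite fourier_coef_tpoly//; case: ifPn => [nk|nk].
    by move: p2 (g0 k); set x := cmod _ ^+ 2; nra.
  have := hk [:: n] isT; rewrite big_seq1 => /(_ _)/wrap[].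
    by move=> m; rewrite inE => /eqP ->.
  rewrite subr0 => h2 h3.
  have := cmod_sqrD_le (fourier_coef v n) (- c n); rewrite cmodN => h4.
  apply: le_trans h4 _.
  move: p2 (g0 k) h2 h3; set x := cmod _ ^+ 2; set y := cmod _ ^+ 2; nra.
- move=> e e0; have [k hk] : exists k, 4 * (2 * pi) * 8^-1 ^+ k <= e.
    apply: contrapT => /forallNP he.
    have : e <= 0; last by rewrite leNgt e0.
    apply: (@le0_geometric _ (4 * (2 * pi))) => k.
    by apply: ltW; rewrite ltNge; apply/negP; exact: he.
  by exists (s_ k); [have [] := hs k|exact: le_trans (hv k) hk].
Qed.

Definition rng (M : nat) : seq int :=
  [seq (i%:Z - M%:Z)%R | i <- iota 0 (M + M).+1].

Lemma rng_uniq M : uniq (rng M).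
Proof.
by rewrite map_inj_uniq ?iota_uniq// => i j /addIr [].
Qed.

Lemma mem_rng M n : (n \in rng M) = (`|n|%N <= M)%N.
Proof.
apply/mapP/idP; first by case=> k; rewrite mem_iota => ? ->; lia.
move=> nM.
exists (absz (n + M%:Z)); last by lia.
by rewrite mem_iota; lia.
Qed.

Lemma sub_rng s : exists M, {subset s <= rng M}.
Proof.
exists (\sum_(n <- s) `|n|%N)%N => n ns; rewrite mem_rng.
by rewrite (big_rem n)//= leq_addr.
Qed.

End square_summable.

(** * Completeness of the trigonometric system *)

Section power_indicator.
Context {R : realType}.
Implicit Types (a x : R).

Lemma bernoulli a (m : nat) : -1 <= a -> 1 + m%:R * a <= (1 + a) ^+ m.
Proof.
move=> a1; elim: m => [|m IH]; first by rewrite mul0r addr0.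
rewrite exprS -natr1; have h : 0 <= (1 + a) ^+ m by rewrite exprn_ge0//; lra.
have := @ler_wpM2l _ (1 + a) _ _ _ IH; have := sqr_ge0 a; have := ler0n R m.
move=> h1 h2 /(_ ltac:(lra)); nra.
Qed.

(* The approximation of a step function used in the Brosowski-Deutsch proof of
   the Stone-Weierstrass theorem. *)
Definition step (N : nat) x : R := (1 - x ^+ N) ^+ (2 ^ N).

Lemma step_ge0_le1 N x : 0 <= x <= 1 -> 0 <= step N x <= 1.
Proof.
move=> /andP[x0 x1]; have h : 0 <= 1 - x ^+ N <= 1.
  by rewrite subr_ge0 exprn_ile1//= gerBl exprn_ge0.
have /andP[h0 h1] := h.
by rewrite /step exprn_ge0//= exprn_ile1.
Qed.

(** Bernoulli gives the lower bound 1 - (2 x)^N. *)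
Lemma step_cvg1 x : 0 <= x -> x < 2^-1 -> step N x @[N --> \oo] --> (1 : R).
Proof.
move=> x0 x1; apply: (@squeeze_cvgr _ _ _ _ (fun N => 1 - (2 * x) ^+ N) (fun=> 1)).
- near=> N.
  have x11 : 0 <= x <= 1 by apply/andP; split; lra.
  have /andP[_ ->] := step_ge0_le1 N x11; rewrite andbT.
  have := @bernoulli (- x ^+ N) (2 ^ N).
  rewrite exprMn natrX mulrN; apply.
  by rewrite lerNl opprK exprn_ile1//; lra.
- rewrite -[X in _ --> X]subr0; apply: cvgB; first exact: cvg_cst.
  have := @cvg_geometric _ 1 (2 * x); rewrite /geometric /=.
  under eq_fun do rewrite mul1r.
  by apply; rewrite ger0_norm; lra.
- exact: cvg_cst.
Unshelve. all: by end_near. Qed.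

(** Multiplication by (1 + x^N)^(2^N) leaves a quantity at most 1, and Bernoulli bounds that factor
    below by (2 x)^N. *)
Lemma step_cvg0 x : 2^-1 < x -> x <= 1 -> step N x @[N --> \oo] --> (0 : R).
Proof.
move=> x0 x1; apply: (@squeeze_cvgr _ _ _ _ (fun=> 0) (fun N => ((2 * x)^-1) ^+ N)).
- near=> N.
  have x11 : 0 <= x <= 1 by apply/andP; split; lra.
  have /andP[-> _] /= := step_ge0_le1 N x11.
  have xN0 : 0 <= x ^+ N by rewrite exprn_ge0//; lra.
  have xN1 : x ^+ N <= 1 by rewrite exprn_ile1//; lra.
  have h0 : 0 < (2 * x) ^+ N by rewrite exprn_gt0//; lra.
  rewrite exprVn -[_^-1]mul1r ler_pdivlMr//.
  apply: (@le_trans _ _ (step N x * (1 + x ^+ N) ^+ (2 ^ N))).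
    apply: ler_wpM2l; first by have /andP[] := step_ge0_le1 N x11.
    apply: le_trans (@bernoulli (x ^+ N) (2 ^ N) _); last by lra.
    by rewrite exprMn natrX lerDr.
  rewrite /step -exprMn exprn_ile1//; nra.
- exact: cvg_cst.
- have := @cvg_geometric _ 1 ((2 * x)^-1); rewrite /geometric /=.
  under eq_fun do rewrite mul1r.
  apply; rewrite ger0_norm ?invr_ge0 ?invf_lt1//; lra.
Unshelve. all: by end_near. Qed.

End power_indicator.

Section trigonometric_algebra.
Context {R : realType}.
Implicit Types (f g : R -> R[i]) (l : seq (R[i] * int)).

Definition trigonometric f :=
  exists l, f = fun x => \sum_(p <- l) p.1 * mode p.2 x.

Lemma trig_cst (z : R[i]) : trigonometric (fun=> z).
Proof.
exists [:: (z, 0)]; apply/funext => x.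
by rewrite big_seq1 /= /mode mul0r expi0 mulr1.
Qed.

Lemma trig_mode n : trigonometric (mode n).
Proof. by exists [:: (1, n)]; apply/funext => x; rewrite big_seq1 mul1r. Qed.

Lemma trigD f g : trigonometric f -> trigonometric g ->
  trigonometric (fun x => f x + g x).
Proof.
move=> [l ->] [l' ->]; exists (l ++ l'); apply/funext => x.
by rewrite big_cat.
Qed.

Lemma trigM f g : trigonometric f -> trigonometric g ->
  trigonometric (fun x => f x * g x).
Proof.
move=> [l ->] [l' ->].
exists [seq (p.1 * q.1, p.2 + q.2) | p <- l, q <- l']; apply/funext => x.
rewrite big_allpairs_dep /= mulr_suml; apply: eq_bigr => p _.
rewrite mulr_sumr; apply: eq_bigr => q _.
by rewrite modeD; ring.
Qed.

Lemma trigX f n : trigonometric f -> trigonometric (fun x => f x ^+ n).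
Proof.
move=> tf; elim: n => [|n IH].
  by under eq_fun do rewrite expr0; exact: trig_cst.
by under eq_fun do rewrite exprS; exact: trigM.
Qed.

(** A trigonometric polynomial of degree one with values in [0, 1], above 1/2 for 0 < x < y and
    below 1/2 on the rest of the open period; the product form [arc_funE] shows the signs. Composed
    with [step], it approximates the indicator of ]y, 2 pi[. *)
Definition arc_fun (y x : R) : R := 2^-1 + (cos (x - y / 2) - cos (y / 2)) / 4.

Lemma trig_arc_fun y : trigonometric (fun x => (arc_fun y x)%:C).
Proof.
have -> : (fun x => (arc_fun y x)%:C) = (fun x =>
    (2^-1 - cos (y / 2) / 4)%:C + ((8^-1)%:C * expi (- (y / 2)) * mode 1 x +
                            (8^-1)%:C * expi (y / 2) * mode (-1) x)).
  apply/funext => x; apply: complex_eqP; rewrite /mode /expi !ReImE /=.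
    by rewrite /arc_fun cosB mul1r mulN1r !cosN !sinN; field.
  by rewrite mul1r mulN1r !cosN !sinN; ring.
by apply: trigD (trig_cst _) (trigD (trigM (trig_cst _) (trig_mode _)) (trigM (trig_cst _) (trig_mode _))).
Qed.

Lemma trig_step N y : trigonometric (fun x => (step N (arc_fun y x))%:C).
Proof.
have -> : (fun x => (step N (arc_fun y x))%:C) =
    (fun x => (1 + (-1) * (arc_fun y x)%:C ^+ N) ^+ (2 ^ N)).
  by apply/funext => x; rewrite /step rmorphXn /= rmorphB /= rmorphXn /= mulN1r.
apply: trigX; apply: trigD (trig_cst _) (trigM (trig_cst _) _).
exact: trigX (trig_arc_fun y).
Qed.

Lemma arc_funE y x : arc_fun y x = 2^-1 + sin (x / 2) * sin ((y - x) / 2) / 2.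
Proof.
have e1 : x - y / 2 = x / 2 - (y - x) / 2 by field.
have e2 : y / 2 = x / 2 + (y - x) / 2 by field.
by rewrite /arc_fun e1 e2 cosB cosD; field.
Qed.

Lemma arc_fun_itv y x : 0 <= arc_fun y x <= 1.
Proof.
rewrite /arc_fun.
have := cos_geN1 (x - y / 2); have := cos_le1 (x - y / 2).
have := cos_geN1 (y / 2); have := cos_le1 (y / 2).
by move=> *; apply/andP; split; lra.
Qed.

Lemma arc_fun_gt y x : 0 < x -> x < y -> y < 2 * pi -> 2^-1 < arc_fun y x.
Proof.
move=> x0 xy y2; rewrite arc_funE ltrDl divr_gt0// mulr_gt0//.
- by apply: sin_gt0_pi; apply/andP; split; lra.
- by apply: sin_gt0_pi; apply/andP; split; lra.
Qed.

Lemma arc_fun_lt y x : 0 < y -> y < x -> x < 2 * pi -> arc_fun y x < 2^-1.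
Proof.
move=> x0 xy y2; rewrite arc_funE -ltrBrDl subrr.
rewrite (_ : (y - x) / 2 = - ((x - y) / 2)); last by field.
rewrite sinN mulrN mulNr oppr_lt0 divr_gt0// mulr_gt0//.
- by apply: sin_gt0_pi; apply/andP; split; lra.
- by apply: sin_gt0_pi; apply/andP; split; lra.
Qed.

End trigonometric_algebra.

Section uniqueness.
Context {R : realType}.
Implicit Types (u v z : R -> R[i]) (s : seq int) (n : int).

Lemma negligible_set1 (a : R) : mu.-negligible [set a].
Proof.
by exists [set a]; split => //; exact: lebesgue_measure_set1.
Qed.

Lemma cintegral_trig0 z (f : R -> R[i]) : L2T z -> (forall n, fourier_coef z n = 0) ->
  trigonometric f -> cintegral period (fun x => f x * z x) = 0.
Proof.
move=> z2 z0 [l ->]; have mp := @period_measurable R.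
have -> : (fun x => (\sum_(p <- l) p.1 * mode p.2 x) * z x) =
    (fun x => \sum_(p <- l) p.1 * (mode p.2 x * z x)).
  by apply/funext => x; rewrite mulr_suml; apply: eq_bigr => p _; rewrite mulrA.
rewrite (cintegral_sum _ mp); last by move=> p; apply: cintegrableZ => //; exact: cintegrable_modeM.
rewrite big1// => p _; rewrite (cintegralZ _ mp); last exact: cintegrable_modeM.
by rewrite -[p.2]opprK cintegral_fourier z0 !mulr0.
Qed.

Lemma measurable_arc_fun y : measurable_fun [set: R] (@arc_fun R y).
Proof.
apply: measurable_funD; first exact: measurable_cst.
apply: measurable_funM; last exact: measurable_cst.
apply: measurable_funB; last exact: measurable_cst.
apply: (measurableT_comp (f := @cos R)).
  by apply: continuous_measurable_fun => x; exact: continuous_cos.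
by apply: measurable_funB; [exact: measurable_id|exact: measurable_cst].
Qed.

Lemma measurable_step N : measurable_fun [set: R] (@step R N).
Proof.
apply: measurable_funX; apply: measurable_funB; first exact: measurable_cst.
by apply: measurable_funX; exact: measurable_id.
Qed.

(** Dominated convergence with majorant |g|, off the three points 0, [y] and 2 pi where [arc_fun y]
    takes the threshold value 1/2. *)
Lemma Rintegral_arc0 (g : R -> R) y :
  mu.-integrable period (EFin \o g) ->
  (forall N, \int[mu]_(x in period) (step N (arc_fun y x) * g x) = 0) ->
  0 < y < 2 * pi -> \int[mu]_(x in period) (g \_ `]y, +oo[) x = 0.
Proof.
move=> ig g0 /andP[y0 y2]; have mp := @period_measurable R.
have mg : measurable_fun (period : set (measurableTypeR R)) g.
  by apply/measurable_EFinP; case/integrableP: ig.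
have mgy : measurable_fun (period : set (measurableTypeR R)) (g \_ `]y, +oo[).
  have my : measurable (`]y, +oo[ : set (measurableTypeR R)) by exact: measurable_itv.
  by apply/(measurable_restrict g my mp); apply: measurable_funS mg => // x [].
have mh N : measurable_fun (period : set (measurableTypeR R)) (fun x => step N (arc_fun y x) * g x).
  apply: measurable_funM => //.
  apply: measurable_funTS; apply: (measurableT_comp (f := step N)).
    exact: measurable_step.
  exact: measurable_arc_fun.
have := @dominated_convergence _ _ _ mu period mp
  (fun N x => (step N (arc_fun y x) * g x)%:E) (fun x => ((g \_ `]y, +oo[) x)%:E)
  (fun x => `|g x|%:E).
case.
- by move=> N; apply/measurable_EFinP; exact: mh.
- exact/measurable_EFinP.
- have := negligibleU (negligible_set1 0) (negligibleU (negligible_set1 y) (negligible_set1 (2 * pi))).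
  apply: negligibleS => x /= /not_implyP[]; rewrite /period /= in_itv /= => /andP[x0 x2].
  apply: contra_notP => /not_orP[/eqP xn0] /not_orP[/eqP xny /eqP xn2].
  have {}x0 : 0 < x by rewrite lt_neqAle eq_sym xn0.
  have {}x2 : x < 2 * pi by rewrite lt_neqAle xn2.
  have cv : step N (arc_fun y x) * g x @[N --> \oo] --> (g \_ `]y, +oo[) x.
    have /andP[a0 a1] := arc_fun_itv y x.
    rewrite /patch mem_setE in_itv /= andbT; case: ifPn => xy.
      have := cvgM (step_cvg1 a0 (arc_fun_lt y0 xy x2)) (cvg_cst (g x)).
      by rewrite mul1r; apply.
    have {}xy : x < y by rewrite lt_neqAle xny leNgt.
    have := cvgM (step_cvg0 (arc_fun_gt x0 xy y2) a1) (cvg_cst (g x)).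
    by rewrite mul0r; apply.
  by apply/fine_cvgP; split; [exact: nearW|exact: cv].
- have := integrable_abse ig; exact.
- apply: aeW => x N _; rewrite /= lee_fin normrM ler_piMl// ger0_norm.
    by have /andP[] := step_ge0_le1 N (arc_fun_itv y x).
  by have /andP[] := step_ge0_le1 N (arc_fun_itv y x).
move=> igy _; have -> : [sequence (\int[mu]_(x in period) (step N (arc_fun y x) * g x)%:E)%E]_N = cst 0%E.
  apply/funext => N /=; have := g0 N; rewrite /Rintegral => h.
  rewrite -[LHS]fineK ?h//; apply: (integrable_fin_num mp).
  apply: (le_integrable mp _ _ ig).
    by apply/measurable_EFinP; exact: mh.
  move=> x _; rewrite /= lee_fin normrM ler_piMl// ger0_norm.
    by have /andP[] := step_ge0_le1 N (arc_fun_itv y x).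
  by have /andP[] := step_ge0_le1 N (arc_fun_itv y x).
move=> h; rewrite /Rintegral.
suff <- : (0 = \int[mu]_(x in period) ((g \_ `]y, +oo[) x)%:E)%E by [].
by apply: (cvg_unique _ (cvg_cst _) h).
Qed.

(** By Lebesgue differentiation [g] is almost everywhere the derivative of its primitive, which
    vanishes on the open period; the two endpoints join the null set. *)
Lemma ae_eq0_of_primitive (g : R -> R) : mu.-integrable period (EFin \o g) ->
  (forall y, 0 < y < 2 * pi -> \int[mu]_(x in period) (g \_ `]-oo, y]) x = 0) ->
  {ae mu, forall x, period x -> g x = 0}.
Proof.
move=> ig g0; have mp := @period_measurable R.
pose f := g \_ period.
have iF : mu.-integrable [set: measurableTypeR R] (EFin \o f).
  by have := (integrable_mkcond _ mp).1 ig; rewrite /f -restrict_EFin.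
have iy y : mu.-integrable `]-oo, y] (EFin \o f) by apply: integrableS iF.
have aeF := @FTC1Ny R f iy (open_integrable_locally openT iF).
have := negligibleU aeF (negligibleU (negligible_set1 0) (negligible_set1 (2 * pi))).
apply: negligibleS => x /= /not_implyP[px gx0].
have [/andP[x0 x2]|xe] := boolP (0 < x < 2 * pi); last first.
  right; move: px xe; rewrite /period /= in_itv /= => /andP[x0 x2].
  rewrite negb_and -!leNgt => /orP[x0'|x2']; [left|right]; apply/eqP; rewrite eq_le.
    by rewrite x0 x0'.
  by rewrite x2 x2'.
left => -[_]; rewrite {2}/f patchE mem_set// derive1E.
rewrite (@near_eq_derive _ _ _ _ (cst 0)).
  by rewrite derive_cst => /esym.
have : x \in `]0, 2 * pi[ by rewrite in_itv /= x0 x2.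
move/near_in_itvoo; apply: filterS => y; rewrite in_itv /= => y02.
rewrite -(g0 y y02) -Rintegral_mkcondr setIC Rintegral_mkcondr.
by [].
Qed.
Lemma ae_eq0_of_step (g : R -> R) : mu.-integrable period (EFin \o g) ->
  \int[mu]_(x in period) g x = 0 ->
  (forall y N, \int[mu]_(x in period) (step N (arc_fun y x) * g x) = 0) ->
  {ae mu, forall x, period x -> g x = 0}.
Proof.
move=> ig g0 gs; apply: ae_eq0_of_primitive => // y y02.
have mp := @period_measurable R.
have my : measurable (`]y, +oo[ : set (measurableTypeR R)) by exact: measurable_itv.
have igy : mu.-integrable period (EFin \o (g \_ `]y, +oo[)).
  apply: (le_integrable mp _ _ ig).
    apply/measurable_EFinP; apply/(measurable_restrict g my mp).
    apply: (@measurable_funS _ _ _ _ period) => //.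
    by apply/measurable_EFinP; case/integrableP: ig.
  by move=> x _; rewrite /= /patch; case: ifP => // _; rewrite normr0 lee_fin.
have := Rintegral_arc0 ig (gs y) y02.
move=> h; rewrite -[RHS]subr0 -{1}g0 -h -RintegralB//; apply: eq_Rintegral => x _.
rewrite !patchE !mem_setE !in_itv /= andbT.
by case: leP => _; rewrite ?subr0 ?subrr.
Qed.

(** The test functions built from [step] and [arc_fun] are trigonometric polynomials with real
    values, so orthogonality to all modes passes to the real and imaginary parts of [z]
    separately. *)
Theorem fourier_uniqueness z : L2T z -> (forall n, fourier_coef z n = 0) ->
  sqnorm z = 0.
Proof.
move=> z2 z0; have mp := @period_measurable R.
have [i1 i2] := L2T_cintegrable z2.
have hs y N : cintegral period (fun x => (step N (arc_fun y x))%:C * z x) = 0.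
  by apply: cintegral_trig0 => //; exact: trig_step.
have h1 : cintegral period z = 0.
  have := cintegral_trig0 z2 z0 (trig_cst 1).
  by under eq_fun do rewrite mul1r.
have aeR := @ae_eq0_of_step (fun x => Re (z x)) i1 (congr1 (@complex.Re R) h1).
have aeI := @ae_eq0_of_step (fun x => Im (z x)) i2 (congr1 (@complex.Im R) h1).
have {}aeR : {ae mu, forall x, period x -> Re (z x) = 0}.
  apply: aeR => y N; rewrite -[RHS](congr1 (@complex.Re R) (hs y N)) /=.
  by apply: eq_Rintegral => x _; rewrite !ReImE mul0r subr0.
have {}aeI : {ae mu, forall x, period x -> Im (z x) = 0}.
  apply: aeI => y N; rewrite -[RHS](congr1 (@complex.Im R) (hs y N)) /=.
  by apply: eq_Rintegral => x _; rewrite !ReImE mul0r addr0.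
suff : esqnorm z = 0%E by rewrite esqnormE// => -[].
rewrite /esqnorm -[RHS](integral0 mu period); apply: ge0_ae_eq_integral => //.
- exact: (measurable_sqr_cmod (L2T_meas z2)).
- by move=> x _; rewrite lee_fin sqr_ge0.
- apply: filterS2 aeR aeI => x hR hI px.
  by rewrite cmod_sqr hR// hI// expr0n addr0.
Qed.

Lemma sqnorm_subC u v : sqnorm (fun x => u x - v x) = sqnorm (fun x => v x - u x).
Proof. by rewrite -sqnormN; congr sqnorm; apply/funext => x; rewrite opprB. Qed.

Lemma fourier_coef_ell2 u : L2T u -> ell2 (fourier_coef u).
Proof.
move=> u2; exists ((2 * pi)^-1 * sqnorm u) => s us.
by rewrite ler_pdivlMl ?pi2_gt0// bessel.
Qed.

Lemma sqnorm_trans_le u v z : L2T u -> L2T v -> L2T z ->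
  sqnorm (fun x => u x - z x) <=
  2 * sqnorm (fun x => u x - v x) + 2 * sqnorm (fun x => v x - z x).
Proof.
move=> u2 v2 z2; have := sqnormD_le (L2TB u2 v2) (L2TB v2 z2).
by under eq_fun do rewrite addrA subrK.
Qed.

Lemma sqnorm_partial_subset u s s' : L2T u -> uniq s -> uniq s' -> {subset s <= s'} ->
  sqnorm (fun x => u x - tpoly s' (fourier_coef u) x) <=
  sqnorm (fun x => u x - tpoly s (fourier_coef u) x).
Proof.
move=> u2 us us' ss'; rewrite !sqnorm_sub_partial// lerD2l lerN2.
rewrite ler_pM2l ?pi2_gt0// -subr_ge0 sum_diff//.
rewrite [X in _ - X]big1_seq ?subr0; first by apply: sumr_ge0 => n _; exact: sqr_ge0.
by move=> n /andP[+ ns]; rewrite ss'.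
Qed.

(** The function that Riesz-Fischer rebuilds from the coefficients of [u] equals [u] in L2 by
    uniqueness, so some partial sum is close. Enlarging the list only decreases the error, hence the
    bound for every list containing [rng M]. *)
Theorem plancherel u (e : R) : L2T u -> 0 < e -> exists M, forall s, uniq s ->
  {subset rng M <= s} -> sqnorm (fun x => u x - tpoly s (fourier_coef u) x) <= e.
Proof.
move=> u2 e0; have [v [v2 vu hv]] := riesz_fischer (fourier_coef_ell2 u2).
have [|s0 us0 hs0] := hv (e / 2); first by rewrite divr_gt0.
have uv : sqnorm (fun x => u x - v x) = 0.
  apply: fourier_uniqueness; first exact: L2TB.
  by move=> n; rewrite fourier_coefB// vu subrr.
have [M s0M] := sub_rng s0; exists M => s us Ms.
apply: le_trans (@sqnorm_partial_subset u s0 s u2 us0 us _) _.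
  by move=> n /s0M /Ms.
apply: le_trans (sqnorm_trans_le u2 v2 (L2T_tpoly _ _)) _.
by rewrite uv; move: hs0; lra.
Qed.

End uniqueness.

(** * The propagator and the Strichartz functional *)

Section propagator.
Context {R : realType}.
Implicit Types (u v w : R -> R[i]) (s : seq int) (c : int -> R[i]) (t : R).

Definition evolve t c : int -> R[i] := fun n => expi (- (n%:~R ^+ 2 * t)) * c n.

Lemma cmod_evolve t c n : cmod (evolve t c n) = cmod (c n).
Proof. by rewrite cmodM cmod_expi mul1r. Qed.

Lemma ell2_evolve t c : ell2 c -> ell2 (evolve t c).
Proof.
move=> [G cG]; exists G => s us; apply: le_trans (cG s us).
by apply: ler_sum => n _; rewrite cmod_evolve.
Qed.

Lemma schrodinger_spec t u : L2T u -> L2T (schrodinger t u) /\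
  forall n, fourier_coef (schrodinger t u) n = evolve t (fourier_coef u) n.
Proof.
move=> u2; have [v [v2 vu _]] := riesz_fischer (ell2_evolve t (fourier_coef_ell2 u2)).
exact: (@xgetPex _ (fun=> 0) [set v | L2T v /\ forall n, fourier_coef v n = _] (ex_intro _ v (conj v2 vu))).
Qed.

Lemma L2T_schrodinger t u : L2T u -> L2T (schrodinger t u).
Proof. by case/(schrodinger_spec t). Qed.

Lemma sqnorm_schrodinger_tpoly t s c : uniq s ->
  sqnorm (fun x => schrodinger t (tpoly s c) x - tpoly s (evolve t c) x) = 0.
Proof.
move=> us; have [S2 hS] := schrodinger_spec t (L2T_tpoly s c).
apply: fourier_uniqueness => [|n]; first by apply: L2TB => //; exact: L2T_tpoly.
rewrite fourier_coefB//; last exact: L2T_tpoly.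
rewrite hS /evolve !fourier_coef_tpoly//.
by case: ifP => _; rewrite ?mulr0 subrr.
Qed.

(** The three values of the flow are picked by [xget] independently, so additivity is stated up to a
    null function; it follows by comparing coefficients. *)
Lemma sqnorm_schrodingerD t u v : L2T u -> L2T v ->
  sqnorm (fun x => schrodinger t u x -
                 (schrodinger t v x + schrodinger t (fun y => u y - v y) x)) = 0.
Proof.
move=> u2 v2; have uv2 := L2TB u2 v2.
have [Su hu] := schrodinger_spec t u2; have [Sv hv] := schrodinger_spec t v2.
have [Suv huv] := schrodinger_spec t uv2.
apply: fourier_uniqueness => [|n]; first by apply: L2TB => //; exact: L2TD.
rewrite fourier_coefB//; last exact: L2TD.
rewrite fourier_coefD// hu hv huv /evolve fourier_coefB//; ring.
Qed.

End propagator.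

(** * The quartic functional at a fixed time *)

Section quartic_functional.
Context {R : realType}.
Implicit Types (u v w : R -> R[i]) (s : seq int) (c : int -> R[i]) (t N : R).

Definition Phi v : \bar R := (\int[mu]_(x in period) (cmod (v x) ^+ 4)%:E)%E.

(* Truncated at height [N], the integrand is Lipschitz, hence its integral is
   continuous in L2; letting [N] grow, [Phi] is lower semicontinuous, and its
   measurability along the flow follows as well. *)
Definition trunc4 N (z : R[i]) : R := Num.min (cmod z) N ^+ 4.

Definition PhiN N v : R := \int[mu]_(x in period) trunc4 N (v x).

Lemma min_ge0 N (z : R[i]) : 0 <= N -> 0 <= Num.min (cmod z) N <= N.
Proof. by move=> N0; rewrite le_min cmod_ge0 N0 /= ge_min lexx orbT. Qed.

Lemma trunc4_ge0 N (z : R[i]) : 0 <= N -> 0 <= trunc4 N z.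
Proof. by move=> N0; rewrite exprn_ge0//; have /andP[] := min_ge0 z N0. Qed.

Lemma trunc4_le N (z : R[i]) : 0 <= N -> trunc4 N z <= N ^+ 4.
Proof.
by move=> N0; have /andP[h0 h1] := min_ge0 z N0; rewrite lerXn2r ?nnegrE.
Qed.

Lemma trunc4_lip N (z w : R[i]) : 0 <= N ->
  trunc4 N z - trunc4 N w <= 4 * N ^+ 3 * cmod (z - w).
Proof.
move=> N0; have /andP[a0 aN] := min_ge0 z N0; have /andP[b0 bN] := min_ge0 w N0.
have hd : Num.min (cmod z) N - Num.min (cmod w) N <= cmod (z - w).
  have := ler_cmod_dist z w; rewrite ler_norml => /andP[h1 h2].
  by have := cmod_ge0 (z - w); case: (leP (cmod z) N); case: (leP (cmod w) N) => *; lra.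
rewrite /trunc4; move: a0 aN b0 bN hd.
set a := Num.min _ _; set b := Num.min _ _ => a0 aN b0 bN hd.
have -> : a ^+ 4 - b ^+ 4 = (a - b) * (a ^+ 3 + a ^+ 2 * b + a * b ^+ 2 + b ^+ 3) by ring.
have hN3 x : 0 <= x -> x <= N -> 0 <= x ^+ 3 <= N ^+ 3.
  by move=> x0 xN; rewrite exprn_ge0//= lerXn2r ?nnegrE.
have q0 : 0 <= a ^+ 3 + a ^+ 2 * b + a * b ^+ 2 + b ^+ 3.
  by rewrite !addr_ge0 ?mulr_ge0 ?exprn_ge0.
have q1 : a ^+ 3 + a ^+ 2 * b + a * b ^+ 2 + b ^+ 3 <= 4 * N ^+ 3.
  have /andP[_ h1] := hN3 a a0 aN; have /andP[_ h2] := hN3 b b0 bN.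
  have h3 : a ^+ 2 * b <= N ^+ 2 * N by rewrite ler_pM ?exprn_ge0 ?lerXn2r ?nnegrE.
  have h4 : a * b ^+ 2 <= N * N ^+ 2 by rewrite ler_pM ?exprn_ge0 ?lerXn2r ?nnegrE.
  rewrite -exprSr in h3; rewrite -exprS in h4; lra.
have := cmod_ge0 (z - w); set d := cmod _ in hd * => d0; clearbody d.
set q := (X in X <= 4 * _) in q1; rewrite -/q in q0 *; nra.
Qed.

Lemma measurable_trunc4 d (T : measurableType d) N (f : T -> R[i]) : cmeas f ->
  measurable_fun [set: T] (fun x => trunc4 N (f x)).
Proof.
move=> mf; apply: measurable_funX; apply: measurable_minr.
  exact: measurable_cmod.
exact: measurable_cst.
Qed.

Lemma integrable_trunc4 N v : 0 <= N -> cmeasurable v ->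
  mu.-integrable period (EFin \o (fun x => trunc4 N (v x))).
Proof.
move=> N0 mv; have mp := @period_measurable R.
apply: (le_integrable mp _ _ (integrable_cst_period (N ^+ 4))).
  by apply/measurable_EFinP; apply: measurable_funTS; exact: measurable_trunc4.
move=> x _ /=; rewrite lee_fin !ger0_norm ?exprn_ge0 ?trunc4_ge0//.
exact: trunc4_le.
by have /andP[] := min_ge0 (v x) N0.
Qed.

(** The Lipschitz bound is combined with the pointwise inequality d <= e + d^2 / e for d = |v - w|,
    which passes from the L1 to the L2 distance at the price of the free parameter [e]. *)
Lemma PhiN_close N v w (e : R) : 0 <= N -> 0 < e -> L2T v -> L2T w ->
  PhiN N v - PhiN N w <=
  4 * N ^+ 3 * (2 * pi * e + e^-1 * sqnorm (fun x => v x - w x)).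
Proof.
move=> N0 e0 v2 w2; have mp := @period_measurable R.
have i2 := L2T_integrable (L2TB v2 w2).
have i2' := integrableZl_EFin e^-1 mp i2.
have ie := integrable_cst_period e.
have is_ := integrableZl_EFin (4 * N ^+ 3) mp (integrableD mp ie i2').
rewrite /PhiN -RintegralB//; try (by apply: integrable_trunc4 => //; exact: L2T_meas).
rewrite -Rintegral_cst_period /sqnorm -RintegralZl// -RintegralD//.
rewrite -RintegralZl//; last exact: (integrableD mp ie i2').
apply: (le_Rintegral mp) => //.
  exact: (integrableB mp (integrable_trunc4 N0 (L2T_meas v2)) (integrable_trunc4 N0 (L2T_meas w2))).
move=> x _; apply: le_trans (trunc4_lip _ _ N0) _.
rewrite ler_wpM2l ?mulr_ge0 ?exprn_ge0//.
have c0 := cmod_ge0 (v x - w x); set d := cmod _ in c0 *.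
rewrite -(ler_pM2r e0) mulrDl mulrAC mulVf ?gt_eqF// mul1r.
by have := sqr_ge0 (e - d); nra.
Qed.

Lemma PhiN_cvg N (v_ : nat -> R -> R[i]) v : 0 <= N ->
  (forall k, L2T (v_ k)) -> L2T v ->
  (forall e, 0 < e -> \forall k \near \oo, sqnorm (fun x => v_ k x - v x) <= e) ->
  PhiN N (v_ k) @[k --> \oo] --> PhiN N v.
Proof.
move=> N0 v_2 v2 hv; apply/cvgrPdist_le => e e0.
(* The final 1 keeps [C] positive when [N] = 0. With h = e / C and squared distance at most h^2, the
   bound of [PhiN_close] is at most h C = e. *)
pose C := 4 * N ^+ 3 * (2 * pi + 1) + 1.
have N3 : 0 <= N ^+ 3 by rewrite exprn_ge0.
have p2 := @pi2_gt0 R.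
have C0 : 0 < C by rewrite ltr_wpDl// !mulr_ge0// addr_ge0// ltW.
pose h := e / C; have h0 : 0 < h by rewrite divr_gt0.
have hC : h * C = e by rewrite /h divfK// gt_eqF.
have hh0 : 0 < h ^+ 2 by rewrite exprn_gt0.
near=> k; have vk : sqnorm (fun x => v_ k x - v x) <= h ^+ 2.
  by near: k; exact: hv.
have key (a : R) : a <= h ^+ 2 -> 4 * N ^+ 3 * (2 * pi * h + h^-1 * a) <= e.
  move=> ah; have : h^-1 * a <= h by rewrite ler_pdivrMl// -expr2.
  move=> {}ah; rewrite -hC /C; nra.
rewrite ler_norml lerBrDr; apply/andP; split.
  have := PhiN_close N0 h0 (v_2 k) v2; have := key _ vk; lra.
have := PhiN_close N0 h0 v2 (v_2 k); rewrite sqnorm_subC; have := key _ vk; lra.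
Unshelve. all: by end_near. Qed.

Lemma Phi_ge0 v : (0 <= Phi v)%E.
Proof. by apply: integral_ge0 => x _; rewrite lee_fin exprn_ge0// cmod_ge0. Qed.

Lemma PhiN_EFin N v : 0 <= N -> L2T v ->
  (PhiN N v)%:E = (\int[mu]_(x in period) (trunc4 N (v x))%:E)%E.
Proof.
move=> N0 v2; rewrite /PhiN /Rintegral fineK//.
exact: (integrable_fin_num (@period_measurable R) (integrable_trunc4 N0 (L2T_meas v2))).
Qed.

Lemma PhiN_le_Phi N v : 0 <= N -> L2T v -> ((PhiN N v)%:E <= Phi v)%E.
Proof.
move=> N0 v2; rewrite PhiN_EFin//; apply: ge0_le_integral => //.
- exact: period_measurable.
- by move=> x _; rewrite lee_fin trunc4_ge0.
- by apply/measurable_EFinP; apply: measurable_funTS; apply: measurable_trunc4; exact: L2T_meas.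
- apply/measurable_EFinP; apply: measurable_funTS; apply: measurable_funX.
  by apply: measurable_cmod; exact: L2T_meas.
- move=> x _; rewrite lee_fin lerXn2r ?nnegrE ?cmod_ge0//.
    by have /andP[] := min_ge0 (v x) N0.
  by rewrite ge_min lexx.
Qed.

Lemma PhiN_cvg_Phi v : L2T v -> (PhiN n%:R v)%:E @[n --> \oo] --> Phi v.
Proof.
move=> v2; have mp := @period_measurable R.
under eq_fun do rewrite (PhiN_EFin (ler0n _ _) v2).
have -> : Phi v = (\int[mu]_(x in period) limn (fun n => (trunc4 n%:R (v x))%:E))%E.
  apply: eq_integral => x _; apply/esym/cvg_lim => //.
  apply: cvg_near_cst; near=> n; congr (_ ^+ 4)%:E.
  apply/min_idPl; near: n; exact: nbhs_infty_ger.
apply: cvg_monotone_convergence => //.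
- move=> n; apply/measurable_EFinP; apply: measurable_funTS; apply: measurable_trunc4.
  exact: L2T_meas.
- by move=> n x _; rewrite lee_fin trunc4_ge0.
- move=> x _ n m nm; rewrite lee_fin lerXn2r ?nnegrE//.
  + by have /andP[] := @min_ge0 n%:R (v x) (ler0n _ _).
  + by have /andP[] := @min_ge0 m%:R (v x) (ler0n _ _).
  + by rewrite le_min2// ler_nat.
Unshelve. all: by end_near. Qed.

Lemma Phi_lsc (v_ : nat -> R -> R[i]) v (K : \bar R) :
  (forall k, L2T (v_ k)) -> L2T v ->
  (forall e, 0 < e -> \forall k \near \oo, sqnorm (fun x => v_ k x - v x) <= e) ->
  (\forall k \near \oo, (Phi (v_ k) <= K)%E) -> (Phi v <= K)%E.
Proof.
move=> v_2 v2 hv hK; rewrite -(cvg_lim _ (PhiN_cvg_Phi v2))//.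
apply: lime_le; first exact: cvgP (PhiN_cvg_Phi v2).
apply: nearW => n.
have cv : (PhiN n%:R (v_ k))%:E @[k --> \oo] --> (PhiN n%:R v)%:E.
  by apply/fine_cvgP; split; [exact: nearW|exact: PhiN_cvg].
rewrite -(cvg_lim _ cv)//; apply: lime_le; first exact: cvgP cv.
by apply: filterS hK => k; apply: le_trans; exact: PhiN_le_Phi.
Qed.

Lemma Phi_le_eq v w : L2T v -> L2T w -> sqnorm (fun x => v x - w x) = 0 ->
  (Phi v <= Phi w)%E.
Proof.
move=> v2 w2 vw; apply: (@Phi_lsc (fun=> w)) => //.
  by move=> e e0; apply: nearW => _; rewrite sqnorm_subC vw ltW.
exact: nearW.
Qed.

Lemma Phi_eq v w : L2T v -> L2T w -> sqnorm (fun x => v x - w x) = 0 -> Phi v = Phi w.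
Proof.
move=> v2 w2 vw; apply/eqP; rewrite eq_le Phi_le_eq//= Phi_le_eq//.
by rewrite sqnorm_subC.
Qed.

Lemma exp4D_le (r a b : R) : 0 < r < 1 ->
  (a + b) ^+ 4 <= (1 - r) ^- 3 * a ^+ 4 + r ^- 3 * b ^+ 4.
Proof.
(* Convexity of the square with weights [1 - r] and [r], used twice. *)
move=> /andP[r0 r1]; have r10 : 0 < 1 - r by rewrite subr_gt0.
have sq x y : (x + y) ^+ 2 <= (1 - r)^-1 * x ^+ 2 + r^-1 * y ^+ 2.
  rewrite -subr_ge0.
  have -> : (1 - r)^-1 * x ^+ 2 + r^-1 * y ^+ 2 - (x + y) ^+ 2 =
     (r * x - (1 - r) * y) ^+ 2 / (r * (1 - r)).
    by field; rewrite !gt_eqF.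
  by rewrite divr_ge0 ?sqr_ge0// ltW// mulr_gt0.
have h1 := sq a b; have h2 := sq ((1 - r)^-1 * a ^+ 2) (r^-1 * b ^+ 2).
have -> : (1 - r) ^- 3 * a ^+ 4 + r ^- 3 * b ^+ 4 =
  (1 - r)^-1 * ((1 - r)^-1 * a ^+ 2) ^+ 2 + r^-1 * (r^-1 * b ^+ 2) ^+ 2.
  by field; rewrite !gt_eqF.
apply: le_trans h2; rewrite (_ : 4 = 2 * 2)%N// exprM.
by rewrite lerXn2r ?nnegrE ?sqr_ge0// (le_trans _ h1) ?sqr_ge0.
Qed.

(** As [r] tends to 0 the factor of [Phi v] tends to 1, while the large factor falls on the
    increment [w]; this takes the place of the triangle inequality for the L4 norm. *)
Lemma PhiD_le (r : R) v w : 0 < r < 1 -> cmeasurable v -> cmeasurable w ->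
  (Phi (fun x => (v x + w x)%R) <=
   ((1 - r) ^- 3)%R%:E * Phi v + (r ^- 3)%R%:E * Phi w)%E.
Proof.
move=> r01 mv mw; have /andP[r0 r1] := r01; have mp := @period_measurable R.
have m4 f : cmeasurable f ->
    measurable_fun (period : set (measurableTypeR R)) (fun x => (cmod (f x) ^+ 4)%:E).
  move=> mf; apply/measurable_EFinP; apply: measurable_funTS; apply: measurable_funX.
  exact: measurable_cmod.
have p4 (f : R -> R[i]) x : (0 <= (cmod (f x) ^+ 4)%:E)%E.
  by rewrite lee_fin exprn_ge0// cmod_ge0.
have k1 : 0 <= (1 - r) ^- 3 by rewrite invr_ge0 exprn_ge0// subr_ge0 ltW.
have k2 : 0 <= r ^- 3 by rewrite invr_ge0 exprn_ge0// ltW.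
rewrite /Phi -!ge0_integralZl//; try exact: m4.
rewrite -ge0_integralD//; first last.
- by apply: measurable_funeM; exact: m4.
- by move=> x _; rewrite mule_ge0.
- by apply: measurable_funeM; exact: m4.
- by move=> x _; rewrite mule_ge0.
apply: ge0_le_integral => //.
- by move=> x _; exact: (p4 (fun x => v x + w x)).
- have mvw : cmeasurable (fun x => v x + w x) by exact: cmeasD.
  exact: (m4 _ mvw).
- by apply: emeasurable_funD; apply: measurable_funeM; [exact: (m4 _ mv)|exact: (m4 _ mw)].
- move=> x _; rewrite -!EFinM -EFinD lee_fin; apply: le_trans (exp4D_le _ _ r01).
  by rewrite lerXn2r ?nnegrE ?addr_ge0 ?cmod_ge0// ler_cmodD.
Qed.

End quartic_functional.

Section time_integral.
Context {R : realType}.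
Implicit Types (u v w : R -> R[i]) (s : seq int) (c : int -> R[i]) (t N B : R).

Lemma cmeas_evolution s c :
  cmeas (fun p : measurableTypeR R * measurableTypeR R => tpoly s (evolve p.1 c) p.2).
Proof.
apply: cmeas_sum => n; apply: cmeasM; last first.
  apply: cmeas_expi; apply: measurable_funM; first exact: measurable_cst.
  exact: measurable_snd.
apply: cmeasM; last exact: cmeas_cst.
apply: cmeas_expi; under eq_fun do rewrite -mulNr.
by apply: measurable_funM; [exact: measurable_cst|exact: measurable_fst].
Qed.

(** The evolution of a polynomial has an explicit jointly measurable formula, so Tonelli applies;
    the indicator of [period] turns the inner integral into one over the whole line. *)
Lemma measurable_PhiN_evolve N s c : 0 <= N ->
  measurable_fun [set: measurableTypeR R] (fun t => PhiN N (tpoly s (evolve t c))).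
Proof.
move=> N0; apply/measurable_EFinP.
pose f (p : measurableTypeR R * measurableTypeR R) : \bar R :=
  (trunc4 N (tpoly s (evolve p.1 c) p.2) * \1_period p.2)%:E.
have mf : measurable_fun setT f.
  apply/measurable_EFinP; apply: measurable_funM.
    by apply: measurable_trunc4; exact: cmeas_evolution.
  have mI : measurable_fun [set: measurableTypeR R] (\1_(@period R) : measurableTypeR R -> R).
    by apply: measurable_indic; exact: period_measurable.
  exact: (measurableT_comp mI measurable_snd).
have f0 p : (0 <= f p)%E by rewrite lee_fin mulr_ge0 ?trunc4_ge0.
have := @measurable_fun_fubini_tonelli_F _ _ _ _ _ (@lebesgue_measure R) f mf f0.
congr measurable_fun; apply/funext => t /=.
rewrite PhiN_EFin//; last exact: L2T_tpoly.
rewrite integral_mkcond; apply: eq_integral => x _.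
rewrite /f /= /patch indicE; case: ifPn => _; last by rewrite mulr0.
by rewrite mulr1.
Qed.

Lemma near_sqnorm_schrodinger t u : L2T u -> forall e, 0 < e -> \forall k \near \oo,
  sqnorm (fun x => tpoly (rng k) (evolve t (fourier_coef u)) x - schrodinger t u x) <= e.
Proof.
move=> u2 e e0; have [S2 hS] := schrodinger_spec t u2.
have [M hM] := plancherel S2 e0.
have hS' : fourier_coef (schrodinger t u) = evolve t (fourier_coef u) by apply/funext.
near=> k; rewrite sqnorm_subC -hS'; apply: hM; first exact: rng_uniq.
move=> n; rewrite !mem_rng => /leq_trans; apply.
by near: k; exact: nbhs_infty_ge.
Unshelve. all: by end_near. Qed.

(** Representatives chosen time by time give no joint measurability, so the function of [t] is
    reached by an iterated pointwise limit: polynomial approximations at a fixed truncation height,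
    then the height. *)
Lemma measurable_Phi_schrodinger u : L2T u ->
  measurable_fun [set: measurableTypeR R] (fun t => Phi (schrodinger t u)).
Proof.
move=> u2; apply: (emeasurable_fun_cvg (fun n t => (PhiN n%:R (schrodinger t u))%:E)).
- move=> n; apply/measurable_EFinP.
  apply: (measurable_fun_cvg (h := fun k t => PhiN n%:R (tpoly (rng k) (evolve t (fourier_coef u))))).
    by move=> k; exact: measurable_PhiN_evolve.
  move=> t _; apply: PhiN_cvg => //; first by move=> k; exact: L2T_tpoly.
    exact: L2T_schrodinger.
  exact: near_sqnorm_schrodinger.
- by move=> t _; apply: PhiN_cvg_Phi; exact: L2T_schrodinger.
Qed.

Lemma WE B u : W B u = (\int[mu]_(t in `[0%R, B]) Phi (schrodinger t u))%E.
Proof. by []. Qed.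

Lemma W_ge0 B u : (0 <= W B u)%E.
Proof. by apply: integral_ge0 => t _; exact: Phi_ge0. Qed.

Lemma WD_le B (r : R) u v : 0 < r < 1 -> L2T u -> L2T v ->
  (W B u <= ((1 - r) ^- 3)%R%:E * W B v + (r ^- 3)%R%:E * W B (fun x => (u x - v x)%R))%E.
Proof.
move=> r01 u2 v2; have /andP[r0 r1] := r01.
have uv2 := L2TB u2 v2.
have mB : measurable (`[0, B] : set (measurableTypeR R)) by exact: measurable_itv.
have m4 w : L2T w ->
    measurable_fun (`[0, B] : set (measurableTypeR R)) (fun t => Phi (schrodinger t w)).
  by move=> w2; apply: measurable_funTS; exact: measurable_Phi_schrodinger.
have k1 : 0 <= (1 - r) ^- 3 by rewrite invr_ge0 exprn_ge0// subr_ge0 ltW.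
have k2 : 0 <= r ^- 3 by rewrite invr_ge0 exprn_ge0// ltW.
rewrite !WE -!ge0_integralZl//; try (by move=> *; exact: Phi_ge0); try exact: m4.
rewrite -ge0_integralD//; first last.
- by apply: measurable_funeM; exact: m4.
- by move=> x _; rewrite mule_ge0// Phi_ge0.
- by apply: measurable_funeM; exact: m4.
- by move=> x _; rewrite mule_ge0// Phi_ge0.
apply: ge0_le_integral => //.
- by move=> t _; exact: Phi_ge0.
- exact: m4.
- by apply: emeasurable_funD; apply: measurable_funeM; [exact: (m4 _ v2)|exact: (m4 _ uv2)].
move=> t _; have S2 w : L2T w -> L2T (schrodinger t w) by exact: L2T_schrodinger.
rewrite (@Phi_eq _ _ (fun x => schrodinger t v x + schrodinger t (fun y => u y - v y) x)).
- by apply: PhiD_le => //; apply: L2T_meas; exact: S2.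
- exact: S2.
- by apply: L2TD; exact: S2.
- exact: sqnorm_schrodingerD.
Qed.

Lemma le_limn_einf (f g : (\bar R)^nat) :
  (forall n, (f n <= g n)%E) -> (limn_einf f <= limn_einf g)%E.
Proof.
move=> fg; rewrite !limn_einf_lim; apply: lee_lim; try exact: is_cvg_einfs.
apply: nearW => n; apply: le_ereal_inf_tmp => _ [k nk <-].
by apply: le_trans (fg k); apply: ereal_inf_lbound; exists k.
Qed.

Lemma Phi_le_limn_einf (v_ : nat -> R -> R[i]) v :
  (forall k, L2T (v_ k)) -> L2T v ->
  (forall e, 0 < e -> \forall k \near \oo, sqnorm (fun x => v_ k x - v x) <= e) ->
  (Phi v <= limn_einf (fun k => Phi (v_ k)))%E.
Proof.
move=> v_2 v2 hv; rewrite -(cvg_lim _ (PhiN_cvg_Phi v2))//.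
apply: lime_le; first exact: cvgP (PhiN_cvg_Phi v2).
apply: nearW => n.
have cv : (PhiN n%:R (v_ k))%:E @[k --> \oo] --> (PhiN n%:R v)%:E.
  by apply/fine_cvgP; split; [exact: nearW|exact: PhiN_cvg].
rewrite -(cvg_lim _ cv)// -is_cvg_limn_einfE; last exact: cvgP cv.
by apply: le_limn_einf => k; exact: PhiN_le_Phi.
Qed.

Lemma Phi_schrodinger_tpoly t s c : uniq s ->
  Phi (schrodinger t (tpoly s c)) = Phi (tpoly s (evolve t c)).
Proof.
move=> us; apply: Phi_eq; [exact/L2T_schrodinger/L2T_tpoly|exact: L2T_tpoly|].
exact: sqnorm_schrodinger_tpoly.
Qed.

(** This carries bounds from trigonometric polynomials to all of L2: at each time [Phi] is lower
    semicontinuous along the partial sums, and Fatou integrates this in time. *)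
Lemma W_fatou B u (K : R) : L2T u ->
  (forall k, (W B (tpoly (rng k) (fourier_coef u)) <= K%:E)%E) -> (W B u <= K%:E)%E.
Proof.
move=> u2 hK; set f := fun k t => Phi (schrodinger t (tpoly (rng k) (fourier_coef u))).
have mB : measurable (`[0, B] : set (measurableTypeR R)) by exact: measurable_itv.
have mf k : measurable_fun (`[0, B] : set (measurableTypeR R)) (f k).
  by apply: measurable_funTS; apply: measurable_Phi_schrodinger; exact: L2T_tpoly.
have f0 k t : [set` `[0, B]] t -> (0 <= f k t)%E by move=> _; exact: Phi_ge0.
rewrite WE; apply: (@le_trans _ _ (\int[mu]_(t in `[0%R, B]) limn_einf (f^~ t))%E); last first.
  by apply: le_trans (fatou mu mB mf f0) _; apply: limn_einf_le; exact: nearW.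
apply: ge0_le_integral => //.
- by move=> t _; exact: Phi_ge0.
- by apply: measurable_funTS; exact: measurable_Phi_schrodinger.
- have -> : (fun t => limn_einf (f ^~ t)) = (fun t => - limn_esup (fun n => - f n t))%E.
    by apply/funext => t; rewrite (limn_esupN (f ^~ t)) oppeK.
  apply: measurableT_comp => //; apply: measurable_fun_limn_esup => n.
  exact: measurableT_comp.
- move=> t _; rewrite /f; under eq_fun do rewrite (Phi_schrodinger_tpoly _ _ (rng_uniq _)).
  apply: Phi_le_limn_einf; [by move=> k; exact: L2T_tpoly|exact: L2T_schrodinger|].
  exact: near_sqnorm_schrodinger.
Qed.

End time_integral.

(** * The quartic form on finitely supported sequences *)

Section quadruple_sums.
Implicit Types (s : seq int).

Definition sum4 (V : nmodType) s (A : int -> int -> int -> int -> V) : V :=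
  \sum_(n <- s) \sum_(j <- s) \sum_(m <- s) \sum_(l <- s) A n j m l.

Lemma eq_sum4 (V : nmodType) s (A A' : int -> int -> int -> int -> V) :
  (forall n j m l, n \in s -> j \in s -> m \in s -> l \in s -> A n j m l = A' n j m l) ->
  sum4 s A = sum4 s A'.
Proof.
move=> AA'; rewrite /sum4; apply: eq_big_seq => n ns; apply: eq_big_seq => j js.
by apply: eq_big_seq => m ms; apply: eq_big_seq => l ls; exact: AA'.
Qed.

Lemma sum4D (V : nmodType) s (A A' : int -> int -> int -> int -> V) :
  sum4 s (fun n j m l => A n j m l + A' n j m l) = sum4 s A + sum4 s A'.
Proof.
rewrite /sum4 -big_split; apply: eq_bigr => n _; rewrite -big_split.
by apply: eq_bigr => j _; rewrite -big_split; apply: eq_bigr => m _; rewrite -big_split.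
Qed.

Lemma sum4_morph (V V' : nmodType) (f : V -> V') s (A : int -> int -> int -> int -> V) :
  f 0 = 0 -> {morph f : x y / x + y} ->
  f (sum4 s A) = sum4 s (fun n j m l => f (A n j m l)).
Proof.
move=> f0 fD; rewrite /sum4 (big_morph f fD f0); apply: eq_bigr => n _.
rewrite (big_morph f fD f0); apply: eq_bigr => j _.
rewrite (big_morph f fD f0); apply: eq_bigr => m _.
by rewrite (big_morph f fD f0).
Qed.

Lemma sum4_mul (K : comNzRingType) s (a b c d : int -> K) :
  (\sum_(n <- s) a n) * (\sum_(n <- s) b n) * (\sum_(n <- s) c n) * (\sum_(n <- s) d n) =
  sum4 s (fun n j m l => a n * b j * c m * d l).
Proof.
rewrite /sum4; under [RHS]eq_bigr => n _.
  under eq_bigr => j _.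
    under eq_bigr => m _ do rewrite -mulr_sumr.
    rewrite -mulr_suml -mulr_sumr; over.
  rewrite -!mulr_suml -mulr_sumr; over.
by rewrite -!mulr_suml.
Qed.

Lemma ler_sum4 (K : numDomainType) s (A A' : int -> int -> int -> int -> K) :
  (forall n j m l, n \in s -> j \in s -> m \in s -> l \in s -> A n j m l <= A' n j m l) ->
  sum4 s A <= sum4 s A'.
Proof.
move=> AA'; rewrite /sum4 !big_seq; apply: ler_sum => n ns.
rewrite !big_seq; apply: ler_sum => j js; rewrite !big_seq; apply: ler_sum => m ms.
by rewrite !big_seq; apply: ler_sum => l ls; exact: AA'.
Qed.

End quadruple_sums.

Section finite_formula.
Context {R : realType}.
Implicit Types (s : seq int) (c : int -> R[i]) (B t : R).

Lemma Re_sum4 s (A : int -> int -> int -> int -> R[i]) :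
  Re (sum4 s A) = sum4 s (fun n j m l => Re (A n j m l)).
Proof. by apply: sum4_morph => //; exact: cReD. Qed.

Lemma mulC_sum4 s (z : R[i]) (A : int -> int -> int -> int -> R[i]) :
  z * sum4 s A = sum4 s (fun n j m l => z * A n j m l).
Proof. by apply: (sum4_morph (f := fun x => z * x)); [exact: mulr0|exact: mulrDr]. Qed.

Lemma cmod_sum4 s (A : int -> int -> int -> int -> R[i]) :
  cmod (sum4 s A) <= sum4 s (fun n j m l => cmod (A n j m l)).
Proof.
rewrite /sum4; do 3 (apply: le_trans (ler_cmod_sum _ _ _) _; apply: ler_sum => ? _).
exact: ler_cmod_sum.
Qed.

Lemma cintegral_sum4 (D : set (measurableTypeR R)) s (A : int -> int -> int -> int -> R -> R[i]) :
  measurable D -> (forall n j m l, cintegrable D (A n j m l)) ->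
  cintegral D (fun x => sum4 s (fun n j m l => A n j m l x)) =
  sum4 s (fun n j m l => cintegral D (A n j m l)).
Proof.
move=> mD iA; rewrite /sum4 (cintegral_sum _ mD); last first.
  by move=> n; do 3 (apply: cintegrable_sum => // ?).
apply: eq_bigr => n _; rewrite (cintegral_sum _ mD); last first.
  by move=> j; do 2 (apply: cintegrable_sum => // ?).
apply: eq_bigr => j _; rewrite (cintegral_sum _ mD); last first.
  by move=> m; apply: cintegrable_sum => // ?.
by apply: eq_bigr => m _; rewrite (cintegral_sum _ mD).
Qed.

Lemma cmod_exp4 (z : R[i]) : (cmod z ^+ 4)%:C = z * z * z^* * z^*.
Proof.
rewrite (_ : z * z * z^* * z^* = (z * z^*) * (z * z^*)); last by ring.
by rewrite mulJ -rmorphM /= -exprD.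
Qed.

(** Orthogonality in space: the integral of four modes over a period vanishes unless the frequencies
    balance. Resonance in time is the separate predicate [resonant]. *)
Definition resonant4 (n j m l : int) : R[i] := (n + j == m + l)%:R.

Lemma Phi_tpoly s c : Phi (tpoly s c) =
  (2 * pi * Re (sum4 s (fun n j m l =>
     resonant4 n j m l * (c n * c j * (c m)^* * (c l)^*))))%:E.
Proof.
have mp := @period_measurable R.
pose A n j m l x := c n * c j * (c m)^* * (c l)^* * mode (n + j - (m + l)) x.
have E x : (cmod (tpoly s c x) ^+ 4)%:C = sum4 s (fun n j m l => A n j m l x).
  rewrite cmod_exp4 /tpoly rmorph_sum /= sum4_mul; apply: eq_sum4 => n j m l _ _ _ _.
  rewrite /A opprD !modeD !rmorphM /= !modeJ; ring.
have iA n j m l : cintegrable period (A n j m l).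
  by apply: cintegrableZ => //; apply: L2T_cintegrable; exact: L2T_mode.
have h : cintegral period (fun x => (cmod (tpoly s c x) ^+ 4)%:C) =
   (2 * pi)%:C * sum4 s (fun n j m l => resonant4 n j m l * (c n * c j * (c m)^* * (c l)^*)).
  under eq_cintegral do rewrite E.
  rewrite cintegral_sum4// mulC_sum4; apply: eq_sum4 => n j m l _ _ _ _.
  rewrite (cintegralZ _ mp); last by apply: L2T_cintegrable; exact: L2T_mode.
  rewrite cintegral_mode /resonant4 subr_eq0.
  by case: eqP => _; rewrite ?mulr1n ?mulr0n ?mul1r ?mul0r ?mulr0// mulrC.
have {}h : \int[mu]_(x in period) (cmod (tpoly s c x) ^+ 4) = 2 * pi * Re (sum4 s (fun n j m l =>
     resonant4 n j m l * (c n * c j * (c m)^* * (c l)^*))).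
  by move/(congr1 (@complex.Re R)): h; rewrite cintegral_real cReM /= mul0r subr0.
rewrite -h /Phi /Rintegral fineK//.
have [+ _] : cintegrable period (fun x => (cmod (tpoly s c x) ^+ 4)%:C).
  have -> : (fun x => (cmod (tpoly s c x) ^+ 4)%:C) = (fun x => sum4 s (fun n j m l => A n j m l x)).
    exact/funext.
  by do 4 (apply: cintegrable_sum => // ?).
exact: integrable_fin_num.
Qed.

Definition kappa B (k : int) : R[i] := cintegral `[0, B] (fun t => expi (k%:~R * t)).

Definition frequency (n j m l : int) : int := m ^+ 2 + l ^+ 2 - n ^+ 2 - j ^+ 2.

Definition quartic B s c : R := 2 * pi * Re (sum4 s (fun n j m l =>
  resonant4 n j m l * (c n * c j * (c m)^* * (c l)^*) * kappa B (frequency n j m l))).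

Lemma evolve4 t c n j m l :
  evolve t c n * evolve t c j * (evolve t c m)^* * (evolve t c l)^* =
  c n * c j * (c m)^* * (c l)^* * expi ((frequency n j m l)%:~R * t).
Proof.
rewrite /evolve !rmorphM /= !expiJ !opprK.
have -> : (frequency n j m l)%:~R * t = - (n%:~R ^+ 2 * t) + - (j%:~R ^+ 2 * t) + m%:~R ^+ 2 * t + l%:~R ^+ 2 * t.
  by rewrite /frequency !rmorphB !rmorphD /= !rmorphXn /=; ring.
rewrite !expiD; ring.
Qed.

Lemma cintegrable_expi B (w : R) : cintegrable `[0, B] (fun t => expi (w * t)).
Proof.
apply: (@cintegrable_le _ _ _ (cst 1)).
- exact: measurable_itv.
- by apply: cmeas_expi; exact: mulrl_measurable.
- apply: continuous_compact_integrable; first exact: segment_compact.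
  by apply: continuous_subspaceT => x; exact: cst_continuous.
- by move=> t _; rewrite cmod_expi.
Qed.

Lemma W_tpoly B s c : uniq s -> W B (tpoly s c) = (quartic B s c)%:E.
Proof.
move=> us; have mB : measurable (`[0, B] : set (measurableTypeR R)) by exact: measurable_itv.
pose A n j m l t := resonant4 n j m l * (c n * c j * (c m)^* * (c l)^*) *
  expi ((frequency n j m l)%:~R * t).
have iA n j m l : cintegrable `[0, B] (A n j m l).
  by apply: cintegrableZ => //; exact: cintegrable_expi.
have [iS _] : cintegrable `[0, B] (fun t => sum4 s (fun n j m l => A n j m l t)).
  by do 4 (apply: cintegrable_sum => // ?).
rewrite WE; under eq_integral => t _.
  rewrite (Phi_schrodinger_tpoly _ _ us) Phi_tpoly.
  rewrite (_ : sum4 s _ = sum4 s (fun n j m l => A n j m l t)); last first.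
    by apply: eq_sum4 => n j m l _ _ _ _; rewrite evolve4 /A; ring.
  over.
have -> : quartic B s c = 2 * pi * \int[mu]_(t in `[0, B]) Re (sum4 s (fun n j m l => A n j m l t)).
  rewrite /quartic; congr (_ * _).
  transitivity (Re (cintegral `[0, B] (fun t => sum4 s (fun n j m l => A n j m l t)))) => //.
  rewrite cintegral_sum4//; congr (Re _); apply: eq_sum4 => n j m l _ _ _ _.
  by rewrite (cintegralZ _ mB)//; exact: cintegrable_expi.
rewrite -RintegralZl// /Rintegral fineK//.
exact: (integrable_fin_num mB (integrableZl_EFin (2 * pi) mB iS)).
Qed.

Lemma kappa0 B : 0 < B -> kappa B 0 = B%:C.
Proof. exact: cintegral_expi0. Qed.

Lemma cmod_kappa B (k : int) : 0 < B -> k != 0 -> cmod (kappa B k) <= 2 / `|k%:~R|.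
Proof. by move=> B0 k0; apply: cmod_cintegral_expi => //; rewrite intr_eq0. Qed.

(** Eliminating [l] factors the phase. It vanishes exactly when [m] equals [n] or [j], and it
    depends on differences of indices only. *)
Lemma frequencyE n j m l : n + j = m + l ->
  frequency n j m l = 2 * (m - n) * (m - j).
Proof. by move=> e; have -> : l = n + j - m; [by rewrite e addrAC subrr add0r|rewrite /frequency; ring]. Qed.

End finite_formula.

(** * Estimates for the quartic form *)

Section uniform_sums.
Context {R : realType}.
Implicit Types (s : seq int) (g : int -> R) (k n j m l : int).

Lemma ler_sum_subset (T : eqType) (s s' : seq T) (F : T -> R) :
  uniq s -> uniq s' -> {subset s <= s'} -> (forall x, 0 <= F x) ->
  \sum_(x <- s) F x <= \sum_(x <- s') F x.
Proof.
move=> us us' ss' F0; rewrite [leRHS](bigID (fun x => x \in s)) /=.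
have ps : perm_eq [seq x <- s' | x \in s] s.
  apply: uniq_perm; rewrite ?filter_uniq// => x; rewrite mem_filter.
  by case: (boolP (x \in s)) => // /ss' ->.
by rewrite -[X in _ <= X + _]big_filter (perm_big _ ps) /= lerDl sumr_ge0.
Qed.

Definition usum g (G : R) := forall s, uniq s -> \sum_(k <- s) g k <= G.

Lemma usum_subr g G s m : usum g G -> uniq s -> \sum_(n <- s) g (m - n) <= G.
Proof.
move=> gG us; rewrite -(big_map (fun n => m - n) predT g) gG// map_inj_uniq//.
by move=> n n' /addrI /oppr_inj.
Qed.

Lemma usum_addr g G s m : usum g G -> uniq s -> \sum_(n <- s) g (n - m) <= G.
Proof.
move=> gG us; rewrite -(big_map (fun n => n - m) predT g) gG// map_inj_uniq//.
by move=> n n' /addIr.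
Qed.

Lemma sum_pred s (p : pred int) : \sum_(n <- s) (p n)%:R = (count p s)%:R :> R.
Proof.
by rewrite -natr_sum -sum1_count [in RHS]big_mkcond.
Qed.

Lemma usum_eq s k : uniq s -> \sum_(n <- s) (n == k)%:R <= 1 :> R.
Proof.
by move=> us; rewrite (sum_pred s (pred1 k)) count_uniq_mem//; case: (k \in s).
Qed.

Definition inv_sqr (P : nat) k : R := if (P < `|k|)%N then (k%:~R ^+ 2)^-1 else 0.

Lemma inv_sqr_ge0 P k : 0 <= inv_sqr P k.
Proof. by rewrite /inv_sqr; case: ifP => // _; rewrite invr_ge0 sqr_ge0. Qed.

(** Telescoping: 1/x^2 <= 2/x - 2/(x + 1) for x >= 1. *)
Lemma inv_sqr_nat_sum P (r : seq nat) : uniq r ->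
  \sum_(i <- r) inv_sqr P i%:Z <= 2 / P.+1%:R.
Proof.
move=> ur; have [N rN] : exists N, {subset r <= iota 0 N}.
  exists (\sum_(i <- r) i.+1)%N => i ir; rewrite mem_iota /= add0n.
  by rewrite (big_rem i)//= leq_addr.
apply: le_trans (ler_sum_subset ur (iota_uniq 0 N) rN (fun i => inv_sqr_ge0 P i)) _.
(* The subtracted term is what telescoping leaves over; the maximum makes it move only from P + 1
   on, the first index with a nonzero term. *)
suff : \sum_(i <- iota 0 N) inv_sqr P i%:Z <= 2 / P.+1%:R - 2 / (maxn P.+1 N)%:R.
  by move=> h; apply: le_trans h _; rewrite gerBl divr_ge0.
elim: N {rN} => [|N IH]; first by rewrite big_nil maxn0 subrr.
rewrite -[N.+1]addn1 iotaD add0n big_cat /= big_seq1.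
rewrite /inv_sqr absz_nat; case: ltnP => PN; last first.
  by rewrite addr0 addn1; move: IH; rewrite !(maxn_idPl _)// ?ltnS// leqW.
have -> : maxn P.+1 (N + 1) = N.+1 by lia.
move: IH; have -> : maxn P.+1 N = N by lia.
have N0 : (0 : R) < N%:R by rewrite ltr0n; lia.
have -> : N%:~R = N%:R :> R by [].
rewrite -[N.+1%:R]natr1; set x := N%:R in N0 *; set a := \sum_(_ <- _) _ => IH.
suff h : (x ^+ 2)^-1 <= 2 / x - 2 / (x + 1).
  by apply: le_trans (lerD IH h) _; rewrite addrA subrK.
have -> : 2 / x - 2 / (x + 1) = 2 / (x * (x + 1)).
  by field; rewrite !gt_eqF//; lra.
have h2 : x + 1 <= 2 * x by have : (1 : R) <= N%:R; [rewrite ler1n; lia|rewrite -/x; lra].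
rewrite -div1r ler_pdivrMr ?exprn_gt0// mulrAC ler_pdivlMr ?mulr_gt0//; [|lra].
by rewrite mul1r expr2; nra.
Qed.

Lemma usum_inv_sqr P : usum (inv_sqr P) (4 / P.+1%:R).
Proof.
move=> s us; rewrite (bigID (fun k => 0 <= k)) /=.
have h (p : pred int) : {in p &, injective (fun k => `|k|%N)} ->
    \sum_(k <- s | p k) inv_sqr P k <= 2 / P.+1%:R.
  move=> ip; rewrite -big_filter.
  have -> : \sum_(k <- [seq k <- s | p k]) inv_sqr P k =
     \sum_(i <- [seq `|k|%N | k <- [seq k <- s | p k]]) inv_sqr P i%:Z.
    rewrite big_map; apply: eq_bigr => k _.
    by rewrite /inv_sqr absz_id; case: ifP => // _; rewrite -[X in X ^+ 2]/(_) abszE intr_norm real_normK// realz.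
  apply: inv_sqr_nat_sum; rewrite map_inj_in_uniq ?filter_uniq//.
  by move=> x y; rewrite !mem_filter => /andP[px _] /andP[py _]; exact: ip.
have -> : 4 / P.+1%:R = 2 / P.+1%:R + 2 / P.+1%:R :> R by rewrite -mulrDl; congr (_ / _); ring.
by apply: lerD; apply: h => x y; rewrite /in_mem /=; lia.
Qed.

Lemma usum_ball (P : nat) : usum (fun k => (`|k| <= P)%N%:R) (P + P).+1%:R.
Proof.
move=> s us; rewrite (sum_pred s (fun k => (`|k| <= P)%N)) ler_nat -size_filter.
rewrite -[leqRHS](_ : size (rng P) = _); last by rewrite size_map size_iota.
apply: uniq_leq_size; first by rewrite filter_uniq.
by move=> k; rewrite mem_filter mem_rng => /andP[].
Qed.

End uniform_sums.

Section quartic_estimates.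
Context {R : realType}.
Implicit Types (s : seq int) (c : int -> R[i]) (B e : R) (P : nat) (n j m l : int)
  (p q : int -> int -> int -> int -> bool).

Definition mass s c : R := \sum_(n <- s) cmod (c n) ^+ 2.

Lemma mass_ge0 s c : 0 <= mass s c. Proof. exact: sum_sqr_ge0. Qed.

Definition qterm B c n j m l : R[i] :=
  resonant4 n j m l * (c n * c j * (c m)^* * (c l)^*) * kappa B (frequency n j m l).

Definition qpart B s c p : R :=
  Re (sum4 s (fun n j m l => if p n j m l then qterm B c n j m l else 0)).

Lemma quarticE B s c : quartic B s c = 2 * pi * qpart B s c (fun _ _ _ _ => true).
Proof. by []. Qed.

Lemma qpart_split B s c p q : qpart B s c p =
  qpart B s c (fun n j m l => p n j m l && q n j m l) +
  qpart B s c (fun n j m l => p n j m l && ~~ q n j m l).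
Proof.
rewrite /qpart -cReD -sum4D; congr Re; apply: eq_sum4 => n j m l _ _ _ _.
by case: (p _ _ _ _); case: (q _ _ _ _); rewrite /= ?addr0 ?add0r.
Qed.

Lemma eq_qpart B s c p q :
  (forall n j m l, n \in s -> j \in s -> m \in s -> l \in s ->
     n + j = m + l -> p n j m l = q n j m l) -> qpart B s c p = qpart B s c q.
Proof.
move=> pq; congr Re; apply: eq_sum4 => n j m l ns js ms ls.
rewrite /qterm /resonant4; have [e|_] := eqVneq (n + j) (m + l); first by rewrite pq.
by rewrite /= mulr0n !mul0r; do 2 case: ifP => _.
Qed.

Lemma qpart_le B s c p (A : int -> int -> int -> int -> R) :
  (forall n j m l, 0 <= A n j m l) ->
  (forall n j m l, n \in s -> j \in s -> m \in s -> l \in s ->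
    p n j m l -> n + j = m + l ->
    cmod (c n) * cmod (c j) * cmod (c m) * cmod (c l) *
      cmod (kappa B (frequency n j m l)) <= A n j m l) ->
  `|qpart B s c p| <= sum4 s (fun n j m l => (n + j == m + l)%:R * A n j m l).
Proof.
move=> A0 hA; apply: le_trans (ler_Re_cmod _) _; apply: le_trans (cmod_sum4 _ _) _.
apply: ler_sum4 => n j m l ns js ms ls.
rewrite /qterm /resonant4; have [e|_] := eqVneq (n + j) (m + l); last first.
  by rewrite /= mulr0n !mul0r; case: ifP; rewrite cmod0.
rewrite /= mulr1n !mul1r; case: ifPn => pn; last by rewrite cmod0.
by rewrite !cmodM !cmodJ; exact: hA.
Qed.

Lemma sum_res_le1 s n j m : uniq s -> \sum_(l <- s) (n + j == m + l)%:R <= 1 :> R.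
Proof.
move=> us; apply: le_trans (usum_eq (n + j - m) us); apply: ler_sum => l _.
by have -> : (n + j == m + l) = (l == n + j - m) by apply/eqP/eqP => h; lia.
Qed.

Lemma sum4_res_njm s (A : int -> int -> int -> R) : uniq s ->
  (forall n j m, 0 <= A n j m) ->
  sum4 s (fun n j m l => (n + j == m + l)%:R * A n j m) <=
  \sum_(n <- s) \sum_(j <- s) \sum_(m <- s) A n j m.
Proof.
move=> us A0; apply: ler_sum => n _; apply: ler_sum => j _; apply: ler_sum => m _.
by rewrite -mulr_suml ler_piMl// sum_res_le1.
Qed.

Lemma sum4_res_nml s (A : int -> int -> int -> R) : uniq s ->
  (forall n m l, 0 <= A n m l) ->
  sum4 s (fun n j m l => (n + j == m + l)%:R * A n m l) <=
  \sum_(n <- s) \sum_(m <- s) \sum_(l <- s) A n m l.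
Proof.
move=> us A0; apply: ler_sum => n _; rewrite exchange_big /=.
apply: ler_sum => m _; rewrite exchange_big /=; apply: ler_sum => l _.
rewrite -mulr_suml ler_piMl//; apply: le_trans (sum_res_le1 m l n us).
by apply: ler_sum => j _; rewrite eq_sym.
Qed.

Lemma cmod_kappa_le B n j m l : 0 < B -> n + j = m + l -> m != n -> m != j ->
  cmod (kappa B (frequency n j m l)) <= (`|(m - n)%:~R| * `|(m - j)%:~R|)^-1.
Proof.
move=> B0 e mn mj; rewrite (frequencyE e).
have h0 : 2 * (m - n) * (m - j) != 0 :> int by rewrite !mulf_neq0 ?subr_eq0.
apply: le_trans (cmod_kappa B0 h0) _.
rewrite !intrM !normrM -mulrA [`|2%:~R|]ger0_norm// invfM mulrA mulfV ?mul1r//.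
Qed.

(* [l] is determined by [n + j = m + l], and the frequency of the term is
   [2 (m - n) (m - j)], so that smallness of the kernel is measured by
   [m - n] and [m - j]. *)
Definition far P n j m l :=
  [&& m != n, m != j & (P < `|m - n|)%N || (P < `|m - j|)%N].

Definition nearby P n j m l :=
  [&& m != n, m != j, (`|m - n| <= P)%N & (`|m - j| <= P)%N].

Lemma invr_sqrE k : k != 0 -> inv_sqr 0 k = (k%:~R ^+ 2)^-1 :> R.
Proof. by move=> k0; rewrite /inv_sqr absz_gt0 k0. Qed.

(* AM-GM on the product of [f n * f m * f l], which is square-summable over the
   three free indices, and of [f j / (|m - n| |m - j|)], which is too. *)
Lemma far_bound_aux B s c P (h : R) : 0 < B -> uniq s -> 0 < h ->
  `|qpart B s c (far P)| <= h / 2 * mass s c ^+ 3 + 16 / (P.+1%:R * h) * mass s c.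
Proof.
move=> B0 us h0; pose f n := cmod (c n).
have f0 n : 0 <= f n := cmod_ge0 _.
(* x y <= (h/2) x^2 + y^2 / (2 h) with x = f n f m f l and y = f j times the kernel. The [A1] part
   is summed with [j] determined by the other indices, the [A2] part with [l] determined. *)
pose A1 n m l := h / 2 * (f n ^+ 2 * f m ^+ 2 * f l ^+ 2).
pose A2 n j m := (2 * h)^-1 * (f j ^+ 2 * (inv_sqr P (m - n) * inv_sqr 0 (m - j) +
                                         inv_sqr 0 (m - n) * inv_sqr P (m - j))).
have A10 n m l : 0 <= A1 n m l by rewrite /A1 !mulr_ge0 ?sqr_ge0 ?invr_ge0// ltW.
have A20 n j m : 0 <= A2 n j m.
  by rewrite /A2 !(mulr_ge0, addr_ge0) ?invr_ge0 ?mulr_ge0 ?sqr_ge0 ?inv_sqr_ge0// ltW.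
apply: le_trans (@qpart_le B s c (far P) (fun n j m l => A1 n m l + A2 n j m) _ _) _.
- by move=> n j m l; rewrite addr_ge0.
- move=> n j m l _ _ _ _ /and3P[mn mj Pm] e.
  have mn0 : m - n != 0 by rewrite subr_eq0.
  have mj0 : m - j != 0 by rewrite subr_eq0.
  (* One of the two gaps exceeds [P], so [inv_sqr P] agrees with [inv_sqr 0] in that factor; the sum
     of both alternatives covers either case. *)
  set k := cmod (kappa _ _); have hk : k ^+ 2 <=
      inv_sqr P (m - n) * inv_sqr 0 (m - j) + inv_sqr 0 (m - n) * inv_sqr P (m - j).
    apply: (@le_trans _ _ (inv_sqr 0 (m - n) * inv_sqr 0 (m - j))).
      rewrite !invr_sqrE// -invfM -exprMn -[(_ * _) ^+ 2]real_normK ?num_real// normrM -exprVn.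
      rewrite lerXn2r ?nnegrE ?cmod_ge0 ?invr_ge0 ?mulr_ge0//.
      exact: cmod_kappa_le.
    case/orP: Pm => Pm; [rewrite -[leLHS]addr0|rewrite -[leLHS]add0r]; apply: lerD;
      rewrite ?mulr_ge0 ?inv_sqr_ge0//.
      by rewrite [inv_sqr P _]/inv_sqr Pm -invr_sqrE.
    by rewrite [inv_sqr P (m - j)]/inv_sqr Pm -invr_sqrE.
  apply: (@le_trans _ _ (A1 n m l + (2 * h)^-1 * (f j ^+ 2 * k ^+ 2))); last first.
    rewrite lerD2l /A2 ler_wpM2l ?invr_ge0 ?mulr_ge0 ?(ltW h0)//.
    by rewrite ler_wpM2l ?sqr_ge0.
  rewrite /A1 -!exprMn -/(f n) -/(f j) -/(f m) -/(f l).
  rewrite (_ : f n * f j * f m * f l * k = (f n * f m * f l) * (f j * k)); last by ring.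
  set x := f n * f m * f l; set y := f j * k.
  rewrite -subr_ge0 (_ : _ - _ = (h * x - y) ^+ 2 / (2 * h)); last by field; rewrite gt_eqF.
  by rewrite divr_ge0 ?sqr_ge0// mulr_ge0// ltW.
rewrite (_ : sum4 s _ = sum4 s (fun n j m l => (n + j == m + l)%:R * A1 n m l) +
    sum4 s (fun n j m l => (n + j == m + l)%:R * A2 n j m)); last first.
  by rewrite -sum4D; apply: eq_sum4 => *; rewrite mulrDr.
apply: lerD.
  apply: le_trans (sum4_res_nml us A10) _; rewrite /A1.
  rewrite le_eqVlt; apply/orP; left; apply/eqP.
  under eq_bigr do under eq_bigr do (rewrite -mulr_sumr -mulr_sumr).
  under eq_bigr do (rewrite -mulr_sumr -mulr_suml -mulr_sumr).
  by rewrite -mulr_sumr -!mulr_suml /mass !exprS expr0; ring.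
apply: le_trans (sum4_res_njm us A20) _.
have U0 := @usum_inv_sqr R 0; have UP := @usum_inv_sqr R P.
rewrite exchange_big /= /mass mulr_sumr; apply: ler_sum => j _.
rewrite exchange_big /=.
apply: (@le_trans _ _ (\sum_(m <- s) (2 * h)^-1 * (f j ^+ 2 *
    (4 / P.+1%:R * inv_sqr 0 (m - j) + 4 * inv_sqr P (m - j))))).
  apply: ler_sum => m _; rewrite /A2 -!mulr_sumr big_split /= -!mulr_suml.
  rewrite ler_wpM2l ?invr_ge0 ?mulr_ge0 ?(ltW h0)// ler_wpM2l ?sqr_ge0//.
  apply: lerD; rewrite ler_wpM2r ?inv_sqr_ge0//; first exact: usum_subr.
  by have := usum_subr m U0 us; rewrite divr1.
rewrite -!mulr_sumr big_split /= -!mulr_sumr.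
have V0 : \sum_(m <- s) inv_sqr 0 (m - j) <= 4 :> R.
  by have := usum_addr j U0 us; rewrite divr1.
have VP : \sum_(m <- s) inv_sqr P (m - j) <= 4 / P.+1%:R :> R by exact: usum_addr.
rewrite -/(f j) [leRHS]mulrC (_ : 16 / (P.+1%:R * h) = (2 * h)^-1 * (4 / P.+1%:R * 4 + 4 * (4 / P.+1%:R))); last first.
  have : 0 < P.+1%:R :> R by [].
  by set x := P.+1%:R => x0; field; rewrite !gt_eqF.
rewrite mulrCA ler_wpM2l ?sqr_ge0// ler_wpM2l ?invr_ge0 ?mulr_ge0 ?(ltW h0)//.
by apply: lerD; rewrite ler_wpM2l ?divr_ge0.
Qed.

Lemma mass_eq0 s c : mass s c = 0 -> {in s, forall n, c n = 0}.
Proof.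
move=> m0 n ns; have /eqP := m0; rewrite /mass psumr_eq0; last by move=> k _; exact: sqr_ge0.
by move=> /allP /(_ n ns) /=; rewrite sqrf_eq0 => /eqP /ComplexField.Normc.eq0_normc.
Qed.

Lemma far_bound B e : 0 < B -> 0 < e -> exists P, forall s c, uniq s ->
  `|qpart B s c (far P)| <= e * mass s c ^+ 2.
Proof.
(* The previous bound is used with h = e / mass and becomes (e/2 + 16 / ((P + 1) e)) mass^2; the
   second term is at most e/2 once P + 1 >= 32 / e^2. Zero mass is treated apart. *)
move=> B0 e0; have [P hP] : exists P : nat, 32 / e ^+ 2 <= P.+1%:R.
  exists (Num.truncn (32 / e ^+ 2)); apply: ltW.
  by rewrite truncnS_gt.
exists P => s c us; have := mass_ge0 s c; rewrite le_eqVlt => /predU1P[m0|m0].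
  rewrite /qpart (@eq_sum4 _ _ _ (fun _ _ _ _ => 0)); last first.
    move=> n j m l ns _ _ _; case: ifP => // _.
    by rewrite /qterm (mass_eq0 (esym m0) ns) !mul0r mulr0 mul0r.
  by rewrite /sum4 !(big1, normr0)// -?m0 ?expr0n /= ?mulr0.
apply: le_trans (far_bound_aux c P B0 us (divr_gt0 e0 m0)) _.
set S := mass s c in m0 *; set x := P.+1%:R in hP *.
have x0 : 0 < x by rewrite ltr0n.
have -> : e / S / 2 * S ^+ 3 = e / 2 * S ^+ 2 by field; rewrite gt_eqF.
have -> : 16 / (x * (e / S)) * S = 16 / (x * e) * S ^+ 2 by field; rewrite !gt_eqF.
rewrite -mulrDl ler_wpM2r ?sqr_ge0// -lerBrDl.
have -> : e - e / 2 = e / 2 by field.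
rewrite ler_pdivrMr ?mulr_gt0//; move: hP; rewrite ler_pdivrMr ?exprn_gt0//; nra.
Qed.

(** The kernel is at most 1, both gaps being nonzero integers. The pair [j], [l] is estimated by
    [D], the pair [n], [m] keeps the mass on [A], and each remaining index has at most 2 P + 1
    values. [D] is small when the sequence vanishes, the mass on [A] when it splits. *)
Lemma near_bound B s c P q (A : pred int) (D : R) : 0 < B -> uniq s -> 0 <= D ->
  {in s, forall n, cmod (c n) ^+ 2 <= D} ->
  (forall n j m l, n + j = m + l -> nearby P n j m l -> q n j m l -> A n && A m) ->
  `|qpart B s c (fun n j m l => nearby P n j m l && q n j m l)| <=
  D * (P + P).+1%:R ^+ 2 * \sum_(n <- s | A n) cmod (c n) ^+ 2.
Proof.
move=> B0 us D0 cD qA; pose f n := cmod (c n).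
have f0 n : 0 <= f n := cmod_ge0 _.
pose b k : R := (`|k| <= P)%N%:R.
pose F n := f n ^+ 2 * (A n)%:R.
have F0 n : 0 <= F n by rewrite mulr_ge0 ?sqr_ge0.
pose A2 n j m := D * ((F n + F m) / 2 * (b (m - n) * b (m - j))).
have A20 n j m : 0 <= A2 n j m by rewrite /A2 !(mulr_ge0, addr_ge0) ?invr_ge0.
apply: le_trans (@qpart_le B s c _ (fun n j m l => A2 n j m) _ _) _.
- by move=> n j m l; exact: A20.
- move=> n j m l ns js ms ls /andP[hn hq] e.
  have /andP[An Am] := qA _ _ _ _ e hn hq; have /and4P[mn mj Pn Pj] := hn.
  rewrite /A2 /F /b An Am Pn Pj !mulr1 -/(f n) -/(f j) -/(f m) -/(f l).
  have k1 : cmod (kappa B (frequency n j m l)) <= 1.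
    apply: le_trans (cmod_kappa_le B0 e mn mj) _.
    have h1 (k : int) : k != 0 -> 1 <= `|k%:~R| :> R.
      by move=> k0; rewrite -intr_norm ler1z; lia.
    have := h1 (m - n); have := h1 (m - j); rewrite !subr_eq0 => /(_ mj) hj /(_ mn) hn1.
    by rewrite invf_le1 ?mulr_ege1// (lt_le_trans ltr01)// mulr_ege1.
  have hjl : f j * f l <= D.
    have := cD j js; have := cD l ls; rewrite -/(f j) -/(f l).
    by have := sqr_ge0 (f j - f l); nra.
  have hnm : f n * f m <= (f n ^+ 2 + f m ^+ 2) / 2.
    by have := sqr_ge0 (f n - f m); nra.
  rewrite (_ : f n * f j * f m * f l = f j * f l * (f n * f m)); last by ring.
  apply: le_trans (_ : f j * f l * (f n * f m) * 1 <= _).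
    by rewrite ler_wpM2l// !mulr_ge0.
  by rewrite mulr1 ler_pM// mulr_ge0.
apply: le_trans (sum4_res_njm us A20) _.
set N := (P + P).+1%:R; have UB := @usum_ball R P.
have b0 k : 0 <= b k by rewrite /b.
have N0 : 0 <= N by [].
have -> : \sum_(n <- s | A n) cmod (c n) ^+ 2 = \sum_(n <- s) F n.
  by rewrite big_mkcond /=; apply: eq_bigr => n _; rewrite /F; case: (A n); rewrite ?mulr1 ?mulr0.
have -> : \sum_(n <- s) \sum_(j <- s) \sum_(m <- s) A2 n j m =
   D * (2^-1 * (\sum_(n <- s) F n * \sum_(m <- s) b (m - n) * \sum_(j <- s) b (m - j)) +
        2^-1 * (\sum_(m <- s) F m * ((\sum_(n <- s) b (m - n)) * \sum_(j <- s) b (m - j)))).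
  pose S m := \sum_(j <- s) b (m - j).
  transitivity (\sum_(n <- s) \sum_(m <- s)
      D * (2^-1 * (F n * (b (m - n) * S m)) + 2^-1 * (F m * (b (m - n) * S m)))).
    apply: eq_bigr => n _; rewrite exchange_big /=; apply: eq_bigr => m _.
    by rewrite /A2 -!mulr_sumr -/(S m); field.
  under eq_bigr do rewrite -mulr_sumr big_split /= -!mulr_sumr.
  rewrite -mulr_sumr big_split /= -!mulr_sumr; congr (_ * (_ * _ + _ * _)).
  rewrite exchange_big /=; apply: eq_bigr => m _.
  by rewrite -mulr_sumr -mulr_suml.
rewrite -mulrA ler_wpM2l//.
have H1 : \sum_(n <- s) F n * \sum_(m <- s) b (m - n) * \sum_(j <- s) b (m - j) <= \sum_(n <- s) F n * N ^+ 2.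
  apply: ler_sum => n _; rewrite ler_wpM2l// expr2.
  apply: (@le_trans _ _ (\sum_(m <- s) b (m - n) * N)).
    by apply: ler_sum => m _; rewrite ler_wpM2l//; exact: usum_subr.
  by rewrite -mulr_suml ler_wpM2r//; exact: usum_addr.
have H2 : \sum_(m <- s) F m * ((\sum_(n <- s) b (m - n)) * \sum_(j <- s) b (m - j)) <= \sum_(m <- s) F m * N ^+ 2.
  apply: ler_sum => m _; rewrite ler_wpM2l// expr2 ler_pM// ?sumr_ge0//; exact: usum_subr.
by move: H1 H2; rewrite -!mulr_suml; set x := \sum_(_ <- s) F _; set y := \sum_(_ <- s) _; set z := \sum_(_ <- s) _; lra.
Qed.

Lemma sum_delta (V : nmodType) s (a : int) (X : int -> V) : uniq s -> a \in s ->
  \sum_(m <- s) (if m == a then X m else 0) = X a.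
Proof.
move=> us sa; rewrite (bigD1_seq a)//= eqxx big1 ?addr0// => m /negbTE ->.
by [].
Qed.

Definition resonant n j m l := (m == n) || (m == j).

Lemma res_part B s c : 0 < B -> uniq s ->
  qpart B s c (fun n j m l => resonant n j m l) =
  B * (2 * mass s c ^+ 2 - \sum_(n <- s) cmod (c n) ^+ 4).
Proof.
move=> B0 us; rewrite /qpart Re_sum4.
pose f n := cmod (c n); pose G n j := f n ^+ 2 * f j ^+ 2 * B.
have inner n j : n \in s -> j \in s -> \sum_(m <- s) \sum_(l <- s)
    Re (if resonant n j m l then qterm B c n j m l else 0) =
    2 * G n j - (if n == j then G n j else 0).
  move=> ns js.
  have t1 m l : m = n -> Re (qterm B c n j m l) = if l == j then G n j else 0.
    move=> ->; rewrite /qterm /resonant4 (inj_eq (addrI n)) [j == l]eq_sym.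
    case: eqP => [->|_]; last by rewrite /= mulr0n !mul0r.
    have -> : frequency n j n j = 0 by rewrite /frequency; ring.
    rewrite kappa0// mulr1n mul1r (_ : c n * c j * (c n)^* * (c j)^* = (c n * (c n)^*) * (c j * (c j)^*)); last by ring.
    by rewrite !mulJ -!rmorphM.
  have t2 m l : m = j -> Re (qterm B c n j m l) = if l == n then G n j else 0.
    move=> ->; rewrite /qterm /resonant4 addrC (inj_eq (addrI j)) [n == l]eq_sym.
    case: eqP => [->|_]; last by rewrite /= mulr0n !mul0r.
    have -> : frequency n j j n = 0 by rewrite /frequency; ring.
    rewrite kappa0// mulr1n mul1r (_ : c n * c j * (c j)^* * (c n)^* = (c n * (c n)^*) * (c j * (c j)^*)); last by ring.
    by rewrite !mulJ -!rmorphM.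
  (* For n = j the two resonant cases coincide and count once; this is the source of the negative
     sum of fourth powers. *)
  rewrite (eq_bigr (fun m => (if m == n then G n j else 0) +
      (if m == j then (if n == j then 0 else G n j) else 0))); last first.
    move=> m _; rewrite /resonant; have [mn|mn] := eqVneq m n.
      rewrite /= (eq_bigr (fun l => if l == j then G n j else 0)); last by move=> l _; exact: t1.
      rewrite sum_delta// mn; case: eqP => _; rewrite addr0//.
    have [mj|mj] := eqVneq m j => /=; last by rewrite big1 ?addr0.
    rewrite (eq_bigr (fun l => if l == n then G n j else 0)); last by move=> l _; exact: t2.
    by rewrite sum_delta// add0r -mj eq_sym (negbTE mn).
  rewrite big_split /= (sum_delta (fun=> G n j) us ns) (sum_delta (fun=> _) us js).
  by case: eqP => _; rewrite ?subr0; ring.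
rewrite /sum4 (eq_big_seq (fun n => \sum_(j <- s) (2 * G n j - (if j == n then G n j else 0)))); last first.
  by move=> n ns; apply: eq_big_seq => j js; rewrite inner// eq_sym.
under eq_bigr do rewrite big_split /= sumrN.
rewrite big_split /= sumrN.
rewrite [X in _ - X](eq_big_seq (fun n => cmod (c n) ^+ 4 * B)); last first.
  by move=> n ns; rewrite (sum_delta (fun j => G n j) us ns) /G /f -exprD.
rewrite -mulr_suml mulrBr [X in _ - X]mulrC; congr (_ - _).
rewrite /G; under eq_bigr do (rewrite -mulr_sumr -mulr_suml -mulr_sumr).
by rewrite -mulr_sumr -!mulr_suml /mass; ring.
Qed.

End quartic_estimates.

Section quartic_consequences.
Context {R : realType}.
Implicit Types (s : seq int) (c : int -> R[i]) (B e d : R) (P L : nat) (n j m l : int).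

Lemma quartic_decomp B s c P : 0 < B -> uniq s ->
  quartic B s c = 2 * pi * (B * (2 * mass s c ^+ 2 - \sum_(n <- s) cmod (c n) ^+ 4) +
    (qpart B s c (nearby P) + qpart B s c (far P))).
Proof.
move=> B0 us; rewrite quarticE (qpart_split _ _ _ _ resonant).
congr (_ * (_ + _)); first exact: res_part.
rewrite (qpart_split _ _ _ _ (nearby P)); congr (_ + _); apply: eq_qpart => n j m l _ _ _ _ _.
- by rewrite /resonant /nearby negb_or; case: (m == n); case: (m == j).
- rewrite /resonant /nearby /far negb_or; case: (m == n); case: (m == j) => //=.
  by rewrite negb_and -!ltnNge.
Qed.

Lemma sum4th_le s c d : {in s, forall n, cmod (c n) ^+ 2 <= d} ->
  \sum_(n <- s) cmod (c n) ^+ 4 <= d * mass s c.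
Proof.
move=> cd; rewrite /mass mulr_sumr big_seq [leRHS]big_seq; apply: ler_sum => n ns.
by rewrite (_ : 4 = 2 + 2)%N// exprD ler_wpM2r ?sqr_ge0// cd.
Qed.

(** The fourth powers and the nearby part are each at most a constant times [d] times the mass. With
    [d] tending to 0 this gives the limit of the form; with [d] equal to the mass it gives the crude
    bound [quartic_bounded]. *)
Lemma quartic_vanishing B e : 0 < B -> 0 < e -> exists2 K : R, 0 <= K &
  forall s c d, uniq s -> 0 <= d -> {in s, forall n, cmod (c n) ^+ 2 <= d} ->
  `|quartic B s c - 4 * pi * B * mass s c ^+ 2| <= e * mass s c ^+ 2 + K * d * mass s c.
Proof.
move=> B0 e0; have p0 := @pi_gt0 R.
have [P hP] := far_bound B0 (divr_gt0 e0 (@pi2_gt0 R)).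
set N := (P + P).+1%:R ^+ 2 : R; have N0 : 0 <= N by rewrite sqr_ge0.
exists (2 * pi * (B + N)).
  by rewrite mulr_ge0 ?addr_ge0// ?ltW ?pi2_gt0.
move=> s c d us d0 cd; rewrite (quartic_decomp c P B0 us).
have h1 := hP s c us; have m0 := mass_ge0 s c.
have h2 : `|qpart B s c (nearby P)| <= d * N * mass s c.
  have := @near_bound _ B s c P (fun _ _ _ _ => true) predT d B0 us d0 cd.
  move=> /(_ (fun _ _ _ _ _ _ _ => isT)); rewrite -/N; congr (`|_| <= _).
  by apply: eq_qpart => *; rewrite andbT.
have h3 := sum4th_le cd.
have h4 : 0 <= \sum_(n <- s) cmod (c n) ^+ 4.
  by apply: sumr_ge0 => n _; rewrite exprn_ge0// cmod_ge0.
move: h1 h2 h3 h4; set S := mass s c in m0 *; set T := \sum_(_ <- _) _.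
set a := qpart _ _ _ (nearby P); set b := qpart _ _ _ (far P) => h1 h2 h3 h4.
have -> : 2 * pi * (B * (2 * S ^+ 2 - T) + (a + b)) - 4 * pi * B * S ^+ 2 =
   2 * pi * (a + b - B * T) by ring.
have -> : e * S ^+ 2 + 2 * pi * (B + N) * d * S =
   2 * pi * (e / (2 * pi) * S ^+ 2 + d * N * S + B * (d * S)).
  have eE : e = 2 * pi * (e / (2 * pi)) by rewrite mulrC divfK// gt_eqF// pi2_gt0.
  by rewrite {1}eE; ring.
rewrite normrM gtr0_norm ?pi2_gt0// ler_pM2l ?pi2_gt0//.
have h5 : `|B * T| <= B * (d * S) by rewrite normrM gtr0_norm// ger0_norm// ler_wpM2l// ltW.
apply: le_trans (ler_normB _ _) _; apply: lerD => //.
by apply: le_trans (ler_normD _ _) _; rewrite addrC lerD.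
Qed.

Lemma cmod_sqr_le_mass s c : uniq s -> {in s, forall n, cmod (c n) ^+ 2 <= mass s c}.
Proof.
move=> us n ns; rewrite /mass (bigD1_seq n)//= lerDl.
by apply: sumr_ge0 => k _; exact: sqr_ge0.
Qed.

Lemma quartic_bounded B : 0 < B -> exists2 C : R, 0 <= C &
  forall s c, uniq s -> quartic B s c <= C * mass s c ^+ 2.
Proof.
move=> B0; have [K K0 hK] := quartic_vanishing B0 ltr01.
exists (4 * pi * B + 1 + K).
  by rewrite !addr_ge0// !mulr_ge0 ?pi_ge0// ltW.
move=> s c us; have := hK s c (mass s c) us (mass_ge0 _ _) (cmod_sqr_le_mass c us).
by rewrite ler_norml => /andP[_]; set S := mass s c; lra.
Qed.

Definition in_ball L : pred int := fun n => (`|n| <= L)%N.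

(** The shell of half-width [w] about radius [L], written additively to avoid truncated
    subtraction. *)
Definition annulus (w L : nat) : pred int := fun n => (L < `|n| + w)%N && (`|n| <= L + w)%N.

Lemma sum4_filter (V : nmodType) s (p : pred int) (A : int -> int -> int -> int -> V) :
  sum4 [seq n <- s | p n] A =
  sum4 s (fun n j m l => if [&& p n, p j, p m & p l] then A n j m l else 0).
Proof.
rewrite /sum4 big_filter big_mkcond; apply: eq_bigr => n _; case: (p n) => /=; last first.
  by do 3 (rewrite big1// => ? _).
rewrite big_filter big_mkcond; apply: eq_bigr => j _; case: (p j) => /=; last first.
  by do 2 (rewrite big1// => ? _).
rewrite big_filter big_mkcond; apply: eq_bigr => m _; case: (p m) => /=; last first.
  by rewrite big1.
by rewrite big_filter big_mkcond; apply: eq_bigr => l _; case: (p l).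
Qed.

Lemma qpart_filter B s c (p : pred int) q :
  qpart B [seq n <- s | p n] c q =
  qpart B s c (fun n j m l => q n j m l && [&& p n, p j, p m & p l]).
Proof.
rewrite /qpart sum4_filter; congr Re; apply: eq_sum4 => n j m l _ _ _ _.
by case: (q _ _ _ _); case: (p n && _).
Qed.

Lemma big_filterC (V : nmodType) s (p : pred int) (F : int -> V) :
  \sum_(n <- s) F n = \sum_(n <- [seq n <- s | p n]) F n +
                      \sum_(n <- [seq n <- s | ~~ p n]) F n.
Proof. by rewrite !big_filter; exact: bigID. Qed.

(* Up to small errors, the two pieces interact only through the resonant set. *)
Lemma quartic_split B e : 0 < B -> 0 < e -> exists w, exists2 K : R, 0 <= K &
  forall L s c, uniq s ->
  quartic B s c <= quartic B [seq n <- s | in_ball L n] c +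
    quartic B [seq n <- s | ~~ in_ball L n] c +
    8 * pi * B * mass [seq n <- s | in_ball L n] c * mass [seq n <- s | ~~ in_ball L n] c + e * mass s c ^+ 2 +
    K * mass s c * \sum_(n <- s | annulus w L n) cmod (c n) ^+ 2.
Proof.
move=> B0 e0; have p0 := @pi_gt0 R.
(* Three far parts are discarded, those of the whole and of the two pieces, each with the prefactor
   2 pi; hence e / (3 (2 pi)). *)
have [P hP] := far_bound B0 (divr_gt0 e0 (mulr_gt0 (ltr0Sn R 2) (@pi2_gt0 R))).
set N := (P + P).+1%:R ^+ 2 : R; have N0 : 0 <= N by rewrite sqr_ge0.
(* In a nearby quadruple any two indices differ by at most 2 P, so a quadruple meeting both the ball
   and its complement lies in the shell of half-width 2 P. *)
exists (P + P)%N; exists (2 * pi * N).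
  by rewrite mulr_ge0// ltW// pi2_gt0.
move=> L s c us; set s1 := [seq n <- s | _]; set s2 := [seq n <- s | ~~ _].
have us1 : uniq s1 by rewrite filter_uniq.
have us2 : uniq s2 by rewrite filter_uniq.
rewrite (quartic_decomp c P B0 us) (quartic_decomp c P B0 us1) (quartic_decomp c P B0 us2).
have hm : mass s c = mass s1 c + mass s2 c by exact: big_filterC.
have h4 : \sum_(n <- s) cmod (c n) ^+ 4 =
  \sum_(n <- s1) cmod (c n) ^+ 4 + \sum_(n <- s2) cmod (c n) ^+ 4 by exact: big_filterC.
pose q1 n j m l := [&& in_ball L n, in_ball L j, in_ball L m & in_ball L l].
pose q2 n j m l := [&& ~~ in_ball L n, ~~ in_ball L j, ~~ in_ball L m & ~~ in_ball L l].
have hn : qpart B s c (nearby P) = qpart B s1 c (nearby P) + (qpart B s2 c (nearby P) +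
   qpart B s c (fun n j m l => nearby P n j m l && (~~ q1 n j m l && ~~ q2 n j m l))).
  rewrite (qpart_split _ _ _ _ q1) /s1 qpart_filter; congr (_ + _).
  rewrite (qpart_split _ _ _ _ q2) /s2 qpart_filter; congr (_ + _).
    apply: eq_qpart => n j m l _ _ _ _ _; rewrite /q1 /q2.
    by case: (nearby _ _ _ _ _); case: (in_ball L n); case: (in_ball L j);
      case: (in_ball L m); case: (in_ball L l).
  by apply: eq_qpart => n j m l _ _ _ _ _; rewrite -andbA.
have hmix := @near_bound _ B s c P (fun n j m l => ~~ q1 n j m l && ~~ q2 n j m l)
   (annulus (P + P) L) (mass s c) B0 us (mass_ge0 _ _) (cmod_sqr_le_mass c us).
have {}hmix := hmix _.
have hA : forall n j m l, n + j = m + l -> nearby P n j m l -> ~~ q1 n j m l && ~~ q2 n j m l ->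
    annulus (P + P) L n && annulus (P + P) L m.
  move=> n j m l e1 /and4P[_ _ h1 h2]; rewrite /q1 /q2 /in_ball /annulus; lia.
have {hA}hmix := hmix hA.
have h0 := hP s c us; have h1 := hP s1 c us1; have h2 := hP s2 c us2.
have m1 := mass_ge0 s1 c; have m2 := mass_ge0 s2 c.
rewrite h4 hn hm in h0 hmix *; rewrite -/N in hmix.
move: h0 h1 h2 hmix m1 m2; set S1 := mass s1 c; set S2 := mass s2 c.
set n1 := qpart B s1 c (nearby P); set n2 := qpart B s2 c (nearby P).
set f0 := qpart B s c (far P); set f1 := qpart B s1 c (far P); set f2 := qpart B s2 c (far P).
set mx := qpart B s c _; set Am := \sum_(_ <- _ | _) _.
set T1 := \sum_(_ <- s1) _; set T2 := \sum_(_ <- s2) _.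
rewrite !ler_norml => /andP[_ h0] /andP[h1 _] /andP[h2 _] /andP[_ hx] m1 m2.
set S := S1 + S2 in h0 hx *.
have hS1 : S1 ^+ 2 <= S ^+ 2 by rewrite lerXn2r ?nnegrE ?addr_ge0// lerDl.
have hS2 : S2 ^+ 2 <= S ^+ 2 by rewrite lerXn2r ?nnegrE ?addr_ge0// lerDr.
set ee := e / (3 * (2 * pi)) in h0 h1 h2.
have ee0 : 0 < ee by rewrite divr_gt0// mulr_gt0// pi2_gt0.
have eE : e = 2 * pi * (3 * ee).
  have h3 : ee * (3 * (2 * pi)) = e by rewrite divfK// gt_eqF// mulr_gt0// pi2_gt0.
  by rewrite -{1}h3; ring.
have hf : f0 - f1 - f2 <= 3 * ee * S ^+ 2.
  have k1 : ee * S1 ^+ 2 <= ee * S ^+ 2 by rewrite ler_pM2l.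
  have k2 : ee * S2 ^+ 2 <= ee * S ^+ 2 by rewrite ler_pM2l.
  by lra.
rewrite -subr_ge0.
(* The interaction is purely resonant: 2 (S1 + S2)^2 exceeds 2 S1^2 + 2 S2^2 by 4 S1 S2, which times
   2 pi B gives the 8 pi B term. The fourth powers add up exactly. *)
have -> : 2 * pi * (B * (2 * S1 ^+ 2 - T1) + (n1 + f1)) +
  2 * pi * (B * (2 * S2 ^+ 2 - T2) + (n2 + f2)) + 8 * pi * B * S1 * S2 + e * S ^+ 2 +
  2 * pi * N * S * Am -
  2 * pi * (B * (2 * S ^+ 2 - (T1 + T2)) + (n1 + (n2 + mx) + f0)) =
  2 * pi * ((3 * ee * S ^+ 2 - (f0 - f1 - f2)) + (S * N * Am - mx)).
  by rewrite {1}eE /S; ring.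
by rewrite mulr_ge0 ?(ltW (@pi2_gt0 R))// addr_ge0// subr_ge0.
Qed.

Lemma quarticZ B s c (z : R) : quartic B s (fun n => z%:C * c n) = z ^+ 4 * quartic B s c.
Proof.
rewrite /quartic mulrCA; congr (_ * _).
transitivity (Re ((z ^+ 4)%:C * sum4 s (fun n j m l =>
  resonant4 n j m l * (c n * c j * (c m)^* * (c l)^*) * kappa B (frequency n j m l)))).
  rewrite mulC_sum4; congr Re; apply: eq_sum4 => n j m l _ _ _ _.
  have zJ : (z%:C)^* = z%:C :> R[i] by apply: complex_eqP; rewrite !ReImE /= ?oppr0.
  have -> : (z ^+ 4)%:C = z%:C ^+ 4 :> R[i] by rewrite rmorphXn.
  by move: zJ; set y := z%:C => zJ; rewrite !rmorphM /= zJ; ring.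
by rewrite cReM /= mul0r subr0.
Qed.

Lemma massZ s c (z : R) : mass s (fun n => z%:C * c n) = z ^+ 2 * mass s c.
Proof.
rewrite /mass mulr_sumr; apply: eq_bigr => n _.
by rewrite cmodM cmodC exprMn real_normK ?num_real.
Qed.

(** Galilean invariance of the flow, read off from the factored phase. *)
Lemma quartic_translate B s c (k : int) :
  quartic B [seq n + k | n <- s] (fun n => c (n - k)) = quartic B s c.
Proof.
rewrite /quartic /sum4; congr (_ * Re _).
rewrite big_map; apply: eq_bigr => n _; rewrite big_map; apply: eq_bigr => j _.
rewrite big_map; apply: eq_bigr => m _; rewrite big_map; apply: eq_bigr => l _.
rewrite !addrK /resonant4 addrACA [m + k + (l + k)]addrACA (inj_eq (addIr _)).
have [e|_] := eqVneq (n + j) (m + l); last by rewrite mulr0n !mul0r.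
have e' : (n + k) + (j + k) = (m + k) + (l + k) by rewrite addrACA e addrACA.
have d a b : a + k - (b + k) = a - b :> int by ring.
by rewrite (frequencyE e) (frequencyE e') !d.
Qed.

End quartic_consequences.

(** * Strichartz inequality, continuity and the supremum *)

Section maximization.
Context {R : realType}.
Implicit Types (u v : R -> R[i]) (s : seq int) (c : int -> R[i]) (B e : R) (n : int).

Lemma W_strichartz B : 0 < B -> exists2 C : R, 0 <= C &
  forall u, L2T u -> (W B u <= (C * sqnorm u ^+ 2)%:E)%E.
Proof.
move=> B0; have [C C0 hC] := @quartic_bounded R B B0; have p2 := @pi2_gt0 R.
exists (C / (2 * pi) ^+ 2); first by rewrite divr_ge0// sqr_ge0.
move=> u u2; apply: W_fatou => // k; rewrite W_tpoly ?rng_uniq// lee_fin.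
apply: le_trans (hC _ _ (rng_uniq k)) _; rewrite -mulrA ler_wpM2l// -exprVn -exprMn.
rewrite lerXn2r ?nnegrE ?mass_ge0 ?mulr_ge0 ?invr_ge0 ?sqnorm_ge0 ?(ltW p2)//.
by rewrite ler_pdivlMl//; exact: bessel (rng_uniq k) u2.
Qed.

Definition Wr B u : R := fine (W B u).

Lemma WrE B u : 0 < B -> L2T u -> W B u = (Wr B u)%:E.
Proof.
move=> B0 u2; have [C C0 hC] := W_strichartz B0; rewrite /Wr fineK//.
by rewrite ge0_fin_numE ?W_ge0//; apply: le_lt_trans (hC u u2) (ltry _).
Qed.

Lemma Wr_ge0 B u : 0 <= Wr B u.
Proof. by rewrite fine_ge0// W_ge0. Qed.

Lemma Wr_tpoly B s c : uniq s -> Wr B (tpoly s c) = quartic B s c.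
Proof. by move=> us; rewrite /Wr W_tpoly. Qed.

(** For r <= 1/2, 1/(1 - r) <= 1 + 2 r, and the cube 1 + 6 r + 12 r^2 + 8 r^3 is at most 1 + (6 + 6
    + 2) r. *)
Lemma inv_cube_le (r : R) : 0 < r -> r <= 2^-1 -> (1 - r) ^- 3 <= 1 + 14 * r.
Proof.
move=> r0 r1; have rr : 0 < 1 - r by lra.
have h2 : (1 - r)^-1 <= 1 + 2 * r.
  by rewrite -[_^-1]mul1r ler_pdivrMr//; nra.
rewrite -exprVn; apply: (@le_trans _ _ ((1 + 2 * r) ^+ 3)).
  by rewrite lerXn2r ?nnegrE// ?invr_ge0; lra.
have r3 : r ^+ 2 <= r / 2 by rewrite expr2; nra.
have r4 : r ^+ 3 <= r / 4.
  by rewrite exprS; have := sqr_ge0 r; nra.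
have -> : (1 + 2 * r) ^+ 3 = 1 + 6 * r + 12 * r ^+ 2 + 8 * r ^+ 3 by ring.
lra.
Qed.

Lemma Wr_uniformly_continuous B e : 0 < B -> 0 < e -> exists2 d : R, 0 < d &
  forall u v, L2T u -> L2T v -> sqnorm v <= 1 ->
    sqnorm (fun x => u x - v x) <= d -> Wr B u <= Wr B v + e.
Proof.
move=> B0 e0; have [C C0 hC] := W_strichartz B0.
(* The factor 28 (C + 1) makes the loss 14 r W(v) at most e/2, since W(v) <= C. *)
pose r := Num.min 2^-1 (e / (28 * (C + 1))).
have C1 : 0 < C + 1 by rewrite ltr_wpDl.
have r0 : 0 < r.
  by rewrite /r lt_min invr_gt0 ltr0n /= divr_gt0 ?mulr_gt0.
have r1 : r <= 2^-1 by rewrite ge_min lexx.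
have r2 : r * (28 * (C + 1)) <= e.
  by rewrite -ler_pdivlMr ?mulr_gt0// ge_min lexx orbT.
have r01 : 0 < r < 1 by rewrite r0/=; lra.
(* The entry 1 gives d^2 <= d in the Strichartz bound for the increment; the other makes r^-3 (C +
   1) d at most e/2. *)
exists (Num.min 1 (r ^+ 3 * e / (2 * (C + 1)))).
  by rewrite lt_min ltr01 divr_gt0// ?mulr_gt0// exprn_gt0.
move=> u v u2 v2 v1; rewrite le_min => /andP[]; set d := sqnorm _ => d1 d2.
have d0 : 0 <= d := sqnorm_ge0 _.
have uv2 := L2TB u2 v2.
have := WD_le B r01 u2 v2; rewrite !WrE// -!EFinM -EFinD lee_fin => h.
have hv : Wr B v <= C.
  have := hC v v2; rewrite WrE// lee_fin => /le_trans; apply.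
  by rewrite ler_piMr// exprn_ile1// sqnorm_ge0.
have hd : Wr B (fun x => u x - v x) <= (C + 1) * d.
  have := hC _ uv2; rewrite WrE// lee_fin -/d => /le_trans; apply.
  have dd : d ^+ 2 <= d by rewrite expr2 ler_piMl.
  by apply: (@le_trans _ _ (C * d)); [rewrite ler_wpM2l|rewrite ler_wpM2r// lerDl].
have h1 := inv_cube_le r0 r1.
have h3 : r ^- 3 * Wr B (fun x => u x - v x) <= e / 2.
  have r30 : 0 < r ^+ 3 by rewrite exprn_gt0.
  rewrite ler_pdivrMl//; apply: le_trans hd _.
  move: d2; rewrite ler_pdivlMr ?mulr_gt0// => d2.
  have half (a x q y : R) : x * (2 * a) <= q * y -> a * x <= q * (y / 2) by clear; lra.
  exact: half.
have h4 : (1 - r) ^- 3 * Wr B v <= Wr B v + e / 2.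
  have w0 := Wr_ge0 B v.
  apply: (@le_trans _ _ ((1 + 14 * r) * Wr B v)); first by rewrite ler_wpM2r.
  have h5 : r * Wr B v <= r * (C + 1).
    by rewrite ler_pM2l// (le_trans hv)// lerDl.
  have sum (x y z : R) : x * y <= x * z -> x * (28 * z) <= e -> (1 + 14 * x) * y <= y + e / 2.
    by clear; lra.
  exact: sum h5 r2.
have -> : Wr B v + e = Wr B v + e / 2 + e / 2 by rewrite -addrA -splitr.
by apply: le_trans h _; exact: lerD.
Qed.

Lemma L2norm_unitP u : L2T u -> ((L2norm u ^+ 2)%E = 1%:E) <-> sqnorm u = 1.
Proof.
by move=> u2; rewrite L2norm_sqr esqnormE//; split => [[]|->].
Qed.

Lemma W_le_J B u : L2T u -> sqnorm u = 1 -> (W B u <= J B 1)%E.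
Proof.
move=> u2 u1; apply: ereal_sup_ubound; exists u => //; split => //.
by apply/L2norm_unitP.
Qed.

(** Equal weights on N + 1 consecutive modes: |c n|^2 = 1 / (2 pi (N + 1)), so the mass is 1 / (2
    pi) and the resonant main term is 4 pi B (2 pi)^-2 = B / pi. *)
Lemma vanishing_sequence B : 0 < B -> exists u_ : nat -> R -> R[i],
  [/\ forall N, L2T (u_ N), forall N, sqnorm (u_ N) = 1,
      Wr B (u_ N) @[N --> \oo] --> B / pi &
      forall N n, cmod (fourier_coef (u_ N) n) ^+ 2 <= N.+1%:R^-1].
Proof.
move=> B0; have p2 := @pi2_gt0 R; have p0 := @pi_gt0 R.
pose s N : seq int := [seq i%:Z | i <- iota 0 N.+1].
have us N : uniq (s N) by rewrite map_inj_uniq ?iota_uniq// => i j [].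
pose a N : R := (2 * pi * N.+1%:R)^-1.
have a0 N : 0 < a N by rewrite invr_gt0 mulr_gt0.
pose c N n : R[i] := (Num.sqrt (a N))%:C.
have cE N n : cmod (c N n) ^+ 2 = a N.
  by rewrite cmodC real_normK ?num_real// sqr_sqrtr// ltW.
have mE N : 2 * pi * mass (s N) (c N) = 1.
  rewrite /mass; under eq_bigr do rewrite cE.
  rewrite big_const_seq count_predT size_map size_iota iter_addr_0 -[a N *+ _]mulr_natr.
  by rewrite mulrCA mulVf// gt_eqF// mulr_gt0.
exists (fun N => tpoly (s N) (c N)); split.
- by move=> N; exact: L2T_tpoly.
- by move=> N; rewrite sqnorm_tpoly//; exact: mE.
- apply/cvgrPdist_le => e e0.
  have [K K0 hK] := quartic_vanishing B0 (divr_gt0 e0 (ltr0Sn R 1)).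
  near=> N; rewrite distrC Wr_tpoly//.
  have ca : {in s N, forall n, cmod (c N n) ^+ 2 <= a N} by move=> n _; rewrite cE.
  have := hK (s N) (c N) (a N) (us N) (ltW (a0 N)) ca.
  have mE' : mass (s N) (c N) = (2 * pi)^-1.
    by apply: (@mulfI _ (2 * pi)); rewrite ?mE ?mulfV// gt_eqF.
  have -> : 4 * pi * B * mass (s N) (c N) ^+ 2 = B / pi.
    by move: p0; rewrite mE'; move: pi => q q0; field; rewrite gt_eqF.
  move=> /le_trans; apply; rewrite mE'.
  have i2 : (2 * pi)^-1 <= 1 :> R.
    by rewrite invf_le1//; have := @pi_ge2 R; lra.
  have i20 : 0 <= (2 * pi)^-1 :> R by rewrite invr_ge0 ltW.
  have h1 : e / 2 * (2 * pi)^-1 ^+ 2 <= e / 2.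
    by rewrite ler_piMr ?exprn_ile1// divr_ge0// ltW.
  have h2 : K * a N * (2 * pi)^-1 <= e / 2.
    apply: (@le_trans _ _ (K * a N)); first by rewrite ler_piMr// mulr_ge0// ltW.
    rewrite /a invfM mulrA; apply: (@le_trans _ _ (K * N.+1%:R^-1)).
      by rewrite -mulrA ler_wpM2l// ler_piMl ?invr_ge0.
    rewrite ler_pdivrMr// mulrC -ler_pdivrMr ?divr_gt0//.
    apply: ltW; apply: lt_le_trans (truncnS_gt _) _; rewrite ler_nat ltnS.
    by near: N; exact: nbhs_infty_ge.
  by rewrite [leRHS]splitr lerD.
- move=> N n; rewrite fourier_coef_tpoly//; case: ifP => _; last first.
    by rewrite cmod0 expr0n invr_ge0.
  rewrite cE lef_pV2 ?posrE ?mulr_gt0// ler_peMl//.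
  by have := @pi_ge2 R; lra.
Unshelve. all: by end_near. Qed.

End maximization.

Section supremum.
Context {R : realType}.
Implicit Types (u v : R -> R[i]) (s : seq int) (c : int -> R[i]) (B e : R) (n : int).

Lemma L2T_unit_sqnorm u : L2T u -> (L2norm u ^+ 2)%E = 1%:E -> sqnorm u = 1.
Proof. by move=> u2; move/(L2norm_unitP u2). Qed.

Lemma J_ge B : 0 < B -> ((B / pi)%:E <= J B 1)%E.
Proof.
move=> B0; have [u_ [u2 u1 cW _]] := vanishing_sequence B0.
have cW' : (Wr B (u_ N))%:E @[N --> \oo] --> (B / pi)%:E.
  by apply/fine_cvgP; split; [exact: nearW|exact: cW].
rewrite -(cvg_lim _ cW')//; apply: lime_le; first exact: cvgP cW'.
by apply: nearW => N; rewrite -WrE//; exact: W_le_J.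
Qed.

Lemma J_fin B : 0 < B -> J B 1 \is a fin_num.
Proof.
move=> B0; have [C C0 hC] := W_strichartz B0.
rewrite ge0_fin_numE; last by apply: le_trans (J_ge B0); rewrite lee_fin divr_ge0 ?pi_ge0// ltW.
apply: (@le_lt_trans _ _ C%:E); last exact: ltry.
apply: ge_ereal_sup => _ [u [u2 u1] <-].
by apply: le_trans (hC u u2) _; rewrite (L2T_unit_sqnorm u2 u1) expr1n mulr1.
Qed.

Definition Jr B : R := fine (J B 1).

Lemma JrE B : 0 < B -> J B 1 = (Jr B)%:E.
Proof. by move=> B0; rewrite /Jr fineK// J_fin. Qed.

Lemma Wr_le_Jr B u : 0 < B -> L2T u -> sqnorm u = 1 -> Wr B u <= Jr B.
Proof. by move=> B0 u2 u1; rewrite -lee_fin -WrE// -JrE//; exact: W_le_J. Qed.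

(** Homogeneity of degree four: rescaling to norm one, by 1 / sqrt x, multiplies the form by x^-2.
    Zero mass cannot be rescaled and is covered by the crude bound. *)
Lemma quartic_le_Jr B s c : 0 < B -> uniq s ->
  quartic B s c <= Jr B * (2 * pi * mass s c) ^+ 2.
Proof.
move=> B0 us; have := mass_ge0 s c; rewrite le_eqVlt => /predU1P[m0|m0].
  have [C C0 hC] := @quartic_bounded R B B0; have := hC s c us.
  by rewrite -m0 !mulr0 expr0n !mulr0.
set x := 2 * pi * mass s c; have x0 : 0 < x by rewrite mulr_gt0// pi2_gt0.
pose z : R := (Num.sqrt x)^-1.
have z2 : z ^+ 2 = x^-1 by rewrite exprVn sqr_sqrtr// ltW.
have := @Wr_le_Jr B (tpoly s (fun n => z%:C * c n)) B0 (L2T_tpoly _ _).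
rewrite Wr_tpoly// quarticZ sqnorm_tpoly// -/(mass s _) massZ mulrCA -/x z2.
rewrite mulVf ?gt_eqF// => /(_ erefl).
rewrite (_ : 4 = 2 * 2)%N// exprM z2 exprVn.
by rewrite mulrC ler_pdivrMr ?exprn_gt0.
Qed.

Lemma L2normE u : L2T u -> L2norm u = (Num.sqrt (sqnorm u))%:E.
Proof.
move=> u2; rewrite /L2norm -[X in (X `^ _)%E]/(esqnorm u) esqnormE//.
by rewrite poweR12_sqrt// lee_fin sqnorm_ge0.
Qed.

Lemma L2cvgP (u_ : nat -> R -> R[i]) u : (forall k, L2T (u_ k)) -> L2T u ->
  L2cvg u_ u <-> (forall e, 0 < e -> \forall k \near \oo, sqnorm (fun x => u_ k x - u x) <= e).
Proof.
move=> u_2 u2; rewrite /L2cvg.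
have -> : (fun k => L2norm (fun x => u_ k x - u x)) =
    (fun k => (Num.sqrt (sqnorm (fun x => u_ k x - u x)))%:E).
  by apply/funext => k; rewrite L2normE//; apply: L2TB.
split.
- move=> /fine_cvgP[_ /cvgrPdist_le h] e e0.
  have := h (Num.sqrt e); rewrite sqrtr_gt0 => /(_ e0).
  apply: filterS => k /=; rewrite sub0r normrN ger0_norm ?sqrtr_ge0//.
  by rewrite ler_sqrt// ltW.
- move=> h; apply/fine_cvgP; split; first exact: nearW.
  apply/cvgrPdist_le => e e0; have e20 : 0 < e ^+ 2 by rewrite exprn_gt0.
  have := h _ e20; apply: filterS => k hk /=; rewrite sub0r normrN ger0_norm ?sqrtr_ge0//.
  by rewrite -(ger0_norm (ltW e0)) -sqrtr_sqr ler_wsqrtr.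
Qed.

Lemma L2T_translate (m : int) u : L2T u -> L2T (fourier_translate m u).
Proof. exact: L2T_modeM. Qed.

Lemma fourier_coef_translate (m : int) u n :
  fourier_coef (fourier_translate m u) n = fourier_coef u (n - m).
Proof. exact: fourier_coef_modeM. Qed.

Lemma sqnorm_translate (m : int) u : sqnorm (fourier_translate m u) = sqnorm u.
Proof.
apply: eq_Rintegral => x _.
by rewrite /fourier_translate -/(mode m x) cmodM cmod_mode mul1r.
Qed.

Lemma increasing_seq_ge (phi : nat -> nat) : increasing_seq phi ->
  forall k, (k <= phi k)%N.
Proof.
move=> /increasing_seqP h; elim=> // k IH; have := h k.
by rewrite ltEnat => /(leq_ltn_trans IH).
Qed.

(** Translations only shift the Fourier coefficients, so after any translations these still tend to
    0 uniformly. A strong limit would have all coefficients zero, hence norm zero, against norms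
    equal to 1. *)
Lemma no_maximizing_compactness B : 0 < B -> J B 1 = (B / pi)%:E ->
  exists u_ : nat -> R -> R[i],
    maximizing_sequence B 1 u_ /\
    ~ exists (phi : nat -> nat) (theta : nat -> int) (u : R -> R[i]),
        [/\ increasing_seq phi, L2T u &
            L2cvg (fun k => fourier_translate (theta k) (u_ (phi k))) u].
Proof.
move=> B0 JB; have [u_ [u2 u1 cW cu]] := vanishing_sequence B0.
exists u_; split.
  split; first by move=> j; split => //; apply/L2norm_unitP.
  rewrite JB; under eq_fun do rewrite (WrE B0 (u2 _)).
  by apply/fine_cvgP; split; [exact: nearW|exact: cW].
move=> [phi [theta [u [hphi u2' /L2cvgP hcv]]]].
pose v k := fourier_translate (theta k) (u_ (phi k)).
have v2 k : L2T (v k) by exact: L2T_translate.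
have {}hcv := hcv v2 u2'.
have uh n : fourier_coef u n = 0.
  apply: ComplexField.Normc.eq0_normc; apply/eqP; rewrite -sqrf_eq0 eq_le sqr_ge0 andbT.
  apply/ler_addgt0Pr => e e0; rewrite add0r.
  have e4 : 0 < e / 4 by rewrite divr_gt0.
  near \oo => k.
  have h1 : sqnorm (fun x => v k x - u x) <= e / 4 by near: k; exact: hcv.
  have h2 : k.+1%:R^-1 <= e / 4.
    rewrite -[e / 4]invrK lef_pV2 ?posrE ?invr_gt0//.
    apply: ltW; apply: lt_le_trans (truncnS_gt _) _; rewrite ler_nat ltnS.
    by near: k; exact: nbhs_infty_ge.
  have h3 : cmod (fourier_coef (v k) n) ^+ 2 <= e / 4.
    rewrite fourier_coef_translate; apply: le_trans (cu _ _) (le_trans _ h2).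
    by rewrite lef_pV2 ?posrE// ler_nat ltnS increasing_seq_ge.
  have h4 : cmod (fourier_coef (v k) n - fourier_coef u n) ^+ 2 <= e / 4.
    rewrite -fourier_coefB//; apply: le_trans h1.
    apply: le_trans (fourier_coef_sqr_le n (L2TB (v2 k) u2')).
    by rewrite ler_peMl ?sqr_ge0//; have := @pi_ge2 R; lra.
  have := cmod_sqrD_le (fourier_coef (v k) n) (- (fourier_coef (v k) n - fourier_coef u n)).
  rewrite cmodN opprB addrC subrK; lra.
have u0 := fourier_uniqueness u2' uh.
near \oo => k.
have h1 : sqnorm (fun x => v k x - u x) <= 4^-1 by near: k; apply: hcv.
have := sqnormD_le (L2TB (v2 k) u2') u2'; under eq_fun do rewrite subrK.
rewrite u0 sqnorm_translate u1; lra.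
Unshelve. all: by end_near. Qed.

End supremum.

(** * Compactness of maximizing sequences *)

Section extraction.
Context {R : realType}.

Lemma bounded_ultra_cvg (U : set_system nat) (a : nat -> R) (M : R) : UltraFilter U ->
  (forall j, `|a j| <= M) -> exists l, forall e, 0 < e -> U [set j | `|a j - l| <= e].
Proof.
move=> UU aM; have FU : ProperFilter U by exact: ultra_proper.
have cM : compact (`[- M, M]%classic : set R) by exact: segment_compact.
have [|l [_ hl]] := cM (fmap a U) (fmap_proper_filter a FU).
  by apply: (@filterE _ U) => j /=; rewrite in_itv /= -ler_norml.
exists l => e e0; have [//|hC] := in_ultra_setVsetC [set j | `|a j - l| <= e] UU.
have [x [/= hx1 hx2]] : [set y | ~ `|y - l| <= e] `&` ball l e !=set0.
  by apply: hl; [exact: hC|exact: nbhsx_ballx].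
by exfalso; apply: hx1; move: hx2; rewrite /ball /= distrC => /ltW.
Qed.

(** An ultrafilter finer than the filter at infinity provides limits at all frequencies at once.
    Stage k picks an index beyond the previous one where the frequencies of [rng k] are within 1 /
    (k + 1) of their limits; such indices form a member of the ultrafilter. *)
Lemma diagonal_extraction (d : nat -> int -> R[i]) (M : R) :
  (forall j n, cmod (d j n) <= M) ->
  exists (phi : nat -> nat) (c : int -> R[i]), increasing_seq phi /\
    forall n, cmod (d (phi k) n - c n) @[k --> \oo] --> (0 : R).
Proof.
move=> dM; have [U [UU hU]] := @ultraFilterLemma nat (nbhs \oo) _.
have FU : ProperFilter U by exact: ultra_proper.
have /choice[x hx] : forall n, exists l, forall e, 0 < e -> U [set j | `|Re (d j n) - l| <= e].
  by move=> n; apply: (@bounded_ultra_cvg U _ M) => // j; exact: le_trans (ler_Re_cmod _) (dM j n).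
have /choice[y hy] : forall n, exists l, forall e, 0 < e -> U [set j | `|Im (d j n) - l| <= e].
  by move=> n; apply: (@bounded_ultra_cvg U _ M) => // j; exact: le_trans (ler_Im_cmod _) (dM j n).
pose c n := x n +i* y n.
have hc n e : 0 < e -> U [set j | cmod (d j n - c n) <= e].
  move=> e0; have e20 : 0 < e / 2 by rewrite divr_gt0.
  apply: filterS2 (hx n _ e20) (hy n _ e20) => j /= h1 h2.
  apply: le_trans (ler_cmod_ReIm _) _; rewrite !ReImE /= [leRHS]splitr.
  exact: lerD.
have hA k p : exists j, (p < j)%N /\ forall n, n \in rng k -> cmod (d j n - c n) <= k.+1%:R^-1.
  have Up : U [set j | (p < j)%N] by apply: hU; exact: nbhs_infty_gt.
  have Ur (r : seq int) : U [set j | forall n, n \in r -> cmod (d j n - c n) <= k.+1%:R^-1].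
    elim: r => [|n r IH]; first by apply: filterE.
    have e0 : 0 < k.+1%:R^-1 :> R by rewrite invr_gt0.
    apply: filterS2 (hc n _ e0) IH => j /= h1 h2 m; rewrite inE => /predU1P[->//|].
    exact: h2.
  by have [j [h1 h2]] := filter_ex (filterI Up (Ur (rng k))); exists j.
have /choice[g hg] : forall kp : nat * nat, exists j, (kp.2 < j)%N /\
    forall n, n \in rng kp.1 -> cmod (d j n - c n) <= kp.1.+1%:R^-1.
  by move=> [k p]; exact: hA.
pose fix phi k := if k is k'.+1 then g (k, phi k') else g (0%N, 0%N).
exists phi, c; split.
  by apply/increasing_seqP => k /=; have [] := hg (k.+1, phi k).
have hphi k n : n \in rng k -> cmod (d (phi k) n - c n) <= k.+1%:R^-1.
  by case: k => [|k] /=; [have [_] := hg (0, 0)%N|have [_] := hg (k.+1, phi k)]; apply.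
move=> n; apply/cvgrPdist_le => e e0; near=> k.
rewrite sub0r normrN ger0_norm ?cmod_ge0//.
apply: le_trans (hphi k n _) _.
  by rewrite mem_rng; near: k; exact: nbhs_infty_ge.
rewrite -[e]invrK lef_pV2 ?posrE ?invr_gt0//.
apply: ltW; apply: lt_le_trans (truncnS_gt _) _; rewrite ler_nat ltnS.
by near: k; exact: nbhs_infty_ge.
Unshelve. all: by end_near. Qed.

End extraction.

Section compactness.
Context {R : realType}.
Implicit Types (u : R -> R[i]) (r : seq int) (c : int -> R[i]) (d : nat -> int -> R[i])
  (B e : R) (n : int).

Lemma cvg_mass d c r : (forall n, cmod (d j n - c n) @[j --> \oo] --> (0 : R)) ->
  mass r (d j) @[j --> \oo] --> mass r c.
Proof.
move=> dc; have cv n : cmod (d j n) @[j --> \oo] --> cmod (c n).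
  apply/cvgrPdist_le => e e0; have /cvgrPdist_le := dc n => /(_ e e0).
  apply: filterS => j; rewrite sub0r normrN ger0_norm ?cmod_ge0//.
  by apply: le_trans; rewrite distrC ler_cmod_dist.
rewrite /mass; elim: r => [|n r IH].
  by under eq_fun do rewrite big_nil; rewrite big_nil; exact: cvg_cst.
under eq_fun do rewrite big_cons; rewrite big_cons; apply: cvgD => //.
by under eq_fun do rewrite expr2; rewrite expr2; exact: cvgM.
Qed.

Lemma cvg_mass_sub d c r : (forall n, cmod (d j n - c n) @[j --> \oo] --> (0 : R)) ->
  \sum_(n <- r) cmod (c n - d j n) ^+ 2 @[j --> \oo] --> (0 : R).
Proof.
move=> dc; have e0 : mass r (fun=> 0 : R[i]) = 0.
  by rewrite /mass big1// => n _; rewrite cmod0 expr0n.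
have := @cvg_mass (fun j n => c n - d j n) (fun=> 0) r; rewrite e0; apply => n.
have -> : (fun j => cmod (c n - d j n - 0)) = (fun j => cmod (d j n - c n)) => //.
by apply/funext => j; rewrite subr0 -cmodN opprB.
Qed.

Lemma near_le_of_cvg (a : nat -> R) (l e : R) : a j @[j --> \oo] --> l -> 0 < e ->
  \forall j \near \oo, a j <= l + e.
Proof.
move=> /cvgrPdist_le h e0; have := h e e0; apply: filterS => j.
by rewrite ler_norml => /andP[h1 h2]; lra.
Qed.

Lemma near_ge_of_cvg (a : nat -> R) (l e : R) : a j @[j --> \oo] --> l -> 0 < e ->
  \forall j \near \oo, l - e <= a j.
Proof.
move=> /cvgrPdist_le h e0; have := h e e0; apply: filterS => j.
by rewrite ler_norml => /andP[h1 h2]; lra.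
Qed.

Lemma mass_subset c r r' : uniq r -> uniq r' -> {subset r <= r'} -> mass r c <= mass r' c.
Proof. by move=> ur ur' rr'; apply: ler_sum_subset => // n; exact: sqr_ge0. Qed.

(* Strict subadditivity: [x] and [y] are the masses of the two pieces of a split
   sequence, [J] the maximum, and [2 k x y] the interaction of the pieces. *)
Lemma dichotomy_gap (J k x y a t err : R) : 0 <= k -> k <= J -> 0 <= x -> 0 <= y -> x + y <= 1 ->
  0 <= a <= 1 -> `|x - a| <= a * (1 - a) / 2 ->
  J - t <= J * x ^+ 2 + J * y ^+ 2 + 2 * k * x * y + err ->
  (J - k) * (a * (1 - a)) <= t + err.
Proof.
move=> k0 kJ x0 y0 xy /andP[a0 a1]; rewrite ler_norml => /andP[h1 h2] h.
have y1 : y <= 1 - x by lra.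
have hy2 : y ^+ 2 <= (1 - x) ^+ 2 by rewrite lerXn2r ?nnegrE//; lra.
have hxy : x * y <= x * (1 - x) by rewrite ler_wpM2l.
have J0 : 0 <= J by lra.
have e1 : J * y ^+ 2 <= J * (1 - x) ^+ 2 by rewrite ler_wpM2l.
have e2 : k * (x * y) <= k * (x * (1 - x)) by rewrite ler_wpM2l.
(* With y replaced by 1 - x, J x^2 + J (1 - x)^2 = J - 2 J x (1 - x), so the gap J - k appears with
   weight 2 x (1 - x). *)
have e3 : 2 * (J - k) * (x * (1 - x)) <= t + err by lra.
have e4 : a * (1 - a) / 2 <= x * (1 - x).
  have -> : x * (1 - x) = a * (1 - a) + (x - a) * (1 - x - a) by ring.
  have : `|(x - a) * (1 - x - a)| <= a * (1 - a) / 2.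
    rewrite normrM -[leRHS]mulr1 ler_pM// ?ler_norml; apply/andP; split; lra.
  by rewrite ler_norml => /andP[h3 _]; lra.
have : (J - k) * (a * (1 - a) / 2) <= (J - k) * (x * (1 - x)) by rewrite ler_wpM2l// subr_ge0.
lra.
Qed.

Lemma one_le_pi2 : 1 <= 2 * pi :> R.
Proof. by have := @pi_ge2 R; lra. Qed.

(** Here [x] and [y] are the masses of the truncation inside and outside a ball, [r] and [s] the
    masses on the ball of the sequence and of its limit, and [a] the total mass of the limit. The
    hypotheses give a - 3 t <= x <= a + t. *)
Lemma mass_balance (x y r s a t b : R) : y + r <= 1 -> s - t <= r -> a - t <= s ->
  x <= a + t -> 1 - t <= x + y -> t <= b / 8 -> 0 < b -> `|x - a| <= b / 2.
Proof. by move=> *; rewrite ler_norml; apply/andP; split; lra. Qed.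

(** The two bounds together say q <= q/4 + q/4. *)
Lemma no_gap (q t K : R) : q <= t + (q / 4 + K * (2 * t)) ->
  t * (4 * (1 + 2 * K)) <= q -> 0 < q -> False.
Proof. by move=> *; lra. Qed.

(** 1 - m <= e/4, q <= e/8 and 1 - S <= e/8 add up to 2 (3 e/8) + 2 (e/8) = e. The product [z * 0]
    is a limit in the form in which the product rule delivers it. *)
Lemma sqnorm_budget (S m q e z : R) : S - e / 8 <= m -> q <= z * 0 + e / 8 -> 1 - e / 8 <= S ->
  2 * (1 - m + q) + 2 * (1 - S) <= e.
Proof. by rewrite mulr0 => *; lra. Qed.

Lemma two_halves (a b t : R) : a <= t / 4 -> b <= t / 4 -> 2 * a + 2 * b <= t.
Proof. by move=> *; lra. Qed.

(** * The limit profile: no loss of mass, hence strong convergence *)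

Section profile.
Variables (B : R) (v_ : nat -> R -> R[i]) (s_ : nat -> seq int) (c : int -> R[i]).
Hypothesis B0 : 0 < B.
Hypothesis gap : B / pi < Jr B.
Hypothesis v2 : forall j, L2T (v_ j).
Hypothesis v1 : forall j, sqnorm (v_ j) = 1.
Hypothesis us : forall j, uniq (s_ j).
Let d j := fourier_coef (v_ j).
(** The quartic form is defined on finite lists, so each term of the sequence comes with a
    truncation that captures almost all of its norm and almost the maximal value. *)
Hypothesis hs : forall e, 0 < e -> \forall j \near \oo, 1 - e <= 2 * pi * mass (s_ j) (d j).
Hypothesis hq : forall e, 0 < e -> \forall j \near \oo, Jr B - e <= quartic B (s_ j) (d j).
Hypothesis hc : forall n, cmod (d j n - c n) @[j --> \oo] --> (0 : R).
Hypothesis c0 : c 0 != 0.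

Let p2 : 0 < 2 * pi :> R := pi2_gt0.

Let sigma L : R := 2 * pi * mass (rng L) c.

Lemma profile_mass_le r : uniq r -> 2 * pi * mass r c <= 1.
Proof.
move=> ur; have cv : 2 * pi * mass r (d j) @[j --> \oo] --> 2 * pi * mass r c.
  by apply: cvgMl_tmp; exact: cvg_mass.
rewrite -(cvg_lim _ cv)//; apply: limr_le; first exact: cvgP cv.
by apply: nearW => j; rewrite -[leRHS](v1 j); exact: bessel ur (v2 j).
Qed.

Lemma profile_ell2 : ell2 c.
Proof.
exists (2 * pi)^-1 => r ur.
by rewrite -[leRHS]mulr1 ler_pdivlMl// profile_mass_le.
Qed.

Lemma profile_mass_mono L L' : (L <= L')%N -> sigma L <= sigma L'.
Proof.
move=> LL'; rewrite ler_pM2l// mass_subset ?rng_uniq// => n; rewrite !mem_rng.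
by move/leq_trans; apply.
Qed.

(** Let [a] be the total mass of the limit, positive because [c 0] is nonzero. If a < 1, the
    sequence splits at a large radius into pieces of masses near a and 1 - a with almost nothing in
    between, and [dichotomy_gap] contradicts the strict gap. *)
Lemma profile_full_mass t : 0 < t -> exists L, 1 - t <= sigma L.
Proof.
move=> t0; pose A := range sigma.
have hA : has_sup A.
  split; first by exists (sigma 0%N); exists 0%N.
  by exists 1 => _ [L _ <-]; apply: profile_mass_le; exact: rng_uniq.
set a := sup A; have aA L : sigma L <= a by apply: (ub_le_sup hA.2); exists L.
have a1 : a <= 1.
  by apply: ge_sup; [exact: hA.1|move=> _ [L _ <-]; apply: profile_mass_le; exact: rng_uniq].
have a0 : 0 < a.
  apply: lt_le_trans (aA 0%N); rewrite /sigma mulr_gt0//.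
  rewrite /mass /rng /= big_seq1 subrr exprn_gt0// lt_neqAle cmod_ge0 andbT eq_sym.
  by apply: contra c0 => /eqP/ComplexField.Normc.eq0_normc ->.
have [a_1|a_1] := eqVneq a 1.
  by have [_ [L _ <-]] := sup_adherent t0 hA; rewrite -/a a_1 => h; exists L; exact: ltW.
have {}a_1 : a < 1 by rewrite lt_neqAle a_1.
exfalso; pose b := a * (1 - a); have b0 : 0 < b by rewrite mulr_gt0// subr_gt0.
pose g := Jr B - B / pi; have g0 : 0 < g by rewrite subr_gt0.
have gb0 : 0 < g * b by rewrite mulr_gt0.
have [|w [K K0 hK]] := @quartic_split R B (g * b / 4) B0; first by rewrite divr_gt0.
(* The entry b/8 is what [mass_balance] requires, the other what [no_gap] requires. *)
pose t1 := Num.min (b / 8) (g * b / (4 * (1 + 2 * K))).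
have K1 : 0 < 1 + 2 * K by rewrite ltr_wpDr ?mulr_ge0.
have t10 : 0 < t1 by rewrite lt_min !divr_gt0// mulr_gt0.
have t1b : t1 <= b / 8 by rewrite ge_min lexx.
have t1K : t1 * (4 * (1 + 2 * K)) <= g * b.
  by rewrite -ler_pdivlMr ?mulr_gt0// ge_min lexx orbT.
have [_ [L0 _ <-] hL0] := sup_adherent t10 hA; rewrite -/a in hL0.
(* With this shift the shell about [L] avoids the ball of radius [L0], which already holds all but
   [t1] of the limit mass; so the shell is light in the limit. *)
pose L := (L0 + w)%N.
have hL M : (L0 <= M)%N -> a - t1 <= sigma M.
  by move=> h; apply: ltW (lt_le_trans hL0 (profile_mass_mono h)).
have cm r : 2 * pi * mass r (d j) @[j --> \oo] --> 2 * pi * mass r c.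
  by apply: cvgMl_tmp; exact: cvg_mass.
pose ann := [seq n <- rng (L + w) | annulus w L n].
have hann : 2 * pi * mass ann c <= t1.
  have : 2 * pi * (mass ann c + mass (rng L0) c) <= sigma (L + w).
    rewrite ler_pM2l// /mass -big_cat /=; apply: mass_subset; rewrite ?rng_uniq//.
    - rewrite cat_uniq rng_uniq filter_uniq ?rng_uniq// andbT.
      apply/hasPn => n; rewrite mem_rng mem_filter /annulus => h.
      by rewrite /L ltn_add2r ltnNge h.
    - move=> n; rewrite mem_cat mem_filter !mem_rng => /orP[/andP[_]//|] h.
      by rewrite /L -addnA (leq_trans h)// leq_addr.
  have := aA (L + w)%N; have := hL L0 (leqnn _); rewrite /sigma mulrDr; lra.
near \oo => j.
have H1 : 1 - t1 <= 2 * pi * mass (s_ j) (d j) by near: j; exact: hs.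
have H2 : Jr B - t1 <= quartic B (s_ j) (d j) by near: j; exact: hq.
have H3 : sigma L - t1 <= 2 * pi * mass (rng L) (d j) by near: j; apply: near_ge_of_cvg.
have H4 : 2 * pi * mass (rng L) (d j) <= sigma L + t1 by near: j; apply: near_le_of_cvg.
have H5 : 2 * pi * mass ann (d j) <= 2 * pi * mass ann c + t1 by near: j; apply: near_le_of_cvg.
have bes r : uniq r -> 2 * pi * mass r (d j) <= 1.
  by move=> ur; rewrite -[leRHS](v1 j); exact: bessel ur (v2 j).
pose s1 := [seq n <- s_ j | in_ball L n]; pose s2 := [seq n <- s_ j | ~~ in_ball L n].
have us1 : uniq s1 by rewrite filter_uniq.
have us2 : uniq s2 by rewrite filter_uniq.
have ms : mass (s_ j) (d j) = mass s1 (d j) + mass s2 (d j) by exact: big_filterC.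
have hx1 : mass s1 (d j) <= mass (rng L) (d j).
  by apply: mass_subset => //; [exact: rng_uniq|move=> n; rewrite mem_filter mem_rng => /andP[]].
have hx2 : 2 * pi * (mass s2 (d j) + mass (rng L) (d j)) <= 1.
  have := bes (s2 ++ rng L); rewrite /mass big_cat /=; apply.
  rewrite cat_uniq us2 rng_uniq andbT; apply/hasPn => n; rewrite mem_rng mem_filter /in_ball => ->.
  by [].
have hAn : \sum_(n <- s_ j | annulus w L n) cmod (d j n) ^+ 2 <= mass ann (d j).
  rewrite -big_filter; apply: mass_subset; rewrite ?filter_uniq ?rng_uniq//.
  move=> n; rewrite !mem_filter => /andP[h _]; rewrite h mem_rng.
  by move: h; rewrite /annulus => /andP[].
have := hK L (s_ j) (d j) (us j); rewrite -/s1 -/s2 => hsplit.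
have := bes (s_ j) (us j) => hm1.
have Q1 := quartic_le_Jr (d j) B0 us1; have Q2 := quartic_le_Jr (d j) B0 us2.
set x := 2 * pi * mass s1 (d j) in Q1; set y := 2 * pi * mass s2 (d j) in Q2.
have x0 : 0 <= x by rewrite mulr_ge0 ?mass_ge0 ?(ltW p2).
have y0 : 0 <= y by rewrite mulr_ge0 ?mass_ge0 ?(ltW p2).
have xyE : 2 * pi * mass (s_ j) (d j) = x + y by rewrite ms mulrDr.
have xy1 : x + y <= 1 by rewrite -xyE.
have xa : `|x - a| <= a * (1 - a) / 2.
  have k1 : x <= a + t1.
    apply: (@le_trans _ _ (2 * pi * mass (rng L) (d j))); first by rewrite ler_pM2l.
    by apply: le_trans H4 _; rewrite lerD2r.
  have k2 : y + 2 * pi * mass (rng L) (d j) <= 1 by rewrite -mulrDr.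
  by apply: (mass_balance k2 H3 (hL L (leq_addr _ _)) k1 _ t1b b0); rewrite -xyE.
have M1 : mass (s_ j) (d j) <= 1.
  apply: le_trans hm1; rewrite ler_peMl ?mass_ge0//.
  exact: one_le_pi2.
have E1 : g * b / 4 * mass (s_ j) (d j) ^+ 2 <= g * b / 4.
  by rewrite ler_piMr ?exprn_ile1 ?mass_ge0// divr_ge0// ltW.
have A1 : mass ann (d j) <= 2 * t1.
  apply: (@le_trans _ _ (2 * pi * mass ann (d j))).
    by rewrite ler_peMl ?mass_ge0//; exact: one_le_pi2.
  by rewrite [2 * t1]mulr_natl mulr2n; apply: le_trans H5 _; rewrite lerD2r.
have E2 : K * mass (s_ j) (d j) * (\sum_(n <- s_ j | annulus w L n) cmod (d j n) ^+ 2) <= K * (2 * t1).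
  apply: ler_pM; rewrite ?mulr_ge0 ?mass_ge0 ?sumr_ge0//.
    by move=> n _; exact: sqr_ge0.
  - by rewrite ler_piMr.
  - exact: le_trans hAn A1.
(* In the normalized masses x and y, which contain the factor 2 pi, the interaction constant 8 pi B
   becomes 2 (B / pi). *)
have E3 : 8 * pi * B * mass s1 (d j) * mass s2 (d j) = 2 * (B / pi) * x * y.
  have pi0 : pi != 0 :> R by rewrite gt_eqF// pi_gt0.
  rewrite /x /y -[in LHS](divfK pi0 B); ring.
have k0 : 0 <= B / pi by rewrite divr_ge0 ?pi_ge0// ltW.
have main := @dichotomy_gap (Jr B) (B / pi) x y a t1 (g * b / 4 + K * (2 * t1))
  k0 (ltW gap) x0 y0 xy1 _ xa _.
have {}main : g * b <= t1 + (g * b / 4 + K * (2 * t1)).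
  apply: main; first by rewrite ltW.
  apply: le_trans H2 (le_trans hsplit _); rewrite E3.
  rewrite [leRHS]addrA; apply: lerD => //; apply: lerD => //; rewrite lerD2r.
  exact: lerD.
exact: no_gap main t1K gb0.
Unshelve. all: by end_near. Qed.

(** Coefficientwise convergence without loss of norm is strong convergence. The truncations then
    converge to [u0] as well, and uniform continuity transfers their nearly maximal values to it. *)
Lemma profile_strong_limit : exists u0, [/\ L2T u0, sqnorm u0 = 1, Wr B u0 = Jr B &
  forall e, 0 < e -> \forall j \near \oo, sqnorm (fun x => v_ j x - u0 x) <= e].
Proof.
have [u0 [u2 uc _]] := riesz_fischer profile_ell2.
have uc' : fourier_coef u0 = c by exact/funext.
have u1 : sqnorm u0 = 1.
  apply/eqP; rewrite eq_le; apply/andP; split; apply/ler_addgt0Pr => e e0.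
    have [M hM] := plancherel u2 e0.
    have := hM (rng M) (rng_uniq M) (fun _ h => h).
    rewrite sqnorm_sub_partial ?rng_uniq// uc' lerBlDr => h; apply: le_trans h _.
    by rewrite addrC lerD2r; apply: profile_mass_le; exact: rng_uniq.
  have [L hL] := profile_full_mass e0; rewrite -lerBlDr; apply: le_trans hL _.
  by have := bessel (rng_uniq L) u2; rewrite uc'.
have conv e : 0 < e -> \forall j \near \oo, sqnorm (fun x => v_ j x - u0 x) <= e.
  move=> e0; have e8 : 0 < e / 8 by rewrite divr_gt0.
  have [L hL] := profile_full_mass e8.
  have cm : 2 * pi * mass (rng L) (d j) @[j --> \oo] --> sigma L.
    by apply: cvgMl_tmp; exact: cvg_mass.
  have cs : 2 * pi * (\sum_(n <- rng L) cmod (c n - d j n) ^+ 2) @[j --> \oo] --> (2 * pi * 0 : R).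
    by apply: cvgMl_tmp; exact: cvg_mass_sub.
  near=> j.
  have H1 : sigma L - e / 8 <= 2 * pi * mass (rng L) (d j) by near: j; apply: near_ge_of_cvg.
  have H2 : 2 * pi * (\sum_(n <- rng L) cmod (c n - d j n) ^+ 2) <= 2 * pi * 0 + e / 8.
    by near: j; apply: near_le_of_cvg.
  have T1 : sqnorm (fun x => v_ j x - tpoly (rng L) c x) =
      1 - 2 * pi * mass (rng L) (d j) + 2 * pi * (\sum_(n <- rng L) cmod (c n - d j n) ^+ 2).
    rewrite sqnorm_sub_tpoly ?rng_uniq// v1 big_split /= sumrN mulrDr /mass; ring.
  have T2 : sqnorm (fun x => tpoly (rng L) c x - u0 x) = 1 - sigma L.
    by rewrite sqnorm_subC -uc' sqnorm_sub_partial ?rng_uniq// u1 uc'.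
  apply: le_trans (sqnorm_trans_le (v2 j) (L2T_tpoly (rng L) c) u2) _.
  rewrite T1 T2; exact: sqnorm_budget H1 H2 hL.
exists u0; split => //; apply/eqP; rewrite eq_le Wr_le_Jr//=.
apply/ler_addgt0Pr => e e0; have e20 : 0 < e / 2 by rewrite divr_gt0.
have [t t0 ht] := Wr_uniformly_continuous B0 e20.
have t4 : 0 < t / 4 by rewrite divr_gt0.
near \oo => j.
have H1 : Jr B - e / 2 <= quartic B (s_ j) (d j) by near: j; exact: hq.
have H2 : 1 - t / 4 <= 2 * pi * mass (s_ j) (d j) by near: j; exact: hs.
have H3 : sqnorm (fun x => v_ j x - u0 x) <= t / 4 by near: j; exact: conv.
have T2 := L2T_tpoly (s_ j) (d j).
have H4 : sqnorm (fun x => tpoly (s_ j) (d j) x - v_ j x) <= t / 4.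
  by rewrite sqnorm_subC sqnorm_sub_partial// v1 lerBlDr addrC -lerBlDr.
have H5 : sqnorm (fun x => tpoly (s_ j) (d j) x - u0 x) <= t.
  by apply: le_trans (sqnorm_trans_le T2 (v2 j) u2) _; exact: two_halves.
have := ht _ _ T2 u2 _ H5; rewrite u1 lexx Wr_tpoly// => /(_ isT) H6.
rewrite [e in leRHS]splitr addrA -lerBlDr; exact: le_trans H1 H6.
Unshelve. all: by end_near. Qed.

End profile.
End compactness.

(** * From maximizing sequences to a profile *)

Section maximizing_sequences.
Context {R : realType}.
Implicit Types (u : R -> R[i]) (B : R).

Lemma vanishing_gap (Jm k q a b m : R) : Jm - (Jm - k) / 4 <= q -> q <= a + b + m ->
  a <= (Jm - k) / 4 -> b <= (Jm - k) / 4 -> m <= k -> k < Jm -> False.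
Proof. by move=> *; lra. Qed.

Lemma maximizing_sequence_compact B (u_ : nat -> R -> R[i]) : 0 < B -> B / pi < Jr B ->
  (forall j, L2T (u_ j)) -> (forall j, sqnorm (u_ j) = 1) ->
  Wr B (u_ j) @[j --> \oo] --> Jr B ->
  exists (phi : nat -> nat) (theta : nat -> int) (u0 : R -> R[i]),
    [/\ increasing_seq phi, L2T u0, sqnorm u0 = 1, Wr B u0 = Jr B &
        forall e, 0 < e -> \forall k \near \oo,
          sqnorm (fun x => fourier_translate (theta k) (u_ (phi k)) x - u0 x) <= e].
Proof.
move=> B0 gap u2 u1 cW; have p2 := @pi2_gt0 R.
pose c j := fourier_coef (u_ j).
have /choice[M_ hM] : forall j, exists M,
    sqnorm (fun x => u_ j x - tpoly (rng M) (c j) x) <= j.+1%:R^-1.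
  move=> j; have [|M hM] := @plancherel R (u_ j) j.+1%:R^-1 (u2 j).
    by rewrite invr_gt0.
  by exists M; apply: hM => //; exact: rng_uniq.
have inv_small e : 0 < e -> \forall j \near \oo, j.+1%:R^-1 <= e :> R.
  move=> e0; near=> j; rewrite -[e]invrK lef_pV2 ?posrE ?invr_gt0//.
  apply: ltW; apply: lt_le_trans (truncnS_gt _) _; rewrite ler_nat ltnS.
  by near: j; exact: nbhs_infty_ge.
have hm e : 0 < e -> \forall j \near \oo, 1 - e <= 2 * pi * mass (rng (M_ j)) (c j).
  move=> e0; near=> j; have := hM j; rewrite sqnorm_sub_partial ?rng_uniq// u1 => h.
  rewrite lerBlDr -lerBlDl; apply: le_trans h _; near: j; exact: inv_small.
have hq e : 0 < e -> \forall j \near \oo, Jr B - e <= quartic B (rng (M_ j)) (c j).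
  move=> e0; have e20 : 0 < e / 2 by rewrite divr_gt0.
  have [t t0 ht] := Wr_uniformly_continuous B0 e20.
  near=> j; have T2 := L2T_tpoly (rng (M_ j)) (c j).
  have H1 : Jr B - e / 2 <= Wr B (u_ j) by near: j; apply: near_ge_of_cvg.
  have H2 : sqnorm (fun x => u_ j x - tpoly (rng (M_ j)) (c j) x) <= t.
    by apply: le_trans (hM j) _; near: j; exact: inv_small.
  have b1 : sqnorm (tpoly (rng (M_ j)) (c j)) <= 1.
    by rewrite sqnorm_tpoly ?rng_uniq// -[leRHS](u1 j); exact: bessel (rng_uniq _) (u2 j).
  have := ht _ _ (u2 j) T2 b1 H2; rewrite Wr_tpoly ?rng_uniq// => H3.
  by rewrite [e]splitr opprD addrA lerBlDr; exact: le_trans H1 H3.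
have [delta dl0 [N _ hN]] : exists2 dl : R, 0 < dl & \forall j \near \oo,
    exists n, dl < cmod (c j n) ^+ 2.
  pose g := Jr B - B / pi; have g0 : 0 < g by rewrite subr_gt0.
  have g4 : 0 < g / 4 by rewrite divr_gt0.
  have [K K0 hK] := quartic_vanishing B0 g4.
  have K1 : 0 < K + 1 by rewrite ltr_wpDl.
  (* If every |c j n|^2 were at most [dl], the two error terms would be at most g/4 each, leaving Jr
     - g/4 <= B/pi + g/2, which is impossible. *)
  pose dl := g / (4 * (K + 1)); have dl0 : 0 < dl by rewrite divr_gt0 ?mulr_gt0.
  exists dl => //; near=> j; apply: contrapT => /forallNP hn.
  have cd : {in rng (M_ j), forall n, cmod (c j n) ^+ 2 <= dl}.
    by move=> n _; rewrite leNgt; apply/negP; exact: hn.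
  have H1 : Jr B - g / 4 <= quartic B (rng (M_ j)) (c j) by near: j; exact: hq.
  have := hK _ (c j) dl (rng_uniq _) (ltW dl0) cd.
  have m0 := mass_ge0 (rng (M_ j)) (c j).
  have m1 : 2 * pi * mass (rng (M_ j)) (c j) <= 1.
    by rewrite -[leRHS](u1 j); exact: bessel (rng_uniq _) (u2 j).
  have m2 : mass (rng (M_ j)) (c j) <= 1.
    by apply: le_trans m1; rewrite ler_peMl// one_le_pi2.
  rewrite ler_norml => /andP[_]; rewrite lerBlDr => H2.
  set S := mass _ _ in m0 m1 m2 H2.
  have E1 : g / 4 * S ^+ 2 <= g / 4 by rewrite ler_piMr ?exprn_ile1// ltW.
  have E2 : K * dl * S <= g / 4.
    apply: (@le_trans _ _ (K * dl)); first by rewrite ler_piMr// mulr_ge0// ltW.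
    have -> : g / 4 = dl * (K + 1) by rewrite /dl invfM mulrA divfK// gt_eqF.
    by rewrite mulrC ler_pM2l// lerDl.
  have E3 : 4 * pi * B * S ^+ 2 <= B / pi.
    have pi0 : pi != 0 :> R by rewrite gt_eqF// pi_gt0.
    have -> : 4 * pi * B * S ^+ 2 = B / pi * (2 * pi * S) ^+ 2.
      by rewrite -[in LHS](divfK pi0 B); ring.
    by rewrite ler_piMr ?divr_ge0 ?pi_ge0 ?(ltW B0)// exprn_ile1// mulr_ge0// ltW.
  exact: vanishing_gap H1 H2 E1 E2 E3 gap.
(* The frequency [nu j] carries squared modulus above [delta] and is about to be moved to 0; before
   rank [N] the value 0 is a placeholder. *)
have /choice[nu hnu] : forall j, exists n, (N <= j)%N -> delta < cmod (c j n) ^+ 2.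
  move=> j; case: (leqP N j) => Nj; last by exists 0.
  by have [n hn] := hN j Nj; exists n.
pose d j n := c j (n + nu j).
have dE j : fourier_coef (fourier_translate (- nu j) (u_ j)) = d j.
  by apply/funext => n; rewrite fourier_coef_translate opprK.
have dle j n : cmod (d j n) <= 1.
  rewrite -(@ler_pXn2r _ 2) ?nnegrE ?cmod_ge0// expr1n -[leRHS](u1 j).
  apply: le_trans (fourier_coef_sqr_le (n + nu j) (u2 j)).
  by rewrite ler_peMl ?sqr_ge0 ?one_le_pi2.
have [phi [c0 [hphi hc]]] := diagonal_extraction dle.
have phige := increasing_seq_ge hphi.
pose v k := fourier_translate (- nu (phi k)) (u_ (phi k)).
(* The truncation list moves with the coefficients, so mass and quartic form keep their values. *)
pose s k := [seq n - nu (phi k) | n <- rng (M_ (phi k))].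
have us k : uniq (s k) by rewrite map_inj_uniq ?rng_uniq// => x y /addIr.
have near_phi (P : nat -> Prop) : (\forall j \near \oo, P j) -> \forall k \near \oo, P (phi k).
  move=> [M _ hP]; exists M => // k /= Mk; apply: hP => /=.
  exact: leq_trans Mk (phige k).
have ms k : mass (s k) (d (phi k)) = mass (rng (M_ (phi k))) (c (phi k)).
  by rewrite /mass big_map; apply: eq_bigr => n _; rewrite /d subrK.
have qs k : quartic B (s k) (d (phi k)) = quartic B (rng (M_ (phi k))) (c (phi k)).
  rewrite -(quartic_translate B (rng (M_ (phi k))) (c (phi k)) (- nu (phi k))).
  by congr quartic; apply/funext => n; rewrite opprK.
have [|||||||u0 [h1 h2 h3 h4]] := @profile_strong_limit R B v s c0 B0 gap.
- by move=> k; exact: L2T_translate.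
- by move=> k; rewrite sqnorm_translate.
- exact: us.
- move=> e e0; have := near_phi _ (hm e e0); apply: filterS => k.
  by rewrite dE ms.
- move=> e e0; have := near_phi _ (hq e e0); apply: filterS => k.
  by rewrite dE qs.
- by move=> n; under eq_fun do rewrite dE; exact: hc.
(* The translated coefficient at 0 has modulus above sqrt delta along the whole tail, so its limit
   cannot be zero. *)
- apply/eqP => c00; have /cvgrPdist_lt := hc 0.
  have sd0 : 0 < Num.sqrt delta by rewrite sqrtr_gt0.
  move=> /(_ _ sd0) [M _ hM0]; pose k := maxn M N.
  have := hM0 k (leq_maxl _ _); rewrite c00 subr0 sub0r normrN ger0_norm ?cmod_ge0//.
  have := hnu (phi k) (leq_trans (leq_maxr _ _) (phige k)).
  rewrite -[c _ _]/(c (phi k) (nu (phi k))) /d add0r => h5 h6.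
  have : cmod (c (phi k) (nu (phi k))) ^+ 2 < delta.
    by rewrite -[ltRHS]sqr_sqrtr ?(ltW dl0)// ltr_pXn2r ?nnegrE ?cmod_ge0 ?sqrtr_ge0.
  by rewrite ltNge (ltW h5).
by exists phi, (fun k => - nu (phi k)), u0.
Unshelve. all: by end_near. Qed.

End maximizing_sequences.

Theorem theorem2p1 (R : realType) :
  (forall B : R, 0 < B -> ((B / pi)%:E < J B 1)%E ->
     (forall u_ : nat -> R -> R[i], maximizing_sequence B 1 u_ ->
        exists (phi : nat -> nat) (theta : nat -> int) (u0 : R -> R[i]),
          [/\ increasing_seq phi, maximizer B 1 u0 &
              L2cvg (fun k => fourier_translate (theta k) (u_ (phi k))) u0]) /\
     (exists u0 : R -> R[i],
        [/\ L2T u0, L2norm u0 = 1%E & W B u0 = J B 1])) /\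
  (forall B : R, 0 < B -> ((B / pi)%:E <= J B 1)%E) /\
  (forall B : R, 0 < B -> J B 1 = (B / pi)%:E ->
     exists u_ : nat -> R -> R[i],
       maximizing_sequence B 1 u_ /\
       ~ exists (phi : nat -> nat) (theta : nat -> int) (u : R -> R[i]),
           [/\ increasing_seq phi, L2T u &
               L2cvg (fun k => fourier_translate (theta k) (u_ (phi k))) u]).
Proof.
split; last by split; [exact: J_ge|exact: no_maximizing_compactness].
move=> B B0; rewrite JrE// lte_fin => gap; split.
  move=> u_ [hu cW]; have u2 j : L2T (u_ j) by have [] := hu j.
  have u1 j : sqnorm (u_ j) = 1 by have [h1 h2] := hu j; exact: L2T_unit_sqnorm.
  have {}cW : Wr B (u_ j) @[j --> \oo] --> Jr B.
    move: cW; rewrite JrE//; under eq_fun do rewrite (WrE B0 (u2 _)).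
    by move=> /fine_cvgP[].
  have [phi [theta [u0 [h1 h2 h3 h4 h5]]]] := maximizing_sequence_compact B0 gap u2 u1 cW.
  exists phi, theta, u0; split => //.
    by split => //; [exact/L2norm_unitP|rewrite WrE// JrE// h4].
  by apply/L2cvgP => // k; exact: L2T_translate.
(* The supremum supplies a maximizing sequence, with error 1 / (j + 1); compactness turns it into a
   maximizer. *)
have /choice[u_ hu] : forall j : nat, exists u, [/\ L2T u, sqnorm u = 1 & Jr B - j.+1%:R^-1 < Wr B u].
  move=> j; have e0 : 0 < j.+1%:R^-1 :> R by rewrite invr_gt0.
  have [_ [u [u2 un] <-]] := ub_ereal_sup_adherent e0 (J_fin B0).
  rewrite -/(J B 1) JrE// WrE// -EFinB lte_fin => h; exists u; split => //.
  exact: L2T_unit_sqnorm.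
have u2 j : L2T (u_ j) by have [] := hu j.
have u1 j : sqnorm (u_ j) = 1 by have [] := hu j.
have cW : Wr B (u_ j) @[j --> \oo] --> Jr B.
  apply: (@squeeze_cvgr _ _ _ _ (fun j : nat => Jr B - j.+1%:R^-1) (fun=> Jr B)).
  - apply: nearW => j; have [_ _ h] := hu j.
    by rewrite (ltW h) Wr_le_Jr.
  - rewrite -[X in _ --> X]subr0; apply: cvgB; first exact: cvg_cst.
    exact: cvg_harmonic.
  - exact: cvg_cst.
have [phi [theta [u0 [h1 h2 h3 h4 _]]]] := maximizing_sequence_compact B0 gap u2 u1 cW.
exists u0; split => //; last by rewrite WrE// h4.
by rewrite L2normE// h3 sqrtr1.
Qed.
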